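(* Let $0<H<1$ and $T>0$. For $t\in[0,T]$, $y\in\mathbb R$, the self-intersection local time $$\alpha_t(y):=\lim_{\varepsilon\to0}\iint_{\mathcal D_t} f_\varepsilon(B^H_s-B^H_r-y)\,dr\,ds$$ exists (the limit exists a.s. and in $L^p(\Omega)$ for every $p\in(0,\infty)$), and the process $(y,t)\mapsto\alpha_t(y)$ has a modification which is almost surely jointly Hölder continuous in $(y,t)\in\mathbb R\times[0,T]$ of any order less than $1-H$, and Hölder continuous in $y$ of any order less than $\min(\frac1H-1,1)$. Moreover, for every continuous $g:\mathbb R\to\mathbb R$, almost surely $$\iint_{\mathcal D_t} g(B^H_s-B^H_r)\,dr\,ds=\int_{\mathbb R}g(y)\,\alpha_t(y)\,dy.$$
   Context: $B^H$ is a one-dimensional fractional Brownian motion with Hurst parameter $H$ (centered Gaussian, $B^H_0=0$, $\mathbf E[(B^H_s-B^H_r)^2]=|s-r|^{2H}$). $\mathcal D_t=\{(r,s):0<r<s<t\}$. For $\varepsilon>0$, $f_\varepsilon(x)=\frac{1}{\sqrt{2\pi\varepsilon}}e^{-x^2/(2\varepsilon)}$. *)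

(* Defs.v *)
From HB Require Import structures.
From mathcomp Require Import all_boot all_order all_algebra.
From mathcomp Require Import all_classical all_reals all_analysis.
Set Implicit Arguments. Unset Strict Implicit. Unset Printing Implicit Defensive.
Import Order.TTheory GRing.Theory Num.Theory.
Import numFieldNormedType.Exports.
Local Open Scope classical_set_scope.
Local Open Scope ring_scope.

Section defs.
Context (R : realType) (d : measure_display) (Omega : measurableType d).

Definition centered_gaussian (P : probability Omega R) (X : Omega -> R) : Prop :=
  measurable_fun setT X /\
  exists s : R, 0 <= s /\
    forall A : set R, measurable A ->
      P (X @^-1` A) = (if s == 0 then \d_(0:R) A else normal_prob 0 s A).

Definition is_fBm (H : R) (P : probability Omega R) (B : R -> Omega -> R) : Prop :=
  [/\ (forall w, B 0 w = 0),
      (forall w, {within `[0, +oo[, continuous (fun t => B t w)}),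
      (forall (n : nat) (ts cs : 'I_n -> R), (forall i, 0 <= ts i) ->
         centered_gaussian P (fun w => \sum_(i < n) cs i * B (ts i) w)) &
      (forall s r, 0 <= s -> 0 <= r ->
         (\int[P]_w ((B s w - B r w) ^+ 2)%:E = (`|s - r| `^ (2 * H))%:E)%E)].

Definition heat (eps x : R) : R :=
  (Num.sqrt (2 * pi * eps))^-1 * expR (- (x ^+ 2) / (2 * eps)).

(* int int_{D_t} h(r,s) dr ds, D_t = {0 < r < s < t}, as an iterated
   Lebesgue integral (extended-real valued) *)
Definition dint (t : R) (h : R -> R -> R) : \bar R :=
  (\int[lebesgue_measure]_(s in `]0%R, t[) \int[lebesgue_measure]_(r in `]0%R, s[) (h r s)%:E)%E.

Definition alpha_eps (B : R -> Omega -> R) (eps t y : R) (w : Omega) : R :=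
  fine (dint t (fun r s => heat eps (B s w - B r w - y))).

End defs.

(* Main.v *)
Require Import Defs.
From HB Require Import structures.
From mathcomp Require Import all_boot all_order all_algebra.
From mathcomp Require Import all_classical all_reals all_analysis.
From mathcomp Require Import measurable_realfun ring lra.
Import Order.TTheory GRing.Theory Num.Theory.
Import numFieldNormedType.Exports.
Set Implicit Arguments.
Unset Strict Implicit.
Unset Printing Implicit Defensive.
Local Open Scope classical_set_scope.
Local Open Scope ring_scope.

(** The occupation measure of [(r, s) |-> B s - B r] over [0 < r < s < t] has Fourier
transform [c t p + i s t p], an integral over the simplex.  Local nondeterminism of fractional
Brownian motion (an increment combination has variance at least [k * q ^+ 2 * (v - u) `^ (2 * H)]
when a total weight [q] jumps across a gap [(u, v)] free of sample times) bounds the second moment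
of the transform over a strip [t' <= s < t], and dyadic chaining in [t] with summable weights
bounds its supremum over [t <= T] by a single random [m0 p] such that [|p| `^ kap * m0 p] is
integrable at infinity for every [kap < 2 / H - 1], almost surely.  Hence the transform is
absolutely integrable: the occupation measure has a density, the limit of its heat regularizations,
and moments of [m0] turn into Hoelder exponents in space and time.

For the convergence in [L^p] it suffices to bound all moments of the regularizations uniformly in
[eps].  By Jensen's inequality it is enough to bound, for fixed [s], the moments of the integral of
[heat eps (B s - B r - y)] over [0 < r < s]; writing each heat kernel as a Gaussian average of
phases, the frequencies are integrated out one at a time, each of them producing a factor
[gap `^ (- H)], which is integrable. *)

(** * Integration preliminaries *)

(** The variance bound gives a strip of width [D] a second moment of order D ^ (1 + th) |p| ^ (- (2
    - th) / H): any [th > 0] pays for the sum over all dyadic strips, and letting [th] tend to [0]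
    yields the threshold kap < 2 / H - 1. Both Hoelder ranges come from this threshold. In space,
    weighted AM-GM against a power of |p| makes |p| ^ gam times the transform integrable when gam <
    1 / H - 1, and [cos] and [sin], being Lipschitz, cannot give an exponent above 1. In time, the
    transform is trivially Lipschitz in [t]; interpolating with the square root of [m0] leaves a
    decay of order |p| ^ (- (1 - gam) / H), integrable when gam < 1 - H. Taking the supremum over
    [t] before integrating in [p] leaves a single null set, valid for all [t] and [y] at once. The
    price is that [m0] is controlled in expectation only, which says nothing about high moments of
    the local time; hence the separate moment bound for convergence in L^p. *)

Section integration_on_domains.
Context d1 d2 (T1 : measurableType d1) (T2 : measurableType d2) (R : realType)
  (m1 : {sigma_finite_measure set T1 -> \bar R})
  (m2 : {sigma_finite_measure set T2 -> \bar R}).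

Lemma integral_restrict_prod (A : set T1) (B : set T2) (f : T1 -> T2 -> \bar R) :
  (\int[m1]_(x in A) \int[m2]_(y in B) f x y =
   \int[m1]_x \int[m2]_y ((fun z => f z.1 z.2) \_ (A `*` B)) (x, y))%E.
Proof.
rewrite integral_mkcond; apply: eq_integral => x _; rewrite patchE.
case: ifPn => xA.
  rewrite integral_mkcond; apply: eq_integral => y _; rewrite !patchE.
  by rewrite in_setX /= xA.
under eq_integral => y _ do rewrite patchE in_setX /= (negbTE xA) /=.
by rewrite integral0.
Qed.

Lemma integral_restrict_prod2 (A : set T1) (B : set T2) (f : T1 -> T2 -> \bar R) :
  (\int[m2]_(y in B) \int[m1]_(x in A) f x y =
   \int[m2]_y \int[m1]_x ((fun z => f z.1 z.2) \_ (A `*` B)) (x, y))%E.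
Proof.
rewrite integral_mkcond; apply: eq_integral => y _; rewrite patchE.
case: ifPn => yB.
  rewrite integral_mkcond; apply: eq_integral => x _; rewrite !patchE.
  by rewrite in_setX /= yB andbT.
under eq_integral => x _ do rewrite patchE in_setX /= (negbTE yB) andbF /=.
by rewrite integral0.
Qed.

Lemma tonelli_on (A : set T1) (B : set T2) (f : T1 -> T2 -> \bar R) :
  measurable A -> measurable B ->
  measurable_fun [set: T1 * T2] (fun z => f z.1 z.2) -> (forall x y, 0 <= f x y)%E ->
  (\int[m1]_(x in A) \int[m2]_(y in B) f x y =
   \int[m2]_(y in B) \int[m1]_(x in A) f x y)%E.
Proof.
move=> mA mB mf f0.
rewrite integral_restrict_prod integral_restrict_prod2 fubini_tonelli//.
- by apply/(measurable_restrictT _ _).1 => //; [exact: measurableX|exact: measurable_funTS].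
- by move=> z; rewrite patchE; case: ifP.
Qed.

Lemma measurable_eint (B : set T2) (f : T1 -> T2 -> \bar R) : measurable B ->
  measurable_fun [set: T1 * T2] (fun z => f z.1 z.2) -> (forall x y, 0 <= f x y)%E ->
  measurable_fun setT (fun x => \int[m2]_(y in B) f x y)%E.
Proof.
move=> mB mf f0.
rewrite [X in measurable_fun _ X](_ : _ =
  fubini_F m2 ((fun z => f z.1 z.2) \_ (setT `*` B))).
  apply: measurable_fun_fubini_tonelli_F.
  - apply/(measurable_restrictT _ _).1; first exact: measurableX.
    exact: measurable_funTS.
  - by move=> z; rewrite patchE; case: ifP.
apply/funext => x; rewrite /fubini_F [LHS]integral_mkcond.
by apply: eq_integral => y _; rewrite !patchE in_setX in_setT.
Qed.

Lemma measurable_Rint (B : set T2) (f : T1 -> T2 -> R) : measurable B ->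
  measurable_fun [set: T1 * T2] (fun z => f z.1 z.2) ->
  measurable_fun setT (fun x => \int[m2]_(y in B) f x y).
Proof.
move=> mB mf; apply: (measurableT_comp (fine_measurable measurableT)).
under eq_fun do rewrite integralE.
apply: emeasurable_funB; apply: measurable_eint => //.
- under eq_fun do rewrite funeposE.
  by apply: measurable_maxe => //; exact/measurable_EFinP.
- under eq_fun do rewrite funenegE.
  apply: measurable_maxe => //.
  by apply: measurableT_comp => //; exact/measurable_EFinP.
Qed.

Lemma ge0_integral_prod_on (A : set T1) (B : set T2) (f : T1 -> T2 -> \bar R) :
  measurable A -> measurable B ->
  measurable_fun [set: T1 * T2] (fun z => f z.1 z.2) -> (forall x y, 0 <= f x y)%E ->
  (\int[m1 \x m2]_(z in A `*` B) f z.1 z.2 =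
   \int[m1]_(x in A) \int[m2]_(y in B) f x y)%E.
Proof.
move=> mA mB mf f0; rewrite integral_restrict_prod integral_mkcond fubini_tonelli1//.
- by apply/(measurable_restrictT _ _).1 => //; [exact: measurableX|exact: measurable_funTS].
- by move=> z; rewrite patchE; case: ifP.
Qed.

Section dominated.
Variables (A : set T1) (B : set T2) (f : T1 -> T2 -> R) (a : T1 -> R) (b : T2 -> R).
Hypotheses (mA : measurable A) (mB : measurable B)
  (mf : measurable_fun [set: T1 * T2] (fun z => f z.1 z.2))
  (ia : m1.-integrable A (EFin \o a)) (ib : m2.-integrable B (EFin \o b))
  (fab : forall x y, A x -> B y -> `|f x y| <= a x * b y).

Let g := (fun z => (f z.1 z.2)%:E) \_ (A `*` B).

Let ig : (m1 \x m2)%E.-integrable setT g.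
Proof.
have mg : measurable_fun setT g.
  apply/(measurable_restrictT _ _).1; first exact: measurableX.
  exact/measurable_funTS/measurable_EFinP.
apply/integrable12ltyP => //.
apply: (@le_lt_trans _ _ (\int[m1]_(x in A) (`|a x|%:E * \int[m2]_(y in B) `|b y|%:E))%E).
  rewrite [leRHS]integral_mkcond; apply: ge0_le_integral => //.
  - by move=> x _; exact: integral_ge0.
  - apply: measurable_eint => //.
    rewrite (_ : (fun _ => _) = abse \o g); last by apply/funext => -[].
    exact: measurableT_comp.
  - apply/(measurable_restrictT _ _).1 => //.
    apply: emeasurable_funM => //; apply/measurable_EFinP/measurableT_comp => //.
    by apply/measurable_EFinP; case/integrableP : ia.
  - move=> x _; rewrite patchE; case: ifPn => [/set_mem xA|xA]; last first.
      rewrite integral0_eq// => y _.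
      by rewrite /g patchE in_setX /= (negbTE xA); exact: abse0.
    rewrite -ge0_integralZl//; last first.
      apply/measurable_EFinP/measurableT_comp => //.
      by apply/measurable_EFinP; case/integrableP : ib.
    rewrite [leRHS]integral_mkcond; apply: ge0_le_integral => //.
    + apply: (@measurableT_comp _ _ _ _ _ _ abse _ (fun y => g (x, y))) => //.
      exact: (measurableT_comp mg (pair1_measurable x)).
    + apply/(measurable_restrictT _ _).1 => //.
      apply: emeasurable_funM => //; apply/measurable_EFinP/measurableT_comp => //.
      by apply/measurable_EFinP; case/integrableP : ib.
    + move=> y _; rewrite /g !patchE in_setX /= mem_set//=.
      case: ifPn => [/set_mem yB|yB]; last by rewrite abse0.
      by rewrite -EFinM lee_fin -normrM (le_trans (fab xA yB))// ler_norm.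
rewrite ge0_integralZr//=; last 2 first.
  - apply/measurable_EFinP/measurableT_comp => //.
    by apply/measurable_EFinP; case/integrableP : ia.
  - by apply: integral_ge0.
apply: lte_mul_pinfty; first exact: integral_ge0.
- rewrite ge0_fin_numE; last exact: integral_ge0.
  by case/integrableP : ia.
- by case/integrableP : ib.
Qed.

Lemma integrable_section1 x : A x -> m2.-integrable B (EFin \o f x).
Proof.
move=> Ax; apply: (@le_integrable _ _ _ _ _ _ _ (fun y => (a x)%:E * (b y)%:E)%E) => //.
- apply/measurable_EFinP/measurable_funTS.
  exact: (measurableT_comp mf (pair1_measurable x)).
- by move=> y By /=; rewrite lee_fin (le_trans (fab Ax By))// ler_norm.
- exact: integrableZl.
Qed.

Lemma integrable_section2 y : B y -> m1.-integrable A (EFin \o f^~ y).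
Proof.
move=> By; apply: (@le_integrable _ _ _ _ _ _ _ (fun x => (b y)%:E * (a x)%:E)%E) => //.
- apply/measurable_EFinP/measurable_funTS.
  exact: (measurableT_comp mf (pair2_measurable y)).
- by move=> x Ax /=; rewrite lee_fin (le_trans (fab Ax By))// mulrC ler_norm.
- exact: integrableZl.
Qed.

(** Domination by a product makes every section integrable, not just almost every one, so taking
    [fine] of the inner integrals loses nothing and Fubini's theorem passes to real-valued
    integrals. *)
Lemma fubini_on : \int[m1]_(x in A) \int[m2]_(y in B) f x y =
  \int[m2]_(y in B) \int[m1]_(x in A) f x y.
Proof.
rewrite /Rintegral.
under eq_integral => x /set_mem Ax do rewrite fineK ?integrable_fin_num ?integrable_section1//.
under [in RHS]eq_integral => y /set_mem By do rewrite fineK ?integrable_fin_num ?integrable_section2//.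
by congr fine; rewrite integral_restrict_prod integral_restrict_prod2 (Fubini ig).
Qed.

Lemma integrable_Rint : m1.-integrable A (EFin \o (fun x => \int[m2]_(y in B) f x y)).
Proof.
apply/integrable_mkcond => //.
have := integrable_fubini_F ig.
apply: eq_integrable => // x _; rewrite /fubini_F /= patchE.
case: ifPn => [/set_mem Ax|xA].
  rewrite /= /Rintegral fineK ?integrable_fin_num ?integrable_section1//.
  rewrite [RHS]integral_mkcond; apply: eq_integral => y _; rewrite /g !patchE in_setX.
  by rewrite mem_set.
under eq_integral => y _ do rewrite /g patchE in_setX /= (negbTE xA) /=.
by rewrite integral0.
Qed.

End dominated.
End integration_on_domains.

(** Convergence from the right is tested on positive sequences, to which dominated convergence
    applies. *)
Lemma cvg_Rint_right d (T : measurableType d) (R : realType)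
    (mu : {measure set T -> \bar R}) (D : set T) (f : R -> T -> R) (l g : T -> R) :
  measurable D -> (forall e, 0 < e -> measurable_fun D (f e)) ->
  (forall x, D x -> f e x @[e --> 0^'+] --> l x) ->
  mu.-integrable D (EFin \o g) ->
  (forall e x, 0 < e -> D x -> `|f e x| <= g x) ->
  \int[mu]_(x in D) f e x @[e --> 0^'+] --> \int[mu]_(x in D) l x.
Proof.
move=> mD mf fl ig fg; apply/cvg_at_rightP => u [u0 u_cvg].
have mfu n : measurable_fun D (fun x => (f (u n) x)%:E).
  exact/measurable_EFinP/mf.
have fu x : D x -> (f (u n) x)%:E @[n --> \oo] --> (l x)%:E.
  move=> Dx; apply: cvg_EFin; first exact: nearW.
  by move/cvg_at_rightP : (fl x Dx); apply.
have [//|||] := @dominated_convergence _ _ _ mu _ mD (fun n x => (f (u n) x)%:E)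
   (EFin \o l) (EFin \o g) mfu _ _ ig.
- exact: emeasurable_fun_cvg fu.
- by apply: aeW => x /=; exact: fu.
- by apply: aeW => x n Dx /=; rewrite lee_fin fg.
- move=> il _ h; apply: fine_cvg; rewrite fineK//.
  exact: integrable_fin_num.
Qed.

(** * Affine changes of variables for the Lebesgue integral *)

Section affine_change_of_variables.
Context (R : realType).
Notation mu := (@lebesgue_measure R).

(** The pushforward of Lebesgue measure by [phi], multiplied by [c], agrees with Lebesgue measure on
    half-open intervals, hence on all measurable sets. *)
Lemma ge0_integral_shift_scale (c e : R) (f : R -> \bar R) : 0 < c ->
  measurable_fun setT f -> (forall x, 0 <= f x)%E ->
  (\int[mu]_x f x = c%:E * \int[mu]_x f (c * x + e)%R)%E.
Proof.
move=> c0 mf f0.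
pose phi (x : measurableTypeR R) : measurableTypeR R := c * x + e.
have mphi : measurable_fun setT phi.
  apply: continuous_measurable_fun => x.
  by apply: cvgD; [apply: cvgMr; exact: cvg_id|exact: cvg_cst].
pose m : {measure set (measurableTypeR R) -> \bar R} := mscale (NngNum (ltW c0))
  (measure_function_pushforward__canonical__measure_function_Measure mu mphi).
have mE A : measurable A -> mu A = m A.
  apply: lebesgue_measure_unique => _ [[a b] /= _ <-].
  rewrite /m /mscale /= /pushforward.
  have -> : phi @^-1` `]a, b] = `](a - e) / c, (b - e) / c]%classic.
    apply/seteqP; split => x /=; rewrite !in_itv/= /phi;
      by rewrite ltr_pdivrMr// ler_pdivlMr// ltrBlDr lerBrDr (mulrC x).
  rewrite !lebesgue_measure_itv/= !lte_fin ltr_pM2r ?invr_gt0// ltrD2r.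
  case: ifPn => _; last by rewrite mule0.
  by rewrite -!EFinB -EFinM; congr EFin; field; rewrite gt_eqF.
rewrite (eq_measure_integral m); last by move=> A mA _; exact: mE.
rewrite ge0_integral_mscale//= ge0_integral_pushforward//.
Qed.

Lemma ge0_integral_shift (e : R) (f : R -> \bar R) :
  measurable_fun setT f -> (forall x, 0 <= f x)%E ->
  (\int[mu]_x f x = \int[mu]_x f (x + e)%R)%E.
Proof.
move=> mf f0; rewrite (ge0_integral_shift_scale e ltr01)// mul1e.
by apply: eq_integral => x _; rewrite mul1r.
Qed.

Lemma ge0_integral_opp (f : R -> \bar R) :
  measurable_fun setT f -> (forall x, 0 <= f x)%E ->
  (\int[mu]_x f x = \int[mu]_x f (- x)%R)%E.
Proof.
move=> mf f0.
rewrite [RHS](_ : _ = \int[mu]_(x in (-%R : R -> measurableTypeR R) @^-1` setT) f (- x)%R)%E//.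
rewrite -(@ge0_integral_pushforward _ _ _ _ _ (-%R : measurableTypeR R -> measurableTypeR R) _ mu setT f)//=.
by apply: eq_measure_integral => //= A mA AS; exact/esym/lebesgue_measureN.
Qed.

End affine_change_of_variables.

(** * Integrals of powers at infinity and at the origin *)

Section power_integrals.
Context (R : realType).
Notation mu := (@lebesgue_measure R).

Lemma integral_powR_segment (a b q : R) : 0 < a -> a < b -> q != -1 ->
  (\int[mu]_(x in `[a, b]) (x `^ q)%:E = ((b `^ (q + 1) - a `^ (q + 1)) / (q + 1))%:E)%E.
Proof.
move=> a0 ab q1.
have q10 : q + 1 != 0 by rewrite addr_eq0.
have dF (x : R^o) : 0 < x -> is_derive x 1 (fun x : R^o => x `^ (q + 1) / (q + 1) : R^o) (x `^ q).
  move=> x0.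
  have h := is_derive1_powR (q + 1) x0.
  rewrite [X in is_derive _ _ X _](_ : _ =
     (q + 1)^-1 \*: ((powR (R:=R))^~ (q + 1) : R^o -> R^o)); last first.
    by apply/funext => y; rewrite /= mulrC.
  apply: is_derive_eq; rewrite addrK /GRing.scale/= mulrA mulVf ?mul1r//.
have cF x : 0 < x -> {for x, continuous (fun x : R => x `^ (q + 1) / (q + 1))}.
  by move=> /dF [? _]; apply: differentiable_continuous; exact/derivable1_diffP.
rewrite (@continuous_FTC2 _ _ (fun x => x `^ (q + 1) / (q + 1)))//.
- by rewrite -EFinB mulrBl.
- apply: continuous_in_subspaceT => x /set_mem /=; rewrite in_itv/= => /andP[ax _].
  apply: differentiable_continuous; apply/derivable1_diffP.
  by apply: derivable_powR; rewrite in_itv/= andbT (lt_le_trans a0).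
- split.
  + by move=> x; rewrite in_itv/= => /andP[ax _]; have [] := dF x (lt_trans a0 ax).
  + by apply: cvg_at_right_filter; exact: cF.
  + by apply: cvg_at_left_filter; apply: cF; exact: lt_trans ab.
- move=> x; rewrite in_itv/= => /andP[ax _].
  by rewrite derive1E; have [_] := dF x (lt_trans a0 ax).
Qed.

Lemma measurable_powR_EFin (D : set R) q : measurable_fun D (fun x : R => (x `^ q)%:E).
Proof. by apply/measurable_EFinP/measurable_funTS; exact: measurable_powR. Qed.

Lemma integral_powR_tail (q : R) : q < -1 ->
  (\int[mu]_(x in `[1%R, +oo[) (x `^ q)%:E <= (- (q + 1)^-1)%:E)%E.
Proof.
move=> q1.
(* [i.+2] keeps each segment nondegenerate, as [integral_powR_segment] requires. *)
pose F (i : nat) : set R := `[1%R, i.+2%:R]%classic.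
have FE : `[1%R, +oo[%classic = \bigcup_i F i.
  apply/seteqP; split => x /=; rewrite in_itv/=.
    rewrite andbT => x1; exists (Num.truncn x) => //=; rewrite /F/= in_itv/= x1/=.
    have := truncnS_gt x => /ltW /le_trans; apply.
    by rewrite ler_nat.
  by move=> [i _]; rewrite /F/= in_itv/= => /andP[-> _].
have ndF : nondecreasing_seq F.
  move=> i j ij; apply/subsetPset => x; rewrite /F/= !in_itv/= => /andP[-> xi]/=.
  by rewrite (le_trans xi)// ler_nat.
have mF i : measurable (F i) by exact: measurable_itv.
rewrite FE.
have h : (\int[mu]_(x in F i) (x `^ q)%:E @[i --> \oo] -->
    \int[mu]_(x in \bigcup_i F i) (x `^ q)%:E)%E.
  apply: ge0_nondecreasing_set_cvg_integral => //.
  - by move=> i; exact: measurable_powR_EFin.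
  - by move=> i x _; rewrite lee_fin powR_ge0.
rewrite -(cvg_lim _ h)//; apply: lime_le; first by apply/cvg_ex; eexists; exact: h.
apply: nearW => i; rewrite integral_powR_segment// ?ltr1n//; last by rewrite lt_eqF.
rewrite lee_fin powR1 mulrBl mul1r lerBlDr addNr.
by apply: mulr_ge0_le0; rewrite ?powR_ge0// invr_le0; lra.
Qed.

Lemma integral_powR_origin (q a : R) : -1 < q -> 0 < a ->
  (\int[mu]_(x in `]0%R, a]) (x `^ q)%:E <= (a `^ (q + 1) / (q + 1))%:E)%E.
Proof.
move=> q1 a0.
pose F (i : nat) : set R := `[a / i.+2%:R, a]%classic.
have FE : `]0%R, a]%classic = \bigcup_i F i.
  apply/seteqP; split => x /=; rewrite in_itv/=.
    move=> /andP[x0 xa]; exists (Num.truncn (a / x)) => //=; rewrite /F/= in_itv/= xa andbT.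
    rewrite ler_pdivrMr// mulrC -ler_pdivrMr//.
    have := truncnS_gt (a / x) => /ltW /le_trans; apply.
    by rewrite ler_nat.
  by move=> [i _]; rewrite /F/= in_itv/= => /andP[+ ->]; rewrite andbT; apply: lt_le_trans; rewrite divr_gt0.
have ndF : nondecreasing_seq F.
  move=> i j ij; apply/subsetPset => x; rewrite /F/= !in_itv/= => /andP[xi ->]/=.
  by rewrite andbT (le_trans _ xi)// ler_pM2l// lef_pV2 ?posrE// ler_nat.
have mF i : measurable (F i) by exact: measurable_itv.
rewrite FE.
have h : (\int[mu]_(x in F i) (x `^ q)%:E @[i --> \oo] -->
    \int[mu]_(x in \bigcup_i F i) (x `^ q)%:E)%E.
  apply: ge0_nondecreasing_set_cvg_integral => //.
  - by move=> i; exact: measurable_powR_EFin.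
  - by move=> i x _; rewrite lee_fin powR_ge0.
rewrite -(cvg_lim _ h)//; apply: lime_le; first by apply/cvg_ex; eexists; exact: h.
apply: nearW => i; rewrite integral_powR_segment// ?divr_gt0//; last 2 first.
  - by rewrite ltr_pdivrMr// ltr_pMr// ltr1n.
  - by rewrite gt_eqF.
rewrite lee_fin ler_pM2r ?invr_gt0; last by rewrite -ltrBlDr sub0r.
by rewrite lerBlDr lerDl powR_ge0.
Qed.

End power_integrals.

(** * Gaussian integrals and characteristic functions *)

Section gaussian_fourier.
Context (R : realType).
Notation mu := (@lebesgue_measure R).

(** Integration by parts on the line: since [v] is integrable, its integrals over [[- n, n]]
    converge to the full one, so the boundary terms matter only along the integers. *)
Lemma integral_derivative_eq0 (u v : R -> R) :
  (forall x : R, is_derive x (1 : R) u (v x)) -> continuous v ->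
  mu.-integrable setT (EFin \o v) ->
  u n%:R @[n --> \oo] --> (0 : R) -> u (- n%:R) @[n --> \oo] --> (0 : R) ->
  \int[mu]_x v x = 0.
Proof.
move=> du cv iv up um.
have cu : continuous u.
  by move=> x; apply: differentiable_continuous; apply/derivable1_diffP; case: (du x).
pose f (n : nat) (x : R) := ((EFin \o v) \_ `[- n%:R, n%:R]) x.
have intf n : (0 < n)%N -> (\int[mu]_x f n x = (u n%:R - u (- n%:R))%:E)%E.
  move=> n0; have nn : - n%:R < n%:R :> R.
    by have : 0 < n%:R :> R; [rewrite ltr0n|lra].
  rewrite -integral_mkcond (@continuous_FTC2 _ v u)// ?EFinB//.
  - exact: continuous_subspaceT.
  - split; first by move=> x _; case: (du x).
    + by apply: cvg_at_right_filter; exact: cu.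
    + by apply: cvg_at_left_filter; exact: cu.
  - by move=> x _; rewrite derive1E; case: (du x).
have mv : measurable_fun setT v by exact: continuous_measurable_fun.
have h : (\int[mu]_x f n x @[n --> \oo] --> \int[mu]_x (v x)%:E)%E.
  apply: (@dominated_cvg _ _ _ mu setT measurableT f (EFin \o v) (fun x => `|(v x)%:E|%E)) => //.
  - move=> n; apply/(measurable_restrictT _ _).1 => //.
    exact/measurable_funTS/measurable_EFinP.
  - move=> x _; apply: cvg_near_cst.
    exists (Num.truncn `|x|).+1 => // n /= xn; rewrite /f patchE.
    rewrite mem_set//= in_itv/= -ler_norml.
    have := truncnS_gt `|x| => /ltW/le_trans; apply; by rewrite ler_nat.
  - exact: integrable_abse.
  - by move=> n x _; rewrite /f patchE; case: ifP => //; rewrite abse0.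
have h2 : ((u n%:R - u (- n%:R))%:E @[n --> \oo] --> (0 : R)%:E)%E.
  apply: cvg_EFin; first exact: nearW.
  by rewrite -[X in _ --> X]subr0; exact: cvgB.
have : (\int[mu]_x f n x @[n --> \oo] --> (0 : R)%:E)%E.
  apply: cvg_trans h2; apply: near_eq_cvg.
  by exists 1%N => // n n1 /=; rewrite intf.
by move=> /cvg_lim h0; rewrite /Rintegral -(cvg_lim _ h)// h0.
Qed.

(** Indexed by the inverse variance and not normalized: [a = 0] gives the constant [1], which covers
    degenerate laws, and the Fourier transform exchanges [a] and [a^-1]. *)
Definition gaussian (a x : R) : R := expR (- (a * x ^+ 2) / 2).

Lemma gaussian_ge0 a x : 0 <= gaussian a x. Proof. exact: expR_ge0. Qed.

Lemma gaussian_gt0 a x : 0 < gaussian a x. Proof. exact: expR_gt0. Qed.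

Lemma gaussian_le1 a x : 0 <= a -> gaussian a x <= 1.
Proof.
move=> a0; rewrite -expR0 ler_expR mulNr oppr_le0.
by rewrite divr_ge0// mulr_ge0// sqr_ge0.
Qed.

Lemma is_derive_gaussian a (x : R) :
  is_derive x (1 : R) (gaussian a) (- (a * x) * gaussian a x).
Proof.
rewrite /gaussian.
have h : is_derive x (1:R) (fun x => - (a * x ^+ 2) / 2) (- (a * x)).
  apply: is_derive_eq; rewrite /GRing.scale/=.
  by field.
by apply: is_derive_eq; rewrite /GRing.scale/= mulrC.
Qed.

Lemma continuous_gaussian a : continuous (gaussian a).
Proof.
move=> x; apply: differentiable_continuous; apply/derivable1_diffP.
by case: (is_derive_gaussian a x).
Qed.

Lemma measurable_gaussian (a : R) : measurable_fun setT (gaussian a).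
Proof. by apply: continuous_measurable_fun; exact: continuous_gaussian. Qed.

Lemma gaussian_normal_pdf (a x : R) : 0 < a ->
  gaussian a x = Num.sqrt (2 * pi / a) * normal_pdf 0 (Num.sqrt a)^-1 x.
Proof.
move=> a0; have s0 : (Num.sqrt a)^-1 != 0 by rewrite invr_neq0// gt_eqF// sqrtr_gt0.
rewrite normal_pdfE// /normal_peak /normal_fun mulrA.
rewrite exprVn sqr_sqrtr ?(ltW a0)// subr0.
have -> : a^-1 * pi *+ 2 = 2 * pi / a by rewrite -mulr_natl; ring.
rewrite divff ?mul1r; last by rewrite gt_eqF// sqrtr_gt0 divr_gt0// mulr_gt0// pi_gt0.
by congr expR; field; rewrite gt_eqF.
Qed.

Lemma integral_gaussian (a : R) : 0 < a ->
  (\int[mu]_x (gaussian a x)%:E = (Num.sqrt (2 * pi / a))%:E)%E.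
Proof.
move=> a0; under eq_integral do rewrite gaussian_normal_pdf// EFinM.
rewrite ge0_integralZl//; last 2 first.
  - by apply/measurable_EFinP; exact: measurable_normal_pdf.
  - by move=> x _; rewrite lee_fin normal_pdf_ge0.
by rewrite integral_normal_pdf mule1.
Qed.

Lemma integrable_gaussian (a : R) : 0 < a -> mu.-integrable setT (EFin \o gaussian a).
Proof.
move=> a0; apply/integrableP; split.
  by apply/measurable_EFinP; exact: measurable_gaussian.
under eq_integral do rewrite /= ger0_norm ?gaussian_ge0//.
by rewrite integral_gaussian// ltry.
Qed.

(** Half of the exponent absorbs the factor [|x|], by [expR z >= 1 + z] and a square completed
    around [|x| = 2]. *)
Lemma mulr_gaussian_le (a x : R) : 0 < a ->
  `|x| * gaussian a x <= (a^-1 + 1) * gaussian (a / 2) x.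
Proof.
move=> a0.
have -> : gaussian a x = gaussian (a / 2) x * gaussian (a / 2) x.
  by rewrite /gaussian -expRD; congr expR; field.
rewrite mulrA ler_pM2r ?gaussian_gt0// -ler_pdivlMr ?gaussian_gt0//.
rewrite /gaussian -expRN.
have := expR_ge1Dx (- (- (a / 2 * x ^+ 2) / 2)).
move=> /(ler_wpM2l (_ : 0 <= a^-1 + 1)) h.
apply: le_trans (h _); last by rewrite addr_ge0 ?invr_ge0 ?(ltW a0).
have -> : (a^-1 + 1) * (1 + - (- (a / 2 * x ^+ 2) / 2)) =
  a^-1 + 1 + x ^+ 2 / 4 + a * x ^+ 2 / 4 by field; rewrite gt_eqF.
rewrite -[x ^+ 2]real_normK ?num_real//.
have : 0 <= a * `|x| ^+ 2 by rewrite mulr_ge0 ?(ltW a0)// sqr_ge0.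
have : 0 < a^-1 by rewrite invr_gt0.
have := sqr_ge0 (`|x| / 2 - 1); nra.
Qed.

Lemma integrable_mulr_gaussian (a : R) : 0 < a ->
  mu.-integrable setT (EFin \o (fun x => `|x| * gaussian a x)).
Proof.
move=> a0; apply: (@le_integrable _ _ _ mu _ measurableT _
   (fun x => (a^-1 + 1)%:E * (EFin \o gaussian (a / 2)) x)%E) => //.
- apply/measurable_EFinP/measurable_funM; last exact: measurable_gaussian.
  exact: normr_measurable.
- move=> x _ /=; rewrite lee_fin ger0_norm ?mulr_ge0 ?gaussian_ge0//.
  by rewrite (le_trans (mulr_gaussian_le x a0))// ler_norm.
- by apply: integrableZl => //; apply: integrable_gaussian; rewrite divr_gt0.
Qed.

Lemma measurable_cos : measurable_fun setT (@cos R).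
Proof. by apply: continuous_measurable_fun; exact: continuous_cos. Qed.

Lemma measurable_sin : measurable_fun setT (@sin R).
Proof. by apply: continuous_measurable_fun; exact: continuous_sin. Qed.

Lemma cvg_gaussian_infty (a : R) : 0 < a -> gaussian a n%:R @[n --> \oo] --> (0 : R).
Proof.
move=> a0; apply/cvgrPdist_le => e e0.
exists (Num.truncn (2 / (a * e))).+1 => // n /= nN.
rewrite sub0r normrN ger0_norm ?gaussian_ge0//.
have : 2 / (a * e) < n%:R.
  have := truncnS_gt (2 / (a * e)) => /lt_le_trans; apply; by rewrite ler_nat.
rewrite ltr_pdivrMr ?mulr_gt0// => h.
have n1 : 1 <= n%:R :> R by rewrite ler1n; case: n nN {h}.
rewrite /gaussian mulNr expRN -[e]invrK lef_pV2 ?posrE ?expR_gt0 ?invr_gt0//.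
apply: le_trans (expR_ge1Dx _).
have ae : 0 < a * e by rewrite mulr_gt0.
rewrite -(ler_pM2r e0) mulVf ?gt_eqF//.
have : n%:R * (a * e) <= n%:R ^+ 2 * (a * e) by rewrite ler_pM2r// expr2 ler_peMr// ltW.
nra.
Qed.

Variables (a psi : R).
Hypothesis a0 : 0 < a.

Let F (p : R) : R := \int[mu]_x (cos (psi + p * x) * gaussian a x).

Let mcos (b p : R) : measurable_fun setT (fun x : R => cos (b + p * x)).
Proof.
apply: measurableT_comp; first exact: measurable_cos.
by apply: measurable_funD => //; exact: measurable_funM.
Qed.

Let msin (b p : R) : measurable_fun setT (fun x : R => sin (b + p * x)).
Proof.
apply: measurableT_comp; first exact: measurable_sin.
by apply: measurable_funD => //; exact: measurable_funM.
Qed.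

Let icos p : mu.-integrable setT (EFin \o (fun x => cos (psi + p * x) * gaussian a x)).
Proof.
apply: (@le_integrable _ _ _ mu _ measurableT _ (EFin \o gaussian a)) => //.
- apply/measurable_EFinP/measurable_funM; last exact: measurable_gaussian.
  exact: mcos.
- move=> x _ /=; rewrite lee_fin normrM ler_piMl// ?normr_ge0//.
  exact: cos_max.
- exact: integrable_gaussian.
Qed.

Let ixsin p : mu.-integrable setT (EFin \o (fun x => x * sin (psi + p * x) * gaussian a x)).
Proof.
apply: (@le_integrable _ _ _ mu _ measurableT _ (EFin \o (fun x => `|x| * gaussian a x))) => //.
- apply/measurable_EFinP/measurable_funM; last exact: measurable_gaussian.
  by apply: measurable_funM => //; exact: msin.
- move=> x _ /=; rewrite lee_fin !normrM normr_id ler_wpM2r//.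
  by rewrite ler_piMr// sin_max.
- exact: integrable_mulr_gaussian.
Qed.

Let is_derive_Fx (p x : R) : is_derive p (1 : R)
  (fun p => cos (psi + p * x) * gaussian a x) (- (x * sin (psi + p * x) * gaussian a x)).
Proof.
by apply: is_derive_eq; rewrite /GRing.scale/= !(mulr1,mulr0,add0r,addr0); ring.
Qed.

Let is_derive_F (p : R) : is_derive p (1 : R) F (- \int[mu]_x (x * sin (psi + p * x) * gaussian a x)).
Proof.
have pin : p \in `](p - 1), (p + 1)[ by rewrite in_itv/=; apply/andP; split; lra.
have dE : forall x, partial1of2 (fun p x => cos (psi + p * x) * gaussian a x) p x =
    - (x * sin (psi + p * x) * gaussian a x).
  by move=> x; rewrite partial1of2E; case: (is_derive_Fx p x).
have [u1 u2] : (forall x, `](p - 1), (p + 1)[%classic x -> mu.-integrable setT (EFin \o (fun y => cos (psi + x * y) * gaussian a y))) /\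
   (forall x y : R, `](p - 1), (p + 1)[%classic x -> setT y -> derivable (fun x : R => cos (psi + x * y) * gaussian a y : R) x (1 : R)).
  split; first by move=> x _; exact: icos.
  by move=> x y _ _; case: (is_derive_Fx x y).
have ub x y : `](p - 1), (p + 1)[%classic x -> setT y ->
   `|partial1of2 (fun p x => cos (psi + p * x) * gaussian a x) x y| <= `|y| * gaussian a y.
  move=> _ _; rewrite partial1of2E; case: (is_derive_Fx x y) => _ ->.
  rewrite normrN !normrM [`|gaussian _ _|]ger0_norm ?gaussian_ge0//.
  by rewrite ler_wpM2r ?gaussian_ge0// ler_piMr// sin_max.
apply: DeriveDef.
  apply: (@derivable_under_integral R _ _ mu _ setT measurableT p (p - 1) (p + 1) pin u1 u2
    (fun y => `|y| * gaussian a y)) => //.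
  - by move=> y; rewrite mulr_ge0 ?gaussian_ge0.
  - exact: integrable_mulr_gaussian.
rewrite -derive1E (@differentiation_under_integral R _ _ mu _ setT measurableT p (p - 1) (p + 1) pin u1 u2
    (fun y => `|y| * gaussian a y)) => //; last 2 first.
  - by move=> y; rewrite mulr_ge0 ?gaussian_ge0.
  - exact: integrable_mulr_gaussian.
rewrite -mulN1r -(RintegralZl _ measurableT (ixsin p)).
by apply: eq_Rintegral => x _; rewrite dE mulN1r.
Qed.

Let F_ode p : a * \int[mu]_x (x * sin (psi + p * x) * gaussian a x) = p * F p.
Proof.
pose u x := sin (psi + p * x) * gaussian a x.
pose v x := p * (cos (psi + p * x) * gaussian a x) - a * (x * sin (psi + p * x) * gaussian a x).
have du (x : R) : is_derive x (1 : R) u (v x).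
  have h := is_derive_gaussian a x.
  by apply: is_derive_eq; rewrite /v /GRing.scale/= !(mulr1,mulr0,add0r,addr0); ring.
have iv1 : mu.-integrable setT (EFin \o (fun x => p * (cos (psi + p * x) * gaussian a x))).
  exact: (@integrableZl _ _ _ mu setT measurableT p _ (icos p)).
have iv2 : mu.-integrable setT (EFin \o (fun x => a * (x * sin (psi + p * x) * gaussian a x))).
  exact: (@integrableZl _ _ _ mu setT measurableT a _ (ixsin p)).
have u_le n (x : R) : gaussian a x = gaussian a n%:R -> `|u x| <= gaussian a n%:R.
  move=> <-; rewrite normrM [`|gaussian _ _|]ger0_norm ?gaussian_ge0//.
  by rewrite ler_piMl ?gaussian_ge0// sin_max.
have ucvg (s : R) : s ^+ 2 = 1 -> u (s * n%:R) @[n --> \oo] --> (0 : R).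
  move=> s1; apply: norm_cvg0; apply: (@squeeze_cvgr _ _ _ _ (cst 0) _ _ _ _ _ (cvg_gaussian_infty a0)).
  - apply: nearW => n; rewrite normr_ge0/=; apply: u_le.
    by rewrite /gaussian exprMn s1 mul1r.
  - exact: cvg_cst.
suff : \int[mu]_x v x = 0.
  rewrite /v RintegralB// (RintegralZl _ measurableT (icos p)) (RintegralZl _ measurableT (ixsin p)).
  by move=> h; apply/esym/eqP; rewrite -subr_eq0; apply/eqP.
apply: (integral_derivative_eq0 du).
- move=> x; apply: cvgB; apply: cvgMr.
  + apply: cvgM; last exact: continuous_gaussian.
    apply: (@cvg_comp _ _ _ (fun x => psi + p * x) cos); last exact: continuous_cos.
    by apply: cvgD; [exact: cvg_cst|apply: cvgMr; exact: cvg_id].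
  + apply: cvgM; last exact: continuous_gaussian.
    apply: cvgM; first exact: cvg_id.
    apply: (@cvg_comp _ _ _ (fun x => psi + p * x) sin); last exact: continuous_sin.
    by apply: cvgD; [exact: cvg_cst|apply: cvgMr; exact: cvg_id].
- have := @integrableB _ _ _ mu setT measurableT _ _ iv1 iv2; exact.
- by have := ucvg 1 (expr1n _ _); under eq_fun do rewrite mul1r.
- have s1 : (-1 : R) ^+ 2 = 1 by rewrite sqrrN expr1n.
  by have := ucvg (-1) s1; under eq_fun do rewrite mulN1r; apply.
Qed.

(** Differentiation under the integral and integration by parts show that the left-hand side [F] has
    derivative [- (p / a) * F p]. Its quotient by [gaussian a^-1 p] is therefore constant, and the
    value at [p = 0] is the Gaussian integral. *)
Lemma gaussian_fourier (p : R) : \int[mu]_x (cos (psi + p * x) * gaussian a x) =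
  Num.sqrt (2 * pi / a) * cos psi * gaussian a^-1 p.
Proof.
pose G p := F p * (gaussian a^-1 p)^-1.
have gN q : (gaussian a^-1 q)^-1 = gaussian (- a^-1) q.
  by rewrite /gaussian -expRN; congr expR; field; rewrite gt_eqF.
have dG (q : R) : is_derive q (1 : R) G 0.
  have h1 := is_derive_F q; have h2 := is_derive_gaussian (- a^-1) q.
  have -> : G = (fun p => F p * gaussian (- a^-1) p) by apply/funext => x; rewrite /G gN.
  apply: is_derive_eq; rewrite /GRing.scale/=.
  have -> : \int[mu]_x (x * sin (psi + q * x) * gaussian a x) = a^-1 * (q * F q).
    by rewrite -F_ode mulrA mulVf ?mul1r// gt_eqF.
  by ring.
have := is_derive_0_is_cst p 0 dG.
rewrite /G {2}/F; under eq_Rintegral => x _ do rewrite mul0r addr0.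
have ig : mu.-integrable setT (EFin \o gaussian a) by exact: integrable_gaussian.
rewrite RintegralZl// /Rintegral integral_gaussian//=.
rewrite [X in _ = _ * X](_ : _ = 1); last first.
  by rewrite /gaussian expr0n/= mulr0 oppr0 mul0r expR0 invr1.
move=> /(congr1 (fun z => z * gaussian a^-1 p)).
rewrite mulr1 divfK ?gt_eqF ?gaussian_gt0// => FE.
by rewrite -[LHS]/(F p) FE; ring.
Qed.

End gaussian_fourier.

Lemma heat_ge0 (R : realType) (eps x : R) : 0 <= heat eps x.
Proof. by rewrite mulr_ge0 ?expR_ge0// invr_ge0 sqrtr_ge0. Qed.

Lemma heatE (R : realType) (eps x : R) :
  heat eps x = (Num.sqrt (2 * pi * eps))^-1 * gaussian eps^-1 x.
Proof. by rewrite /heat /gaussian; congr (_ * expR _); rewrite invfM; ring. Qed.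

(** Fourier inversion of the heat kernel, read off [gaussian_fourier] with [a = eps]. The free phase
    [psi] lets several kernels be expanded one after the other, each adding its frequency to the
    phase. *)
Lemma heat_fourier (R : realType) (eps v psi : R) : 0 < eps ->
  heat eps v * cos psi = (2 * pi)^-1 *
    \int[lebesgue_measure]_x (cos (psi + v * x) * gaussian eps x).
Proof.
move=> e0; rewrite gaussian_fourier// heatE.
have p0 : 0 < pi :> R := pi_gt0 R.
set s := Num.sqrt (2 * pi * eps).
have s0 : 0 < s by rewrite sqrtr_gt0 !mulr_gt0.
have s2 : s ^+ 2 = 2 * pi * eps by rewrite sqr_sqrtr// !mulr_ge0 ?ltW.
have -> : 2 * pi / eps = (s / eps) ^+ 2.
  by rewrite exprMn s2; field; rewrite gt_eqF.
rewrite sqrtr_sqr ger0_norm ?divr_ge0 ?ltW//.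
have -> : s^-1 = (2 * pi)^-1 * (s / eps).
  apply: (mulIf (lt0r_neq0 s0)).
  rewrite mulVf ?gt_eqF//.
  have -> : (2 * pi)^-1 * (s / eps) * s = (2 * pi)^-1 * (s ^+ 2 / eps) by ring.
  by rewrite s2 mulfK ?lt0r_neq0// mulVf// lt0r_neq0// mulr_gt0.
by ring.
Qed.

(** * Laws and characteristic functions of Gaussian variables *)

Section gaussian_variables.
Context (R : realType) (d : measure_display) (Omega : measurableType d)
  (P : probability Omega R).
Notation mu := (@lebesgue_measure R).

Lemma ge0_integral_normal_prob (m s : R) (f : R -> R) :
  measurable_fun setT f -> (forall x, 0 <= f x) ->
  (\int[normal_prob m s]_x (f x)%:E = \int[mu]_x (f x * normal_pdf m s x)%:E)%E.
Proof.
move=> mf f0; have nmu := normal_prob_dominates m s.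
rewrite -(Radon_Nikodym_SigmaFinite.change_of_variables nmu)//=; last first.
  exact/measurable_EFinP.
have nupdf : ae_eq mu setT (fun x => (normal_pdf m s x)%:E)
   (Radon_Nikodym_SigmaFinite.f (normal_prob m s) mu).
  apply: integral_ae_eq => //.
  - exact: integrable_normal_pdf.
  - apply: measurable_int; exact: Radon_Nikodym_SigmaFinite.f_integrable.
  - by move=> E _ mE; rewrite -Radon_Nikodym_SigmaFinite.f_integral.
have mpdf : measurable_fun setT (normal_pdf m s) by exact: measurable_normal_pdf.
apply: ae_eq_integral => //.
- apply: emeasurable_funM; first exact/measurable_EFinP.
  by apply: measurable_int; exact: Radon_Nikodym_SigmaFinite.f_integrable.
- by apply/measurable_EFinP; exact: measurable_funM.
- by apply: filterS nupdf => x /= /(_ I) <-.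
Qed.

Lemma Rintegral_normal_prob (m s M : R) (f : R -> R) :
  measurable_fun setT f -> (forall x, `|f x| <= M) ->
  \int[normal_prob m s]_x (f x) = \int[mu]_x (f x * normal_pdf m s x).
Proof.
move=> mf fM.
have M0 : 0 <= M by apply: le_trans (fM 0).
(* Adding the bound [M] makes the integrand nonnegative; the added constant is subtracted at the
   end. *)
have h : \int[normal_prob m s]_x (f x + M) = \int[mu]_x ((f x + M) * normal_pdf m s x).
  congr fine; apply: ge0_integral_normal_prob.
  - exact: measurable_funD.
  - by move=> x; have := fM x; rewrite ler_norml => /andP[]; lra.
have i1 : (normal_prob m s).-integrable setT (EFin \o f).
  apply: measurable_bounded_integrable => //.
  - exact: (le_lt_trans (probability_le1 _ measurableT) (ltry 1)).
  - exists M; split; first exact: num_real.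
    by move=> x Mx y _ /=; rewrite (le_trans (fM y))// ltW.
have i2 : (normal_prob m s).-integrable setT (EFin \o (fun=> M)).
  exact: finite_measure_integrable_cst.
have mpdf : measurable_fun setT (normal_pdf m s) by exact: measurable_normal_pdf.
have i3 : mu.-integrable setT (EFin \o (fun x => f x * normal_pdf m s x)).
  apply: (@le_integrable _ _ _ mu _ measurableT _ (fun x => M%:E * (normal_pdf m s x)%:E)%E) => //.
  - by apply/measurable_EFinP; exact: measurable_funM.
  - move=> x _ /=; rewrite lee_fin !normrM ler_wpM2r//.
    by rewrite (le_trans (fM x))// ler_norm.
  - by apply: integrableZl => //; exact: integrable_normal_pdf.
have i4 : mu.-integrable setT (EFin \o (fun x => M * normal_pdf m s x)).
  have h2 := @integrable_normal_pdf R m s.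
  exact: (integrableZl measurableT M h2).
move: h; rewrite RintegralD//.
under [in X in _ = X -> _]eq_Rintegral => x _ do rewrite mulrDl.
rewrite RintegralD// [in X in _ = X -> _]RintegralZl//; last exact: integrable_normal_pdf.
rewrite Rintegral_cst//= [fine _](congr1 fine (probability_setT (normal_prob m s))).
rewrite [in X in _ = _ + M * X]/Rintegral integral_normal_pdf /= !mulr1.
by move/addIr.
Qed.

Lemma integrable_bounded_prob d' (T : measurableType d') (Q : probability T R) (f : T -> R) (M : R) :
  measurable_fun setT f -> (forall x, `|f x| <= M) -> Q.-integrable setT (EFin \o f).
Proof.
move=> mf fM; apply: measurable_bounded_integrable => //.
- exact: (le_lt_trans (probability_le1 _ measurableT) (ltry 1)).
- exists M; split; first exact: num_real.
  by move=> x Mx y _ /=; rewrite (le_trans (fM y))// ltW.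
Qed.

Lemma Rintegral_addr_cst d' (T : measurableType d') (Q : probability T R) (f : T -> R) (M c : R) :
  measurable_fun setT f -> (forall x, `|f x| <= M) ->
  \int[Q]_x (f x + c) = \int[Q]_x f x + c.
Proof.
move=> mf fM; rewrite RintegralD//.
- rewrite Rintegral_cst//; congr (_ + _); rewrite -[RHS]mulr1; congr (_ * _).
  exact: (congr1 fine (probability_setT Q)).
- by have := @integrable_bounded_prob _ _ Q f M mf fM; apply.
- exact: finite_measure_integrable_cst.
Qed.

Section law.
Variables (X : Omega -> R) (nu : probability (measurableTypeR R) R).
Hypotheses (mX : measurable_fun setT X)
  (HX : forall A : set R, measurable A -> P (X @^-1` A) = nu A).

Lemma ge0_integral_law (f : R -> R) : measurable_fun setT f -> (forall x, 0 <= f x) ->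
  (\int[P]_w (f (X w))%:E = \int[nu]_x (f x)%:E)%E.
Proof.
move=> mf f0.
have h := @ge0_integral_pushforward _ _ _ (measurableTypeR R) R X mX P setT (EFin \o f).
transitivity (\int[measure_function_pushforward__canonical__measure_function_Measure P (mX : measurable_fun setT (X : _ -> measurableTypeR R))]_x (f x)%:E)%E.
  apply/esym/h => //; first by apply/measurable_EFinP.
  by move=> x _; rewrite lee_fin.
by apply: eq_measure_integral => A mA _; exact: HX.
Qed.

Lemma Rintegral_law (f : R -> R) (M : R) : measurable_fun setT f -> (forall x, `|f x| <= M) ->
  \int[P]_w f (X w) = \int[nu]_x f x.
Proof.
move=> mf fM; apply: (@addIr _ M).
rewrite -(@Rintegral_addr_cst _ _ P _ M); last 2 first.
- exact: measurableT_comp.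
- by move=> x; exact: fM.
rewrite -(@Rintegral_addr_cst _ _ nu _ M)//; congr fine.
apply: (ge0_integral_law (f := fun x => f x + M)); first exact: measurable_funD.
by move=> x; have := fM x; rewrite ler_norml => /andP[]; lra.
Qed.

End law.

(** The derivative of [x * gaussian a x] is [gaussian a x - a * (x ^+ 2 * gaussian a x)], and it
    integrates to zero. *)
Lemma integral_sqr_gaussian (a : R) : 0 < a ->
  (\int[mu]_x (x ^+ 2 * gaussian a x)%:E = (a^-1 * Num.sqrt (2 * pi / a))%:E)%E.
Proof.
move=> a0.
have a20 : 0 < a / 2 by rewrite divr_gt0.
have a40 : 0 < a / 2 / 2 by rewrite !divr_gt0.
have bnd (x : R) : x ^+ 2 * gaussian a x <= ((a / 2)^-1 + 1) ^+ 2 * gaussian (a / 2) x.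
  have -> : gaussian a x = gaussian (a / 2) x * gaussian (a / 2) x.
    by rewrite /gaussian -expRD; congr expR; field.
  have -> : gaussian (a / 2) x = gaussian (a / 2 / 2) x * gaussian (a / 2 / 2) x.
    by rewrite /gaussian -expRD; congr expR; field.
  have -> : x ^+ 2 * (gaussian (a / 2 / 2) x * gaussian (a / 2 / 2) x * (gaussian (a / 2 / 2) x * gaussian (a / 2 / 2) x))
    = (`|x| * (gaussian (a / 2 / 2) x * gaussian (a / 2 / 2) x)) ^+ 2.
    by rewrite exprMn real_normK ?num_real//; ring.
  have -> : gaussian (a / 2 / 2) x * gaussian (a / 2 / 2) x = gaussian (a / 2) x.
    by rewrite /gaussian -expRD; congr expR; field.
  have h := mulr_gaussian_le x a20.
  rewrite (le_trans (_ : _ <= ((((a / 2)^-1 + 1) * gaussian (a / 2 / 2) x) ^+ 2)))//.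
    by rewrite ler_pXn2r// ?nnegrE ?mulr_ge0 ?gaussian_ge0 ?addr_ge0 ?invr_ge0// ltW.
  have -> : gaussian (a / 2) x = gaussian (a / 2 / 2) x ^+ 2.
    by rewrite [RHS]expr2 /gaussian -expRD; congr expR; field.
  by rewrite exprMn.
have mg (b : R) : measurable_fun setT (gaussian b) by exact: measurable_gaussian.
have i2 : mu.-integrable setT (EFin \o (fun x => x ^+ 2 * gaussian a x)).
  apply: (@le_integrable _ _ _ mu _ measurableT _
     (fun x => (((a / 2)^-1 + 1) ^+ 2)%:E * (EFin \o gaussian (a / 2)) x)%E) => //.
  - by apply/measurable_EFinP; apply: measurable_funM; [exact: exprn_measurable|exact: mg].
  - move=> x _ /=; rewrite lee_fin ger0_norm.
      by rewrite (le_trans (bnd x))// ler_norm.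
    by apply: mulr_ge0; [exact: sqr_ge0|exact: gaussian_ge0].
  - by apply: integrableZl => //; exact: integrable_gaussian.
have i1 := integrable_gaussian a0.
pose v (x : R) := gaussian a x - a * (x ^+ 2 * gaussian a x).
have i3 : mu.-integrable setT (EFin \o (fun x => a * (x ^+ 2 * gaussian a x))).
  exact: (integrableZl measurableT a i2).
have du (x : R) : is_derive x (1 : R) (fun x : R => x * gaussian a x : R) (v x).
  have h := is_derive_gaussian a x.
  by apply: is_derive_eq; rewrite /v /GRing.scale/= !(mulr1,mulr0,add0r,addr0); ring.
have u0 (s : R) : s ^+ 2 = 1 -> (s * n%:R * gaussian a (s * n%:R)) @[n --> \oo] --> (0 : R).
  move=> s1; apply: norm_cvg0.
  have h : ((a^-1 + 1) * gaussian (a / 2) n%:R) @[n --> \oo] --> (0 : R).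
    by rewrite -(mulr0 (a^-1 + 1)); apply: cvgMr; exact: cvg_gaussian_infty.
  apply: (@squeeze_cvgr _ _ _ _ (cst 0) _ _ _ _ _ h); last exact: cvg_cst.
  apply: nearW => n; rewrite normr_ge0/= normrM [`|gaussian _ _|]ger0_norm ?gaussian_ge0//.
  rewrite (le_trans (mulr_gaussian_le _ a0))//.
  by rewrite /gaussian exprMn s1 mul1r.
have h : \int[mu]_x v x = 0.
  apply: (integral_derivative_eq0 du).
  - move=> x; apply: cvgB; first exact: continuous_gaussian.
    apply: cvgMr; apply: cvgM; last exact: continuous_gaussian.
    exact: sqr_continuous.
  - have := integrableB measurableT i1 i3; exact.
  - by have := u0 1 (expr1n _ _); under eq_fun do rewrite mul1r.
  - have s1 : (-1 : R) ^+ 2 = 1 by rewrite sqrrN expr1n.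
    by have := u0 (-1) s1; under eq_fun do rewrite mulN1r; apply.
move: h; rewrite /v RintegralB// (RintegralZl _ measurableT i2).
rewrite [X in X - _]/Rintegral integral_gaussian//= => /eqP; rewrite subr_eq0 => /eqP ->.
rewrite mulrA mulVf ?mul1r ?lt0r_neq0// /Rintegral fineK//.
exact: integrable_fin_num i2.
Qed.

(** The scale of the law is hidden under an existential quantifier; expressing the characteristic
    function through the second moment [v] makes it computable from the prescribed variances of the
    increments. *)
Lemma centered_gaussian_char (X : Omega -> R) : centered_gaussian P X ->
  exists v : R, [/\ 0 <= v, (\int[P]_w (X w ^+ 2)%:E = v%:E)%E &
    forall psi p : R, \int[P]_w cos (psi + p * X w) = cos psi * gaussian v p].
Proof.
move=> [mX [s [s0 HX]]].
have mcos (psi p : R) : measurable_fun setT (fun x : R => cos (psi + p * x)).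
  apply: measurableT_comp; first exact: measurable_cos.
  by apply: measurable_funD => //; exact: measurable_funM.
have bcos (psi p x : R) : `|cos (psi + p * x)| <= 1 by exact: cos_max.
have [s00|sn0] := eqVneq s 0.
  exists 0; split => //.
  - have HX' (A : set R) : measurable A -> P (X @^-1` A) = (@dirac _ (measurableTypeR R) (0 : R) R : probability (measurableTypeR R) R) A.
      by move=> mA; rewrite HX// s00 eqxx.
    rewrite (ge0_integral_law mX HX' (f := fun x => x ^+ 2)); last 2 first.
    + exact: exprn_measurable.
    + by move=> x; rewrite sqr_ge0.
    by rewrite integral_dirac ?diracT ?mul1e ?expr0n//; apply/measurable_EFinP; exact: exprn_measurable.
  - move=> psi p.
    have HX' (A : set R) : measurable A -> P (X @^-1` A) = (@dirac _ (measurableTypeR R) (0 : R) R : probability (measurableTypeR R) R) A.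
      by move=> mA; rewrite HX// s00 eqxx.
    rewrite (Rintegral_law mX HX' (mcos psi p) (bcos psi p)).
    rewrite /Rintegral integral_dirac ?diracT ?mul1e//=.
      by rewrite mulr0 addr0 /gaussian mul0r oppr0 mul0r expR0 mulr1.
    by apply/measurable_EFinP; exact: mcos.
have sp : 0 < s by rewrite lt_neqAle eq_sym sn0.
have HX' (A : set R) : measurable A -> P (X @^-1` A) = normal_prob 0 s A.
  by move=> mA; rewrite HX// (negbTE sn0).
pose a := (s ^+ 2)^-1.
have a0 : 0 < a by rewrite invr_gt0 exprn_gt0.
have sa : (Num.sqrt a)^-1 = s by rewrite /a sqrtrV ?sqr_ge0// invrK sqrtr_sqr ger0_norm.
have pdfE (x : R) : normal_pdf 0 s x = (Num.sqrt (2 * pi / a))^-1 * gaussian a x.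
  rewrite gaussian_normal_pdf// sa mulrA mulVf ?mul1r// lt0r_neq0// sqrtr_gt0 divr_gt0//.
  by rewrite mulr_gt0// pi_gt0.
have c0 : 0 < Num.sqrt (2 * pi / a) by rewrite sqrtr_gt0 divr_gt0// mulr_gt0// pi_gt0.
exists (s ^+ 2); split; first exact: sqr_ge0.
- rewrite (ge0_integral_law mX HX' (f := fun x => x ^+ 2)); last 2 first.
  + exact: exprn_measurable.
  + by move=> x; rewrite sqr_ge0.
  rewrite ge0_integral_normal_prob//; last by move=> x; rewrite sqr_ge0.
  under eq_integral => x _ do rewrite pdfE mulrCA EFinM.
  rewrite ge0_integralZl//; last 2 first.
  + apply/measurable_EFinP; apply: measurable_funM; first exact: exprn_measurable.
    exact: measurable_gaussian.
  + move=> x _; rewrite lee_fin.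
    by apply: mulr_ge0; [exact: sqr_ge0|exact: gaussian_ge0].
  rewrite integral_sqr_gaussian// -EFinM; congr EFin.
  by rewrite mulrCA mulVf ?mulr1 ?lt0r_neq0// /a invrK.
- move=> psi p.
  rewrite (Rintegral_law mX HX' (mcos psi p) (bcos psi p)).
  rewrite (Rintegral_normal_prob 0 s (mcos psi p) (bcos psi p)).
  under eq_Rintegral => x _ do rewrite pdfE mulrCA.
  rewrite RintegralZl//.
    rewrite gaussian_fourier// 2!mulrA mulVf ?mul1r ?lt0r_neq0//.
    by rewrite /a invrK.
  apply: (@le_integrable _ _ _ mu _ measurableT _ (EFin \o gaussian a)) => //.
  - by apply/measurable_EFinP; apply: measurable_funM; [exact: mcos|exact: measurable_gaussian].
  - move=> x _ /=; rewrite lee_fin normrM ler_piMl// ?normr_ge0//.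
  - exact: integrable_gaussian.
Qed.

End gaussian_variables.

(** * Characteristic function of combinations of increments *)

Section fbm_characteristic_function.
Context (R : realType).

(** When the weights sum to zero, only differences of the values matter, and the second moments of
    these are exactly what [is_fBm] prescribes. *)
Lemma sqr_sum_sum0 (T : Type) (l : seq T) (c b : T -> R) : \sum_(x <- l) c x = 0 ->
  (\sum_(x <- l) c x * b x) ^+ 2 =
  - 2^-1 * \sum_(x <- l) \sum_(y <- l) c x * c y * (b x - b y) ^+ 2.
Proof.
move=> c0.
have -> : \sum_(x <- l) \sum_(y <- l) c x * c y * (b x - b y) ^+ 2 =
  - 2 * (\sum_(x <- l) c x * b x) ^+ 2.
  have h (x : T) : \sum_(y <- l) c x * c y * (b x - b y) ^+ 2 =
     - 2 * (c x * b x) * (\sum_(y <- l) c y * b y) + c x * (\sum_(y <- l) c y * b y ^+ 2).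
    transitivity (- 2 * (c x * b x) * (\sum_(y <- l) c y * b y) +
      c x * (\sum_(y <- l) c y * b y ^+ 2) + (\sum_(y <- l) c y) * (c x * b x ^+ 2)).
      rewrite mulr_suml !mulr_sumr -!big_split/=.
      by apply: eq_bigr => y _; ring.
    by rewrite c0 mul0r addr0.
  under eq_bigr => x _ do rewrite h.
  by rewrite big_split/= -!mulr_suml c0 mul0r addr0 -mulr_sumr expr2 mulrA.
by rewrite mulrA mulNr mulrN mulVf// opprK mul1r.
Qed.

(* The variance of [\sum_(x <- l) x.1 * B x.2] when the weights [x.1] sum to zero. *)
Definition increment_var (H : R) (l : seq (R * R)) : R :=
  - 2^-1 * \sum_(x <- l) \sum_(y <- l) x.1 * y.1 * `|x.2 - y.2| `^ (2 * H).

Lemma Rintegral_sum d (T : measurableType d) (m : {measure set T -> \bar R})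
    (D : set T) (I : Type) (l : seq I) (f : I -> T -> R) : measurable D ->
  (forall i, m.-integrable D (EFin \o f i)) ->
  \int[m]_(x in D) (\sum_(i <- l) f i x) = \sum_(i <- l) \int[m]_(x in D) f i x.
Proof.
move=> mD intf; rewrite /Rintegral.
under eq_integral => x _ do rewrite -sumEFin.
rewrite (integral_sum mD (f := fun i x => (f i x)%:E))//.
elim: l => [|i l ih]; first by rewrite !big_nil.
rewrite !big_cons fineD ?ih//; first exact: integrable_fin_num (intf i).
apply: (big_ind (fun z : \bar R => z \is a fin_num)) => //.
- by move=> x y xf yf; rewrite fin_numD xf.
- by move=> j _; exact: integrable_fin_num (intf j).
Qed.

Lemma integrable_sum_EFin d (T : measurableType d) (m : {measure set T -> \bar R})
    (D : set T) (I : Type) (l : seq I) (f : I -> T -> R) : measurable D ->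
  (forall i, m.-integrable D (EFin \o f i)) ->
  m.-integrable D (EFin \o (fun x => \sum_(i <- l) f i x)).
Proof.
move=> mD intf.
rewrite (_ : EFin \o _ = (fun x => \sum_(i <- l) (f i x)%:E)%E).
  by apply: integrable_sum => // i _; exact: intf.
by apply/funext => x; rewrite /= sumEFin.
Qed.

Context d (Omega : measurableType d) (P : probability Omega R) (H : R) (B : R -> Omega -> R).
Hypothesis hB : is_fBm H P B.

Lemma fbm_measurable t : 0 <= t -> measurable_fun setT (B t).
Proof.
move=> t0; have [_ _ /(_ 1 (fun=> t) (fun=> 1) (fun=> t0)) [+ _] _] := hB.
by under eq_fun do rewrite big_ord1 mul1r.
Qed.

Lemma fbm_char (l : seq (R * R)) (psi : R) : (forall x, x \in l -> 0 <= x.2) ->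
  \sum_(x <- l) x.1 = 0 ->
  \int[P]_w cos (psi + \sum_(x <- l) x.1 * B x.2 w) =
    cos psi * expR (- increment_var H l / 2).
Proof.
move=> l0 c0; have [_ _ hG hV] := hB.
pose t i := (tnth (in_tuple l) i).2; pose c i := (tnth (in_tuple l) i).1.
have t0 i : 0 <= t i by apply: l0; rewrite mem_tnth.
have [v [v0 EX2 EX]] := centered_gaussian_char (hG _ t c t0).
have sumE w : \sum_(i < size l) c i * B (t i) w = \sum_(x <- l) x.1 * B x.2 w.
  by rewrite [RHS]big_tnth.
have mB2 s r : 0 <= s -> 0 <= r -> measurable_fun setT (fun w => (B s w - B r w) ^+ 2).
  by move=> s0 r0; apply: measurable_funX; apply: measurable_funB; exact: fbm_measurable.
have iB2 s r : 0 <= s -> 0 <= r -> P.-integrable setT (fun w => ((B s w - B r w) ^+ 2)%:E).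
  move=> s0 r0; apply/integrableP; split; first by apply/measurable_EFinP; exact: mB2.
  under eq_integral => w _ do rewrite /= ger0_norm ?sqr_ge0//.
  by rewrite hV// ltry.
have -> : increment_var H l = v.
  rewrite -[RHS]/(fine v%:E) -EX2.
  under eq_integral => w _ do rewrite sumE (sqr_sum_sum0 (fun x => B x.2 w) c0).
  (* Linearity of the integral is applied to families that are integrable at every index, not only
     at the entries of [l]; clamping at [0] makes every index a legitimate time. *)
  pose b (x : R * R) w := B (Num.max x.2 0) w.
  have lm (x : R * R) : x \in l -> Num.max x.2 0 = x.2 by move=> /l0 x0; apply/max_idPl.
  have m0 (x : R * R) : 0 <= Num.max x.2 0 by rewrite le_max lexx orbT.
  have ib (x y : R * R) : P.-integrable setT (EFin \o (fun w => x.1 * y.1 * (b x w - b y w) ^+ 2)).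
    by have := integrableZl measurableT (x.1 * y.1) (iB2 _ _ (m0 x) (m0 y)); exact.
  have ibs (x : R * R) : P.-integrable setT (EFin \o (fun w => \sum_(y <- l) x.1 * y.1 * (b x w - b y w) ^+ 2)).
    by apply: integrable_sum_EFin => // y; exact: ib.
  transitivity (\int[P]_w (- 2^-1 * \sum_(x <- l) \sum_(y <- l) x.1 * y.1 * (b x w - b y w) ^+ 2)); last first.
    congr fine; apply: eq_integral => w _; congr (_ * _)%:E.
    apply: eq_big_seq => x xl; apply: eq_big_seq => y yl.
    by rewrite /b !lm.
  rewrite RintegralZl//; last by apply: integrable_sum_EFin.
  rewrite Rintegral_sum//; congr (_ * _); apply: eq_big_seq => x xl.
  rewrite Rintegral_sum//; apply: eq_big_seq => y yl.
  rewrite RintegralZl//; last exact: iB2.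
  by rewrite /Rintegral hV//= !lm.
rewrite -[RHS](_ : cos psi * gaussian v 1 = _); last by rewrite /gaussian expr1n mulr1.
rewrite -EX; apply: eq_Rintegral => w _; by rewrite mul1r sumE.
Qed.

End fbm_characteristic_function.

(** * Local nondeterminism *)

Section trigonometric_bounds.
Context (R : realType).

Lemma ler_dist_derive1 (f g : R -> R) (x y : R) :
  (forall z : R, is_derive z (1 : R) f (g z)) -> (forall z, `|g z| <= 1) ->
  `|f x - f y| <= `|x - y|.
Proof.
move=> df g1; wlog xy : x y / y <= x => [h|].
  by have [|/ltW] := leP y x; [exact: h|rewrite distrC (distrC x); exact: h].
have [|c _ ->] := @MVT_segment _ f g y x xy (fun z _ => df z).
  apply: derivable_within_continuous => z _; by case: (df z).
by rewrite normrM ler_piMl.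
Qed.

Lemma ler_dist_cos (x y : R) : `|cos x - cos y| <= `|x - y|.
Proof.
apply: (@ler_dist_derive1 _ (fun z => - sin z)) => z.
by rewrite normrN sin_max.
Qed.

Lemma ler_dist_sin (x y : R) : `|sin x - sin y| <= `|x - y|.
Proof. by apply: (@ler_dist_derive1 _ (fun z => cos z)) => z; exact: cos_max. Qed.

Lemma cos_double (x : R) : cos x = 1 - 2 * sin (x / 2) ^+ 2.
Proof.
have -> : cos x = cos (x / 2 + x / 2) by congr cos; field.
rewrite cosD -!expr2; have := cos2Dsin2 (x / 2); lra.
Qed.

Lemma onem_cos_le_sqr (x : R) : 1 - cos x <= x ^+ 2.
Proof.
rewrite cos_double.
have := ler_dist_sin (x / 2) 0; rewrite sin0 !subr0 => h.
have : sin (x / 2) ^+ 2 <= (x / 2) ^+ 2.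
  by rewrite -[sin _ ^+ 2]real_normK ?num_real// -[(x / 2) ^+ 2]real_normK ?num_real// ler_pXn2r ?nnegrE.
have := sqr_ge0 x; lra.
Qed.

Lemma onem_cos_ge0 (x : R) : 0 <= 1 - cos x.
Proof. by rewrite subr_ge0 cos_le1. Qed.

Lemma onem_cos_le2 (x : R) : 1 - cos x <= 2.
Proof. by have := cos_geN1 x; lra. Qed.

End trigonometric_bounds.

(** * The spectral kernel of fractional Brownian motion *)

Section power_kernel.
Context (R : realType).
Notation mu := (@lebesgue_measure R).

(** Its integral over [x > 0] is proportional to |t| ^ (2 a): this is the spectral representation of
    the variance of an increment of Hurst index [a]. *)
Definition power_kernel (a t x : R) : R := (1 - cos (t * x)) * x `^ (- 1 - 2 * a).

Lemma power_kernel_ge0 a t x : 0 <= power_kernel a t x.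
Proof. by rewrite mulr_ge0 ?powR_ge0// onem_cos_ge0. Qed.

Lemma measurable_power_kernel a t : measurable_fun setT (power_kernel a t).
Proof.
apply: measurable_funM; last exact: measurable_powR.
apply: measurable_funB => //; apply: measurableT_comp; first exact: measurable_cos.
exact: mulrl_measurable.
Qed.

(** At the origin [1 - cos] is of order two and [a < 1] gives integrability; at infinity it is
    bounded and [a > 0] does. *)
Lemma integrable_power_kernel (a t : R) : 0 < a -> a < 1 ->
  mu.-integrable `]0, +oo[ (EFin \o power_kernel a t).
Proof.
move=> a0 a1; apply/integrableP; split.
  by apply/measurable_EFinP/measurable_funTS; exact: measurable_power_kernel.
under eq_integral => x _ do rewrite /= ger0_norm ?power_kernel_ge0//.
have mk (D : set R) : measurable_fun D (fun x => (power_kernel a t x)%:E).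
  by apply/measurable_EFinP/measurable_funTS; exact: measurable_power_kernel.
have -> : `]0, +oo[%classic = `]0, 1] `|` `]1, +oo[ :> set R.
  by rewrite -itv_bndbnd_setU// bnd_simp.
rewrite ge0_integral_setU//=; last 3 first.
- exact: mk.
- by move=> x _; rewrite lee_fin power_kernel_ge0.
- apply/disj_setPS => x [] /=; rewrite !in_itv/= => /andP[_ x1].
  by rewrite andbT ltNge x1.
apply: lte_add_pinfty.
- apply: (@le_lt_trans _ _ (\int[mu]_(x in `]0%R, 1%R]) ((t ^+ 2)%:E * (x `^ (1 - 2 * a))%:E))%E).
    apply: ge0_le_integral => //.
    + by move=> x _; rewrite lee_fin power_kernel_ge0.
    + exact: mk.
    + by apply: emeasurable_funM => //; exact: measurable_powR_EFin.
    + move=> x; rewrite /= in_itv/= => /andP[x0 _].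
      rewrite -EFinM lee_fin /power_kernel.
      have -> : x `^ (1 - 2 * a) = x ^+ 2 * x `^ (- 1 - 2 * a).
        rewrite -powR_mulrn ?ltW// -powRD ?(gt_eqF x0) ?implybT//.
        by congr (_ `^ _); ring.
      by rewrite mulrA ler_wpM2r ?powR_ge0// -exprMn onem_cos_le_sqr.
  rewrite ge0_integralZl//; last 3 first.
  + exact: measurable_powR_EFin.
  + by move=> x _; rewrite lee_fin powR_ge0.
  + by rewrite lee_fin sqr_ge0.
  rewrite lte_mul_pinfty ?lee_fin ?sqr_ge0//.
  by rewrite (le_lt_trans (integral_powR_origin _ _)) ?ltry//; lra.
- apply: (@le_lt_trans _ _ (\int[mu]_(x in `]1%R, +oo[) (2%:E * (x `^ (- 1 - 2 * a))%:E))%E).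
    apply: ge0_le_integral => //.
    + by move=> x _; rewrite lee_fin power_kernel_ge0.
    + exact: mk.
    + by apply: emeasurable_funM => //; exact: measurable_powR_EFin.
    + move=> x _; rewrite -EFinM lee_fin /power_kernel.
      by rewrite ler_wpM2r ?powR_ge0// onem_cos_le2.
  rewrite ge0_integralZl//; last 2 first.
  + exact: measurable_powR_EFin.
  + by move=> x _; rewrite lee_fin powR_ge0.
  rewrite lte_mul_pinfty ?lee_fin//.
  rewrite integral_itv_obnd_cbnd; last exact: measurable_powR_EFin.
  by rewrite (le_lt_trans (integral_powR_tail _)) ?ltry//; lra.
Qed.

Definition kernel_mass (a : R) : R := \int[mu]_(x in `]0, +oo[) power_kernel a 1 x.

Lemma integral_power_kernel_gt0 (a t : R) : 0 < a -> a < 1 -> 0 < t ->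
  \int[mu]_(x in `]0, +oo[) power_kernel a t x = t `^ (2 * a) * kernel_mass a.
Proof.
move=> a0 a1 t0; pose f (x : R) := ((fun x => (power_kernel a 1 x)%:E) \_ `]0, +oo[) x.
have mk (D : set R) u : measurable_fun D (fun x => (power_kernel a u x)%:E).
  by apply/measurable_EFinP/measurable_funTS; exact: measurable_power_kernel.
have mf : measurable_fun setT f by apply/(measurable_restrictT _ _).1.
have f0 x : (0 <= f x)%E by rewrite /f patchE; case: ifP; rewrite ?lee_fin ?power_kernel_ge0.
have fi u : (\int[mu]_(x in `]0%R, +oo[) (power_kernel a u x)%:E)%E \is a fin_num.
  by apply: integrable_fin_num => //; exact: integrable_power_kernel.
have E1 : (\int[mu]_(x in `]0%R, +oo[) (power_kernel a 1 x)%:E =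
    t%:E * ((t `^ (- 1 - 2 * a))%:E * \int[mu]_(x in `]0%R, +oo[) (power_kernel a t x)%:E))%E.
  rewrite [LHS]integral_mkcond (ge0_integral_shift_scale 0 t0 mf f0); congr (_ * _)%E.
  rewrite -ge0_integralZl//; last 3 first.
  - exact: mk.
  - by move=> x _; rewrite lee_fin power_kernel_ge0.
  - by rewrite lee_fin powR_ge0.
  rewrite [RHS]integral_mkcond; apply: eq_integral => x _.
  rewrite addr0 /f !patchE.
  have -> : (t * x \in `]0, +oo[%classic) = (x \in `]0, +oo[%classic).
    by apply/idP/idP; rewrite !inE /= !in_itv/= !andbT pmulr_rgt0.
  case: ifPn => // /set_mem/=; rewrite in_itv/= andbT => x0.
  rewrite -EFinM /power_kernel mul1r powRM ?ltW//; congr EFin; ring.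
move: E1 => /(congr1 fine); rewrite /kernel_mass /Rintegral.
rewrite fineM ?fin_numM// fineM// => ->/=.
rewrite !mulrA -[X in _ = _ * X * _ * _](powRr1 (ltW t0)) -!powRD ?(gt_eqF t0) ?implybT//.
have -> : 2 * a + 1 + (-1 - 2 * a) = 0 by ring.
by rewrite powRr0 mul1r.
Qed.

Lemma integral_power_kernel (a t : R) : 0 < a -> a < 1 ->
  \int[mu]_(x in `]0, +oo[) power_kernel a t x = `|t| `^ (2 * a) * kernel_mass a.
Proof.
move=> a0 a1; have [->|t0] := eqVneq t 0.
  rewrite normr0 powR0 ?mul0r; last by rewrite mulf_neq0// lt0r_neq0.
  rewrite /power_kernel -[RHS](mul0r (fine (mu `]0%R, +oo[))) -Rintegral_cst//.
  by apply: eq_Rintegral => x _; rewrite mul0r cos0 subrr mul0r.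
rewrite -integral_power_kernel_gt0 ?normr_gt0//; apply: eq_Rintegral => x /set_mem/=.
rewrite in_itv/= andbT => x0; rewrite /power_kernel -[in RHS](gtr0_norm x0) -normrM cos_norm.
by rewrite gtr0_norm.
Qed.

Lemma kernel_mass_ge0 a : 0 <= kernel_mass a.
Proof. by apply: Rintegral_ge0 => x _; exact: power_kernel_ge0. Qed.

Lemma kernel_mass_gt0 a : 0 < a -> a < 1 -> 0 < kernel_mass a.
Proof.
move=> a0 a1; rewrite lt_neqAle eq_sym kernel_mass_ge0 andbT; apply/eqP => k0.
have mk (D : set R) : measurable_fun D (fun x => (power_kernel a 1 x)%:E).
  by apply/measurable_EFinP/measurable_funTS; exact: measurable_power_kernel.
have fi : (\int[mu]_(x in `]0%R, +oo[) (power_kernel a 1 x)%:E)%E \is a fin_num.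
  by apply: integrable_fin_num => //; exact: integrable_power_kernel.
(* On [[pi / 2, pi]] the cosine is nonpositive and the decreasing power is at least its value [c] at
   [pi]. *)
pose c := pi `^ (- 1 - 2 * a) : R.
have c0 : 0 < c by apply: powR_gt0; exact: pi_gt0.
have : (\int[mu]_(x in `[(pi / 2)%R, pi]) (c%:E) <= \int[mu]_(x in `]0%R, +oo[) (power_kernel a 1 x)%:E)%E.
  apply: (@le_trans _ _ (\int[mu]_(x in `[(pi / 2)%R, pi]) (power_kernel a 1 x)%:E)%E).
    apply: ge0_le_integral => //.
    - by move=> x _; rewrite lee_fin ltW.
    - exact: mk.
    move=> x; rewrite /= in_itv/= => /andP[x1 x2]; rewrite lee_fin /power_kernel mul1r.
    have p0 := pi_gt0 R.
    have xp : 0 < x by rewrite (lt_le_trans _ x1)// divr_gt0.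
    have cx : cos x <= 0.
      rewrite -[x](subrK (pi / 2)) cosDpihalf oppr_le0; apply: sin_ge0_pi.
      by apply/andP; split; lra.
    have h : c <= x `^ (-1 - 2 * a).
      rewrite /c; have -> : - 1 - 2 * a = - (1 + 2 * a) by ring.
      rewrite !powRN lef_pV2 ?posrE ?powR_gt0//.
      apply: ge0_ler_powR => //; rewrite ?nnegrE; [|exact: ltW|exact: ltW].
      by rewrite addr_ge0// mulr_ge0// ltW.
    by apply: le_trans h _; rewrite ler_peMl ?powR_ge0//; lra.
  apply: ge0_subset_integral => //.
  - exact: mk.
  - by move=> x _; rewrite lee_fin power_kernel_ge0.
  - move=> x; rewrite /= !in_itv/= => /andP[x1 x2]; rewrite andbT.
    by rewrite (lt_le_trans _ x1)// divr_gt0// pi_gt0.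
rewrite -(fineK fi) [X in (_ <= X%:E)%E](k0 : _ = 0) integral_cst//= lebesgue_measure_itv/= lte_fin.
have p0 := pi_gt0 R.
have -> : pi / 2 < pi :> R by lra.
rewrite -EFinB -EFinM lee_fin; apply/negP; rewrite -ltNge mulr_gt0//; lra.
Qed.

End power_kernel.

(** * Lower bound for the variance across a gap *)

Section local_nondeterminism.
Context (R : realType).
Notation mu := (@lebesgue_measure R).

(** The left-hand side is the squared modulus of a trigonometric polynomial. As the weights sum to
    zero, each [cos] of a difference may be replaced with [cos - 1], which brings in the numerator
    of [power_kernel]. *)
Lemma sqr_sum_cos_sin (T : Type) (l : seq T) (c t : T -> R) (x : R) :
  \sum_(i <- l) c i = 0 ->
  (\sum_(i <- l) c i * cos (t i * x)) ^+ 2 + (\sum_(i <- l) c i * sin (t i * x)) ^+ 2 =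
  - \sum_(i <- l) \sum_(j <- l) c i * c j * (1 - cos ((t i - t j) * x)).
Proof.
move=> c0.
have h i : \sum_(j <- l) c i * c j * (1 - cos ((t i - t j) * x)) =
  - (c i * cos (t i * x) * (\sum_(j <- l) c j * cos (t j * x)) +
     c i * sin (t i * x) * (\sum_(j <- l) c j * sin (t j * x))).
  transitivity (c i * \sum_(j <- l) c j
   - (c i * cos (t i * x) * (\sum_(j <- l) c j * cos (t j * x)) +
     c i * sin (t i * x) * (\sum_(j <- l) c j * sin (t j * x)))).
    rewrite !mulr_sumr -big_split/= -sumrB; apply: eq_bigr => j _.
    by rewrite mulrBl cosB; ring.
  by rewrite c0 mulr0 add0r.
under [in RHS]eq_bigr => i _ do rewrite h.
by rewrite sumrN opprK big_split/= -!mulr_suml !expr2.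
Qed.

Definition gap_lower_bound (H k : R) : Prop := forall (l : seq (R * R)) (u v : R),
  \sum_(x <- l) x.1 = 0 -> u < v -> (forall x, x \in l -> x.2 <= u \/ v <= x.2) ->
  k * (\sum_(x <- l | v <= x.2) x.1) ^+ 2 * (v - u) `^ (2 * H) <= increment_var H l.

Lemma local_nondeterminism (H : R) : 0 < H -> H < 1 ->
  exists2 k : R, 0 < k & gap_lower_bound H k.
Proof.
move=> H0 H1.
have Hc0 : 0 < 1 - H by rewrite subr_gt0.
have Hc1 : 1 - H < 1 by rewrite ltrBlDr ltrDl.
have h0 : 0 < 2^-1 :> R by rewrite invr_gt0.
have h1 : 2^-1 < 1 :> R by lra.
set D := `]0, +oo[%classic : set R.
have [d1 d1E d10] : exists2 z, z = kernel_mass H & 0 < z.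
  by exists (kernel_mass H) => //; exact: kernel_mass_gt0.
have [d2 d2E d20] : exists2 z, z = kernel_mass (2^-1 : R) & 0 < z.
  by exists (kernel_mass (2^-1 : R)) => //; exact: kernel_mass_gt0.
have [d3 d3E d30] : exists2 z, z = kernel_mass (1 - H) & 0 < z.
  by exists (kernel_mass (1 - H)) => //; exact: kernel_mass_gt0.
have k0 := divr_gt0 (exprn_gt0 2 d20) (mulr_gt0 d10 d30).
exists (d2 ^+ 2 / (d1 * d3)); first exact: k0.
move=> l u v c0 uv luv.
set q := \sum_(x <- l | v <= x.2) x.1; set V := increment_var H l.
pose len := v - u; have len0 : 0 < len by rewrite subr_gt0.
pose A x := \sum_(i <- l) i.1 * cos (i.2 * x).
pose S x := \sum_(i <- l) i.1 * sin (i.2 * x).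
have mD : measurable (D : set (measurableTypeR R)) by exact: measurable_itv.
have ik a (t : R) : 0 < a -> a < 1 -> mu.-integrable D (EFin \o power_kernel a t).
  by move=> a0 a1; exact: integrable_power_kernel.
have ikZ a (c t : R) : 0 < a -> a < 1 -> mu.-integrable D (EFin \o (fun x => c * power_kernel a t x)).
  by move=> a0 a1; have := integrableZl mD c (ik a t a0 a1); exact.
pose f1 x := - \sum_(i <- l) \sum_(j <- l) i.1 * j.1 * power_kernel H (i.2 - j.2) x.
have f1E x : f1 x = (A x ^+ 2 + S x ^+ 2) * x `^ (- 1 - 2 * H).
  rewrite /A /S (sqr_sum_cos_sin (fun i => i.2) x c0) mulNr; congr (- _).
  rewrite mulr_suml; apply: eq_bigr => i _; rewrite mulr_suml; apply: eq_bigr => j _.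
  by rewrite /power_kernel mulrA.
have if1' : mu.-integrable D (EFin \o (fun x => \sum_(i <- l) \sum_(j <- l) i.1 * j.1 * power_kernel H (i.2 - j.2) x)).
  apply: integrable_sum_EFin => // i; apply: integrable_sum_EFin => // j; exact: ikZ.
have if1 : mu.-integrable D (EFin \o f1) by have := integrableN if1'; exact.
have Rf1 : \int[mu]_(x in D) f1 x = 2 * d1 * V.
  transitivity (- \int[mu]_(x in D) (\sum_(i <- l) \sum_(j <- l) i.1 * j.1 * power_kernel H (i.2 - j.2) x)).
    rewrite -[RHS]mulN1r -RintegralZl//; apply: eq_Rintegral => x _; by rewrite mulN1r.
  rewrite Rintegral_sum//; last by move=> i; apply: integrable_sum_EFin => // j; exact: ikZ.
  rewrite /V /increment_var mulrA.
  have -> : 2 * d1 * - 2^-1 = - d1 by field.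
  rewrite mulNr mulr_sumr; congr (- _); apply: eq_bigr => i _.
  rewrite mulr_sumr Rintegral_sum//; last by move=> j; exact: ikZ.
  apply: eq_bigr => j _; rewrite RintegralZl//; last exact: ik.
  by rewrite integral_power_kernel// -d1E; ring.
pose f2 x := \sum_(i <- l) (i.1 * power_kernel 2^-1 (i.2 - u) x - i.1 * power_kernel 2^-1 (i.2 - v) x).
have i2 i : mu.-integrable D (EFin \o (fun x => i.1 * power_kernel 2^-1 (i.2 - u) x - i.1 * power_kernel 2^-1 (i.2 - v) x)).
  by have := integrableB mD (ikZ _ i.1 (i.2 - u) h0 h1) (ikZ _ i.1 (i.2 - v) h0 h1); exact.
have if2 : mu.-integrable D (EFin \o f2) by exact: integrable_sum_EFin.
have Rf2 : \int[mu]_(x in D) f2 x = 2 * d2 * len * q.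
  rewrite Rintegral_sum//.
  (* For a time outside the gap, [|i.2 - u| - |i.2 - v|] is [len] or [- len], that is [2 * len]
     times the indicator of [v <= i.2], minus [len]; the constant part cancels because the weights
     sum to zero. *)
  transitivity (\sum_(i <- l) d2 * (i.1 * (if v <= i.2 then 2 * len else 0) - i.1 * len)).
    apply: eq_big_seq => i il.
    rewrite RintegralB//; [|exact: ikZ|exact: ikZ].
    rewrite !RintegralZl//; [|exact: ik|exact: ik].
    rewrite !integral_power_kernel// -d2E divff// !powRr1 ?normr_ge0//.
    have [vi|vi] := leP v i.2.
      rewrite !ger0_norm ?subr_ge0//; last by rewrite (le_trans (ltW uv)).
      by rewrite /len; ring.
    have iu : i.2 <= u by case: (luv i il) => // /le_lt_trans/(_ vi); rewrite ltxx.
    rewrite !ler0_norm ?subr_le0//; last by rewrite (le_trans iu)// ltW.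
    by rewrite /len; ring.
  rewrite -mulr_sumr sumrB -mulr_suml c0 mul0r subr0.
  rewrite (eq_bigr (fun i => if v <= i.2 then i.1 * (2 * len) else 0)); last first.
    by move=> i _; case: ifP; rewrite ?mulr0.
  by rewrite -big_mkcond/= -mulr_suml -/q; ring.
pose f3 := power_kernel (1 - H) len.
have Rf3 : \int[mu]_(x in D) (2 * f3 x) = 2 * d3 * len `^ (2 * (1 - H)).
  rewrite RintegralZl//; last exact: ik.
  by rewrite integral_power_kernel// gtr0_norm// -d3E; ring.
(* [f1] is the spectral density [|A + i S| ^+ 2 * x `^ (-1 - 2 H)] of the variance.  Pairing
   [A + i S] with [exp (i v x) - exp (i u x)] against [x `^ (-2)] gives [f2], whose integral is
   computed by the case of Hurst index [1/2] and only sees the jump [q]; Cauchy-Schwarz leaves the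
   kernel [f3], of index [1 - H]. *)
have ptw m x : D x -> 2 * m * f2 x <= m ^+ 2 * f1 x + 2 * f3 x.
  rewrite /D/= in_itv/= andbT => x0.
  pose r := x `^ (2^-1 * (- 1 - 2 * H)); pose s := x `^ (2^-1 * (- 1 - 2 * (1 - H))).
  have xn (p : R) : (p == 0) ==> (x != 0) by rewrite (gt_eqF x0) implybT.
  have rr : x `^ (- 1 - 2 * H) = r * r.
    by rewrite /r -powRD//; congr (_ `^ _); field.
  have ss : x `^ (- 1 - 2 * (1 - H)) = s * s.
    by rewrite /s -powRD//; congr (_ `^ _); field.
  have rs : x `^ (- 1 - 2 * 2^-1) = r * s.
    by rewrite /r /s -powRD//; congr (_ `^ _); field.
  have -> : f2 x = (A x * (cos (v * x) - cos (u * x)) + S x * (sin (v * x) - sin (u * x))) * (r * s).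
    rewrite /f2 /A /S !mulr_suml -big_split/= mulr_suml; apply: eq_bigr => i _.
    rewrite /power_kernel rs !mulrBl !cosB; ring.
  have -> : f3 x = (1 - (cos (v * x) * cos (u * x) + sin (v * x) * sin (u * x))) * (s * s).
    by rewrite /f3 /power_kernel ss /len; congr ((1 - _) * _); rewrite mulrBl cosB.
  rewrite f1E rr.
  have := cos2Dsin2 (v * x); have := cos2Dsin2 (u * x).
  set a := cos (v * x); set b := sin (v * x); set a' := cos (u * x); set b' := sin (u * x).
  move=> e1 e2.
  (* Squared modulus of [m * (A + i S) * r - (exp (i v x) - exp (i u x)) * s], written with real and
     imaginary parts. *)
  have : 0 <= (m * A x * r - (a - a') * s) ^+ 2 + (m * S x * r - (b - b') * s) ^+ 2.
    by rewrite addr_ge0 ?sqr_ge0.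
  have -> : 1 - (a * a' + b * b') = ((a - a') ^+ 2 + (b - b') ^+ 2) / 2.
    by rewrite !sqrrB; lra.
  rewrite !sqrrB; lra.
have key m : 4 * m * d2 * len * q <= m ^+ 2 * (2 * d1 * V) + 2 * d3 * len `^ (2 * (1 - H)).
  rewrite -Rf1 -Rf3 -RintegralZl// -RintegralD//; last 2 first.
  - by have := integrableZl mD (m ^+ 2) if1; exact.
  - exact: ikZ.
  have -> : 4 * m * d2 * len * q = \int[mu]_(x in D) (2 * m * f2 x).
    by rewrite RintegralZl// Rf2; ring.
  apply: le_Rintegral => //.
  - by have := integrableZl mD (2 * m) if2; exact.
  - have i3 : mu.-integrable D (EFin \o (fun x => 2 * f3 x)) by exact: ikZ.
    by have := integrableD mD (integrableZl mD (m ^+ 2) if1) i3; exact.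
  - exact: ptw.
have V0 : 0 <= V.
  have : 0 <= \int[mu]_(x in D) f1 x.
    apply: Rintegral_ge0 => x _; rewrite f1E mulr_ge0 ?powR_ge0//.
    by rewrite addr_ge0 ?sqr_ge0.
  by rewrite Rf1 pmulr_rge0// mulr_gt0.
have [->|q0] := eqVneq q 0; first by rewrite expr0n/= mulr0 mul0r.
pose g := d3 * len `^ (2 * (1 - H)).
have g0 : 0 < g by rewrite mulr_gt0// powR_gt0.
(* The bound [key] is quadratic in [m]. This choice makes its left-hand side [4 * g], twice the
   contribution [2 * g] of the kernel [f3], so the variance term has to supply the other [2 * g]. *)
have := key (g / (d2 * len * q)).
have -> : 4 * (g / (d2 * len * q)) * d2 * len * q = 4 * g.
  by field; rewrite q0 !gt_eqF.
have -> : (g / (d2 * len * q)) ^+ 2 * (2 * d1 * V) + 2 * d3 * len `^ (2 * (1 - H)) =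
  2 * g * (g * d1 * V / (d2 * len * q) ^+ 2) + 2 * g.
  by rewrite /g; field; rewrite q0 !gt_eqF.
have z0 : 0 < (d2 * len * q) ^+ 2 by rewrite exprn_even_gt0//= !mulf_neq0// gt_eqF.
move=> h.
have : 1 <= g * d1 * V / (d2 * len * q) ^+ 2.
  by rewrite -(ler_pM2l (mulr_gt0 (ltr0n _ 2) g0)); lra.
rewrite ler_pdivlMr// mul1r => h2.
have lenE : len ^+ 2 = len `^ (2 * H) * len `^ (2 * (1 - H)).
  rewrite -powRD ?(gt_eqF len0) ?implybT// -powR_mulrn ?ltW//.
  by congr (_ `^ _); ring.
have l0 : 0 < len `^ (2 * (1 - H)) by rewrite powR_gt0.
rewrite -/len -(ler_pM2r (mulr_gt0 l0 (mulr_gt0 d10 d30))).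
have -> : V * (len `^ (2 * (1 - H)) * (d1 * d3)) = g * d1 * V by rewrite /g; ring.
apply: le_trans h2; rewrite !exprMn lenE le_eqVlt; apply/orP; left; apply/eqP.
by field; rewrite !gt_eqF.
Qed.

End local_nondeterminism.

(** * Occupation densities *)

Section heat_kernel.
Context (R : realType).
Notation mu := (@lebesgue_measure R).

Lemma measurable_heat (eps : R) : measurable_fun setT (heat eps).
Proof.
rewrite (_ : heat eps = (fun x => (Num.sqrt (2 * pi * eps))^-1 * gaussian eps^-1 x)).
  by apply: measurable_funM => //; exact: measurable_gaussian.
by apply/funext => x; rewrite heatE.
Qed.

Lemma heatN (eps x : R) : heat eps (- x) = heat eps x.
Proof. by rewrite /heat sqrrN. Qed.

(** Follows from [expR (- z) <= z^-1]; it serves to confine the local time to the range of the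
    increments. *)
Lemma heat_le_sqrt (eps eta x : R) : 0 < eps -> 0 < eta -> eta <= `|x| ->
  heat eps x <= 2 / eta ^+ 2 * Num.sqrt eps.
Proof.
move=> e0 eta0 etax.
have s0 : 0 < Num.sqrt eps by rewrite sqrtr_gt0.
have x2 : eta ^+ 2 <= x ^+ 2 by rewrite -[x ^+ 2]real_normK ?num_real// ler_pXn2r// nnegrE ltW.
have eta2 : 0 < eta ^+ 2 by rewrite exprn_gt0.
have xx : 0 < x ^+ 2 by rewrite (lt_le_trans _ x2).
have h1 : (Num.sqrt (2 * pi * eps))^-1 <= (Num.sqrt eps)^-1.
  rewrite lef_pV2 ?posrE ?sqrtr_gt0 ?mulr_gt0 ?pi_gt0//; apply: ler_wsqrtr.
  by rewrite ler_peMl ?(ltW e0)//; have := pi_ge2 R; lra.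
have h2 : expR (- x ^+ 2 / (2 * eps)) <= 2 * eps / eta ^+ 2.
  rewrite mulNr expRN -[leRHS]invrK lef_pV2 ?posrE ?expR_gt0 ?invr_gt0 ?divr_gt0 ?mulr_gt0//.
  rewrite invf_div; apply: (@le_trans _ _ (x ^+ 2 / (2 * eps))).
    by rewrite ler_pM2r ?invr_gt0 ?mulr_gt0.
  by apply: le_trans (expR_ge1Dx _); rewrite lerDr.
apply: (@le_trans _ _ ((Num.sqrt eps)^-1 * (2 * eps / eta ^+ 2))).
  by rewrite /heat ler_pM ?expR_ge0// invr_ge0 sqrtr_ge0.
rewrite -{2}(sqr_sqrtr (ltW e0)) le_eqVlt; apply/orP; left; apply/eqP.
by field; rewrite !gt_eqF.
Qed.

Lemma integral_heat (eps x : R) : 0 < eps -> (\int[mu]_y (heat eps (x - y))%:E = 1)%E.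
Proof.
move=> e0; have ei : 0 < eps^-1 by rewrite invr_gt0.
have k0 : 0 < Num.sqrt (2 * pi * eps) by rewrite sqrtr_gt0 !mulr_gt0// pi_gt0.
under eq_integral => y _ do rewrite -heatN opprB heatE.
have mg : measurable_fun setT (fun y => ((Num.sqrt (2 * pi * eps))^-1 * gaussian eps^-1 y)%:E).
  by apply/measurable_EFinP; apply: measurable_funM => //; exact: measurable_gaussian.
rewrite -(ge0_integral_shift (- x) mg); last first.
  by move=> y; rewrite lee_fin mulr_ge0 ?gaussian_ge0// invr_ge0 ltW.
under eq_integral => y _ do rewrite EFinM.
rewrite ge0_integralZl//; last 2 first.
- by apply/measurable_EFinP; exact: measurable_gaussian.
- by move=> y _; rewrite lee_fin gaussian_ge0.
by rewrite integral_gaussian// invrK -EFinM mulVf// gt_eqF.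
Qed.

Lemma integral_sqr_heat (eps x : R) : 0 < eps ->
  (\int[mu]_y ((y - x) ^+ 2 * heat eps (x - y))%:E = eps%:E)%E.
Proof.
move=> e0; have ei : 0 < eps^-1 by rewrite invr_gt0.
have k0 : 0 < Num.sqrt (2 * pi * eps) by rewrite sqrtr_gt0 !mulr_gt0// pi_gt0.
under eq_integral => y _ do rewrite -heatN opprB heatE mulrCA.
have ge0 (y : R) : 0 <= y ^+ 2 * gaussian eps^-1 y.
  by apply: mulr_ge0; [exact: sqr_ge0|exact: gaussian_ge0].
have mg0 : measurable_fun setT (fun y : R => y ^+ 2 * gaussian eps^-1 y).
  by apply: measurable_funM; [exact: exprn_measurable|exact: measurable_gaussian].
have mg : measurable_fun setT (fun y : R => ((Num.sqrt (2 * pi * eps))^-1 * (y ^+ 2 * gaussian eps^-1 y))%:E).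
  by apply/measurable_EFinP; exact: measurable_funM.
rewrite -(ge0_integral_shift (- x) mg); last first.
  by move=> y; rewrite lee_fin; apply: mulr_ge0 => //; rewrite invr_ge0 ltW.
under eq_integral => y _ do rewrite EFinM.
rewrite ge0_integralZl//; last 2 first.
- by apply/measurable_EFinP; exact: mg0.
- by move=> y _; rewrite lee_fin.
rewrite integral_sqr_gaussian// !invrK -EFinM; congr EFin.
by rewrite mulrCA mulVf ?mulr1 ?lt0r_neq0.
Qed.

Lemma cvg_heat_convolution (g : R -> R) (M x : R) : continuous g -> (forall y, `|g y| <= M) ->
  \int[mu]_y (g y * heat eps (x - y)) @[eps --> 0^'+] --> g x.
Proof.
move=> cg gM.
have mg : measurable_fun setT g by exact: continuous_measurable_fun.
have mh (eps : R) : measurable_fun setT (fun y : R => heat eps (x - y)).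
  by apply: measurableT_comp; [exact: measurable_heat|exact: measurable_funB].
have ih (eps : R) : 0 < eps -> mu.-integrable setT (EFin \o (fun y => heat eps (x - y))).
  move=> e0; apply/integrableP; split; first by apply/measurable_EFinP; exact: mh.
  under eq_integral => y _ do rewrite /= ger0_norm ?heat_ge0//.
  by rewrite integral_heat// ltry.
have ih2 (eps : R) : 0 < eps -> mu.-integrable setT (EFin \o (fun y => (y - x) ^+ 2 * heat eps (x - y))).
  move=> e0; apply/integrableP; split.
    apply/measurable_EFinP; apply: measurable_funM; last exact: mh.
    by apply: measurable_funX; exact: measurable_funB.
  have nn y : 0 <= (y - x) ^+ 2 * heat eps (x - y).
    by apply: mulr_ge0; [exact: sqr_ge0|exact: heat_ge0].
  under eq_integral => y _ do rewrite /= ger0_norm//.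
  by rewrite integral_sqr_heat// ltry.
have M0 : 0 <= M by rewrite (le_trans _ (gM 0)).
apply/cvgrPdist_le => e e0.
have e20 : 0 < e / 2 by rewrite divr_gt0.
have /cvgrPdist_le /(_ _ e20) [eta /= eta0 geta] := cg x.
have eta2 : 0 < eta ^+ 2 by rewrite exprn_gt0.
(* As in Chebyshev's inequality: beyond distance [eta] the crude bound [2 * M] is at most
   [c * (y - x) ^+ 2], and the second moment of the kernel is [eps]. *)
pose c := 2 * M / eta ^+ 2.
have c0 : 0 <= c by rewrite divr_ge0 ?mulr_ge0// ltW.
have gx y : `|g y - g x| <= e / 2 + c * (y - x) ^+ 2.
  have [xy|xy] := ltP `|x - y| eta.
    by rewrite distrC (le_trans (geta y xy))// lerDl mulr_ge0// sqr_ge0.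
  apply: (@le_trans _ _ (2 * M)).
    by rewrite (le_trans (ler_normB _ _))//; have := gM x; have := gM y; lra.
  apply: (@le_trans _ _ (c * eta ^+ 2)); first by rewrite /c divfK// gt_eqF.
  apply: (@le_trans _ _ (c * (y - x) ^+ 2)); last by rewrite lerDr ltW.
  by rewrite ler_wpM2l// -[(y - x) ^+ 2]real_normK ?num_real// distrC ler_pXn2r ?nnegrE// ltW.
have igh (eps : R) : 0 < eps -> mu.-integrable setT (EFin \o (fun y => g y * heat eps (x - y))).
  move=> e'0; apply: (@le_integrable _ _ _ mu _ measurableT _ (fun y => M%:E * (heat eps (x - y))%:E)%E) => //.
  - by apply/measurable_EFinP; apply: measurable_funM; [exact: mg|exact: mh].
  - move=> y _ /=; rewrite lee_fin !normrM ler_wpM2r//.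
    by rewrite (le_trans (gM y))// ler_norm.
  - by have := integrableZl measurableT M (ih _ e'0); exact.
near=> eps.
have e'0 : 0 < eps by near: eps; exact: nbhs_right_gt.
have mass : \int[mu]_y heat eps (x - y) = 1 by rewrite /Rintegral integral_heat.
have -> : g x = \int[mu]_y (g x * heat eps (x - y)).
  by rewrite RintegralZl ?mass ?mulr1//; exact: ih.
have igx : mu.-integrable setT (EFin \o (fun y => g x * heat eps (x - y))).
  by have := integrableZl measurableT (g x) (ih _ e'0); exact.
rewrite distrC -RintegralB//; last exact: igh.
have id1 : mu.-integrable setT (EFin \o (fun y => g y * heat eps (x - y) - g x * heat eps (x - y))).
  by have := integrableB measurableT (igh _ e'0) igx; exact.
rewrite (le_trans (le_normr_Rintegral measurableT id1))//.
have i1 : mu.-integrable setT (EFin \o (fun y => e / 2 * heat eps (x - y))).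
  by have := integrableZl measurableT (e / 2) (ih _ e'0); exact.
have i2 : mu.-integrable setT (EFin \o (fun y => c * ((y - x) ^+ 2 * heat eps (x - y)))).
  by have := integrableZl measurableT c (ih2 _ e'0); exact.
apply: (@le_trans _ _ (\int[mu]_y (e / 2 * heat eps (x - y) + c * ((y - x) ^+ 2 * heat eps (x - y))))).
  apply: le_Rintegral => //.
  - by have := integrable_norm id1; exact.
  - by have := integrableD measurableT i1 i2; exact.
  move=> y _ /=; rewrite -mulrBl normrM [`|heat _ _|]ger0_norm ?heat_ge0// mulrA -mulrDl.
  by rewrite ler_wpM2r ?heat_ge0.
rewrite RintegralD// (RintegralZl _ measurableT (ih _ e'0)) (RintegralZl _ measurableT (ih2 _ e'0)).
rewrite mass [X in c * X]/Rintegral integral_sqr_heat//= mulr1.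
have ce : eps * (c + 1) <= e / 2.
  rewrite -ler_pdivlMr; last by rewrite ltr_wpDl.
  near: eps; apply: nbhs_right_le; rewrite divr_gt0// ltr_wpDl//.
by move: ce; rewrite mulrDr mulr1 (mulrC eps) => ce; clear -ce e'0; lra.
Unshelve. all: end_near. Qed.

End heat_kernel.

(** * Density of an occupation measure by Fourier inversion *)

Section occupation_density.
Context (R : realType) (d : measure_display) (Z : measurableType d).
Notation mu := (@lebesgue_measure R).
Variables (m : {sigma_finite_measure set Z -> \bar R}) (D : set Z) (X : Z -> R).

Definition cos_transform (p : R) : R := \int[m]_(z in D) cos (p * X z).
Definition sin_transform (p : R) : R := \int[m]_(z in D) sin (p * X z).

Hypotheses (mD : measurable D) (mDfin : (m D < +oo)%E)
  (mX : measurable_fun setT X).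

Lemma integrable_bounded_on (f : Z -> R) (M : R) : measurable_fun setT f ->
  (forall z, D z -> `|f z| <= M) -> m.-integrable D (EFin \o f).
Proof.
move=> mf fM; apply: measurable_bounded_integrable => //; first exact: measurable_funTS.
exists M; split; first exact: num_real.
by move=> x Mx y Dy /=; rewrite (le_trans (fM y Dy))// ltW.
Qed.

Lemma le_normr_Rintegral_bounded (f : Z -> R) (M : R) : measurable_fun setT f ->
  (forall z, D z -> `|f z| <= M) -> `|\int[m]_(z in D) f z| <= M * fine (m D).
Proof.
move=> mf fM; have intf := integrable_bounded_on mf fM.
rewrite (le_trans (le_normr_Rintegral mD intf))//.
rewrite -Rintegral_cst//; apply: le_Rintegral => //.
- have := integrable_norm intf; exact.
- by apply: (@integrable_bounded_on _ `|M|).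
Qed.

Lemma measurable_cosM (p y : R) : measurable_fun setT (fun z => cos (p * (X z - y))).
Proof.
apply: measurableT_comp; first exact: measurable_cos.
by apply: measurable_funM => //; exact: measurable_funB.
Qed.

Lemma measurable_cosX (p : R) : measurable_fun setT (fun z => cos (p * X z)).
Proof.
apply: measurableT_comp; first exact: measurable_cos.
exact: measurable_funM.
Qed.

Lemma measurable_sinX (p : R) : measurable_fun setT (fun z => sin (p * X z)).
Proof.
apply: measurableT_comp; first exact: measurable_sin.
exact: measurable_funM.
Qed.

Let icos p : m.-integrable D (EFin \o (fun z => cos (p * X z))).
Proof. by apply: (integrable_bounded_on (measurable_cosX p)) => z _; exact: cos_max. Qed.

Let isin p : m.-integrable D (EFin \o (fun z => sin (p * X z))).
Proof. by apply: (integrable_bounded_on (measurable_sinX p)) => z _; exact: sin_max. Qed.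

Lemma measurable_pX : measurable_fun [set: R * Z] (fun z => z.1 * X z.2).
Proof. by apply: measurable_funM => //; exact: measurableT_comp. Qed.

Lemma measurable_cos_transform : measurable_fun setT cos_transform.
Proof.
have h : measurable_fun [set: R * Z] (fun z => cos (z.1 * X z.2)).
  by apply: measurableT_comp; [exact: measurable_cos|exact: measurable_pX].
exact: (measurable_Rint m (f := fun (p : R) z => cos (p * X z)) mD h).
Qed.

Lemma measurable_sin_transform : measurable_fun setT sin_transform.
Proof.
have h : measurable_fun [set: R * Z] (fun z => sin (z.1 * X z.2)).
  by apply: measurableT_comp; [exact: measurable_sin|exact: measurable_pX].
exact: (measurable_Rint m (f := fun (p : R) z => sin (p * X z)) mD h).
Qed.

Lemma shifted_transform (p y : R) : \int[m]_(z in D) cos (p * (X z - y)) =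
  cos (p * y) * cos_transform p + sin (p * y) * sin_transform p.
Proof.
rewrite /cos_transform /sin_transform -!RintegralZl// -RintegralD//.
- by apply: eq_Rintegral => z _; rewrite mulrBr cosB; ring.
- by have := integrableZl mD (cos (p * y)) (icos p); exact.
- by have := integrableZl mD (sin (p * y)) (isin p); exact.
Qed.

(** The Gaussian factor makes the double integral absolutely convergent, so the identity holds
    before anything is known about the integrability of the transform. *)
Lemma heat_occupation (eps y : R) : 0 < eps ->
  \int[m]_(z in D) heat eps (X z - y) = (2 * pi)^-1 *
  \int[mu]_p ((cos (p * y) * cos_transform p + sin (p * y) * sin_transform p) * gaussian eps p).
Proof.
move=> e0.
under eq_Rintegral => z _ do rewrite -[heat _ _]mulr1 -(@cos0 R) heat_fourier//.
under eq_Rintegral => z _ do under eq_Rintegral => p _ do rewrite add0r mulrC [_ * p]mulrC.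
have mf : measurable_fun [set: Z * measurableTypeR R]
   (fun z => gaussian eps z.2 * cos (z.2 * (X z.1 - y))).
  apply: measurable_funM; first by apply: measurableT_comp => //; exact: measurable_gaussian.
  apply: measurableT_comp; first exact: measurable_cos.
  apply: measurable_funM => //.
  by apply: measurable_funB => //; exact: measurableT_comp.
have i1 : m.-integrable D (EFin \o (fun=> 1 : R)).
  by apply: (@integrable_bounded_on _ 1) => // z _; rewrite normr1.
have ig : mu.-integrable setT (EFin \o gaussian eps) by exact: integrable_gaussian.
have fab (z : Z) (p : R) : D z -> setT p -> `|gaussian eps p * cos (p * (X z - y))| <= 1 * gaussian eps p.
  move=> _ _; rewrite normrM mul1r ger0_norm ?gaussian_ge0//.
  by rewrite ler_piMr ?gaussian_ge0// cos_max.
rewrite RintegralZl//; last first.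
  exact: (integrable_Rint mD measurableT mf i1 ig fab).
rewrite (fubini_on mD measurableT mf i1 ig fab); congr (_ * _).
apply: eq_Rintegral => p _.
rewrite RintegralZl//; last first.
  by apply: (integrable_bounded_on (measurable_cosM p y)) => z _; exact: cos_max.
by rewrite shifted_transform mulrC.
Qed.

Definition occupation_density (y : R) : R := (2 * pi)^-1 *
  \int[mu]_p (cos (p * y) * cos_transform p + sin (p * y) * sin_transform p).

Hypothesis itr : mu.-integrable setT
  (EFin \o (fun p => `|cos_transform p| + `|sin_transform p|)).

Lemma measurable_shifted_transform (y : R) : measurable_fun setT
  (fun p : R => cos (p * y) * cos_transform p + sin (p * y) * sin_transform p).
Proof.
apply: measurable_funD; apply: measurable_funM.
- apply: measurableT_comp; first exact: measurable_cos.
  exact: mulrr_measurable.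
- exact: measurable_cos_transform.
- apply: measurableT_comp; first exact: measurable_sin.
  exact: mulrr_measurable.
- exact: measurable_sin_transform.
Qed.

Let shifted_transform_le p y : `|cos (p * y) * cos_transform p + sin (p * y) * sin_transform p| <=
  `|cos_transform p| + `|sin_transform p|.
Proof.
rewrite (le_trans (ler_normD _ _))// !normrM lerD// ler_piMl//.
- exact: cos_max.
- exact: sin_max.
Qed.

Let ishifted y : mu.-integrable setT (EFin \o
  (fun p => cos (p * y) * cos_transform p + sin (p * y) * sin_transform p)).
Proof.
apply: (le_integrable measurableT _ _ itr).
- by apply/measurable_EFinP; exact: measurable_shifted_transform.
- by move=> p _ /=; rewrite lee_fin (le_trans (shifted_transform_le p y))// ler_norm.
Qed.

Lemma cvg_heat_occupation (y : R) :
  \int[m]_(z in D) heat eps (X z - y) @[eps --> 0^'+] --> occupation_density y.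
Proof.
have h : (2 * pi)^-1 * \int[mu]_p ((cos (p * y) * cos_transform p + sin (p * y) * sin_transform p) * gaussian eps p) @[eps --> 0^'+] --> occupation_density y.
  apply: cvgMr.
  apply: (@cvg_Rint_right _ (measurableTypeR R) R mu setT
    (fun e p => (cos (p * y) * cos_transform p + sin (p * y) * sin_transform p) * gaussian e p)
    (fun p => cos (p * y) * cos_transform p + sin (p * y) * sin_transform p)
    (fun p => `|cos_transform p| + `|sin_transform p|)) => //.
  - move=> e _; apply: measurable_funM; last exact: measurable_gaussian.
    exact: measurable_shifted_transform.
  - move=> p _; rewrite -[X in _ --> X]mulr1; apply: cvgMr.
    rewrite /gaussian -[X in _ --> X](@expR0 R).
    apply: (@cvg_comp _ _ _ (fun e : R => - (e * p ^+ 2) / 2) expR); last exact: continuous_expR.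
    have {2}-> : 0 = - (0 * p ^+ 2) / 2 :> R by rewrite mul0r oppr0 mul0r.
    apply: cvgMl; apply: cvgN; apply: cvgMl.
    by apply: cvg_at_right_filter; exact: cvg_id.
  - move=> e p e0 _; rewrite normrM [`|gaussian _ _|]ger0_norm ?gaussian_ge0//.
    by rewrite (le_trans _ (shifted_transform_le p y))// ler_piMr// gaussian_le1// ltW.
apply: cvg_trans h; apply: near_eq_cvg.
near=> e; have e0 : 0 < e by near: e; exact: nbhs_right_gt.
by rewrite heat_occupation.
Unshelve. all: end_near. Qed.

Let A := (2 * pi)^-1 * \int[mu]_p (`|cos_transform p| + `|sin_transform p|).

Lemma heat_occupation_le (eps y : R) : 0 < eps -> `|\int[m]_(z in D) heat eps (X z - y)| <= A.
Proof.
move=> e0; rewrite heat_occupation// normrM ger0_norm ?invr_ge0 ?mulr_ge0 ?pi_ge0//.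
rewrite ler_pM2l ?invr_gt0 ?mulr_gt0 ?pi_gt0//.
have ii : mu.-integrable setT (EFin \o
  (fun p => (cos (p * y) * cos_transform p + sin (p * y) * sin_transform p) * gaussian eps p)).
  apply: (le_integrable measurableT _ _ itr).
  - apply/measurable_EFinP; apply: measurable_funM; last exact: measurable_gaussian.
    exact: measurable_shifted_transform.
  - move=> p _ /=; rewrite lee_fin normrM [`|gaussian _ _|]ger0_norm ?gaussian_ge0//.
    rewrite (le_trans _ (ler_norm _))// (le_trans _ (shifted_transform_le p y))//.
    by rewrite ler_piMr// gaussian_le1// ltW.
rewrite (le_trans (le_normr_Rintegral measurableT ii))//.
apply: le_Rintegral => //; first by have := integrable_norm ii; exact.
move=> p _ /=; rewrite normrM [`|gaussian _ _|]ger0_norm ?gaussian_ge0//.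
by rewrite (le_trans _ (shifted_transform_le p y))// ler_piMr// gaussian_le1// ltW.
Qed.

Lemma measurable_occupation_density : measurable_fun setT occupation_density.
Proof.
apply: measurable_funM => //.
have h : measurable_fun [set: R * measurableTypeR R]
   (fun z => cos (z.2 * z.1) * cos_transform z.2 + sin (z.2 * z.1) * sin_transform z.2).
  apply: measurable_funD; apply: measurable_funM.
  - by apply: measurableT_comp; [exact: measurable_cos|exact: measurable_funM].
  - by apply: measurableT_comp; [exact: measurable_cos_transform|].
  - by apply: measurableT_comp; [exact: measurable_sin|exact: measurable_funM].
  - by apply: measurableT_comp; [exact: measurable_sin_transform|].
have := measurable_Rint mu (f := fun (y p : R) => cos (p * y) * cos_transform p + sin (p * y) * sin_transform p) measurableT h.
exact.
Qed.

Lemma occupation_density_le y : `|occupation_density y| <= A.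
Proof.
rewrite /occupation_density /A normrM ger0_norm ?invr_ge0 ?mulr_ge0 ?pi_ge0//.
rewrite ler_pM2l ?invr_gt0 ?mulr_gt0 ?pi_gt0//.
rewrite (le_trans (le_normr_Rintegral measurableT (ishifted y)))//.
apply: le_Rintegral => //; first by have := integrable_norm (ishifted y); exact.
Qed.

Section bounded_support.
Variables (r : R).
Hypothesis Xr : forall z, D z -> `|X z| <= r.

(** The heat averages tend to zero away from the range of [X]. Test functions in the occupation
    formula are only continuous, possibly unbounded, and this is what permits cutting them off. *)
Lemma occupation_density_out y : r < `|y| -> occupation_density y = 0.
Proof.
move=> ry; pose eta := `|y| - r; have eta0 : 0 < eta by rewrite subr_gt0.
have mhX (eps : R) : measurable_fun setT (fun z => heat eps (X z - y)).
  by apply: measurableT_comp; [exact: measurable_heat|exact: measurable_funB].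
rewrite -(cvg_lim _ (@cvg_heat_occupation y))//; apply/cvg_lim => //.
have h : 2 / eta ^+ 2 * Num.sqrt eps * fine (m D) @[eps --> 0^'+] --> (0 : R).
  rewrite [X in _ --> X](_ : _ = 2 / eta ^+ 2 * Num.sqrt 0 * fine (m D)).
    apply: cvgMl; apply: cvgMr; apply: cvg_at_right_filter; exact: sqrt_continuous.
  by rewrite sqrtr0 mulr0 mul0r.
apply: norm_cvg0; apply: (@squeeze_cvgr _ _ _ _ (cst 0) _ _ _ _ _ h); last exact: cvg_cst.
near=> e; rewrite normr_ge0/=.
have e0 : 0 < e by near: e; exact: nbhs_right_gt.
apply: le_normr_Rintegral_bounded => // z Dz.
rewrite ger0_norm ?heat_ge0//; apply: heat_le_sqrt => //.
rewrite /eta distrC (le_trans _ (lerB_dist _ _))// lerB//; exact: Xr.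
Unshelve. all: end_near. Qed.

(** Both sides are limits of the integral of [g] against the regularized density. In [c1] domination
    comes from [heat_occupation_le], which is uniform in [eps]; in [c2] the heat kernel acts as an
    approximate identity; Fubini's theorem equates the two integrals for each [eps]. *)
Lemma occupation_formula_bounded_support (g : R -> R) (M L : R) : continuous g ->
  (forall y, `|g y| <= M) -> (forall y, L < `|y| -> g y = 0) ->
  \int[m]_(z in D) g (X z) = \int[mu]_y (g y * occupation_density y).
Proof.
move=> cg gM gL.
have M0 : 0 <= M by rewrite (le_trans _ (gM 0)).
have mg : measurable_fun setT g by exact: continuous_measurable_fun.
pose I := `[- L, L]%classic : set R.
have mI : measurable (I : set (measurableTypeR R)) by exact: measurable_itv.
have iI (c : R) : mu.-integrable setT (EFin \o (fun y => c * \1_I y)).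
  have h : mu.-integrable setT (EFin \o \1_I) by exact: (@integrable_indic_itv R (- L) L true false).
  by have := integrableZl measurableT c h; exact.
have gI y : g y = g y * \1_I y.
  have [yL|yL] := leP `|y| L; last by rewrite gL// mul0r.
  by rewrite /I indicE mem_set ?mulr1//= in_itv/= -ler_norml.
pose al e y := \int[m]_(z in D) heat e (X z - y).
have mX2 (e : R) : measurable_fun [set: Z * measurableTypeR R] (fun z => g z.2 * heat e (X z.1 - z.2)).
  apply: measurable_funM; first exact: measurableT_comp.
  apply: measurableT_comp; first exact: measurable_heat.
  by apply: measurable_funB => //; exact: measurableT_comp.
have mal e : measurable_fun setT (al e).
  have h : measurable_fun [set: measurableTypeR R * Z] (fun z => heat e (X z.2 - z.1)).
    apply: measurableT_comp; first exact: measurable_heat.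
    by apply: measurable_funB => //; exact: measurableT_comp.
  exact: (measurable_Rint m (f := fun (y : measurableTypeR R) z => heat e (X z - y)) mD h).
have c1 : \int[mu]_y (g y * al e y) @[e --> 0^'+] --> \int[mu]_y (g y * occupation_density y).
  apply: (@cvg_Rint_right _ (measurableTypeR R) R mu setT (fun e y => g y * al e y)
     (fun y => g y * occupation_density y) (fun y => (M * A) * \1_I y)) => //.
  - by move=> e _; apply: measurable_funM; [exact: mg|exact: mal].
  - by move=> y _; apply: cvgMr; exact: cvg_heat_occupation.
  - move=> e y e0 _; rewrite gI -mulrA [\1_I y * _]mulrC mulrA normrM.
    rewrite [`|\1_I y|]ger0_norm// ler_wpM2r// normrM ler_pM//.
    exact: heat_occupation_le.
have c2 : \int[m]_(z in D) (\int[mu]_y (g y * heat e (X z - y))) @[e --> 0^'+] --> \int[m]_(z in D) g (X z).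
  apply: (@cvg_Rint_right _ _ R m D (fun e z => \int[mu]_y (g y * heat e (X z - y)))
     (fun z => g (X z)) (fun=> M)) => //.
  - move=> e _; apply: measurable_funTS.
    exact: (measurable_Rint mu (f := fun z (y : measurableTypeR R) => g y * heat e (X z - y)) measurableT (mX2 e)).
  - by move=> z _; exact: (cvg_heat_convolution cg gM).
  - by apply: (@integrable_bounded_on _ M) => // z _; rewrite ger0_norm.
  - move=> e z e0 _.
    have ih : mu.-integrable setT (EFin \o (fun y => heat e (X z - y))).
      apply/integrableP; split.
        apply/measurable_EFinP; apply: measurableT_comp; first exact: measurable_heat.
        exact: measurable_funB.
      under eq_integral => y _ do rewrite /= ger0_norm ?heat_ge0//.
      by rewrite integral_heat// ltry.
    have iM : mu.-integrable setT (EFin \o (fun y => M * heat e (X z - y))).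
      by have := integrableZl measurableT M ih; exact.
    have igh : mu.-integrable setT (EFin \o (fun y => g y * heat e (X z - y))).
      apply: (@le_integrable _ _ _ mu _ measurableT _ _ _ _ iM).
      - apply/measurable_EFinP; apply: measurable_funM; first exact: mg.
        by apply: measurableT_comp; [exact: measurable_heat|exact: measurable_funB].
      - move=> y _ /=; rewrite lee_fin !normrM ler_wpM2r//.
        by rewrite (le_trans (gM y))// ler_norm.
    rewrite (le_trans (le_normr_Rintegral measurableT igh))//.
    rewrite -[leRHS]mulr1 -[X in M * X](_ : \int[mu]_y heat e (X z - y) = 1); last first.
      by rewrite /Rintegral integral_heat.
    rewrite -RintegralZl//; apply: le_Rintegral => //.
      by have := integrable_norm igh; exact.
    by move=> y _ /=; rewrite normrM [`|heat _ _|]ger0_norm ?heat_ge0// ler_wpM2r ?heat_ge0.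
rewrite -(cvg_lim _ c2)//; apply/cvg_lim => //; apply: cvg_trans c1; apply: near_eq_cvg; near=> e.
have e0 : 0 < e by near: e; exact: nbhs_right_gt.
pose k := (Num.sqrt (2 * pi * e))^-1.
have k0 : 0 <= k by rewrite invr_ge0 sqrtr_ge0.
have hk x : heat e x <= k by rewrite heatE ler_piMr// gaussian_le1// invr_ge0 ltW.
have i1 : m.-integrable D (EFin \o (fun=> 1 : R)).
  by apply: (@integrable_bounded_on _ 1) => // z _; rewrite normr1.
have fab (z : Z) (y : R) : D z -> setT y -> `|g y * heat e (X z - y)| <= 1 * ((M * k) * \1_I y).
  move=> _ _; rewrite mul1r gI mulrAC normrM [`|\1_I y|]ger0_norm// ler_wpM2r// normrM.
  by rewrite ler_pM// ger0_norm ?heat_ge0.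
rewrite (fubini_on mD measurableT (mX2 e) i1 (iI (M * k)) fab).
apply: eq_Rintegral => y _; rewrite RintegralZl//.
apply: (@integrable_bounded_on _ k).
  by apply: measurableT_comp; [exact: measurable_heat|exact: measurable_funB].
by move=> z _; rewrite ger0_norm ?heat_ge0.
Unshelve. all: end_near. Qed.

Lemma occupation_formula (g : R -> R) : continuous g ->
  (\int[m]_(z in D) (g (X z))%:E = \int[mu]_y (g y * occupation_density y)%:E)%E.
Proof.
(* The absolute value is there because [r] may be negative when [D] is empty. The cutoff [chi] below
   is [1] on the range of [X] and [0] beyond [L]. *)
move=> cg; pose L := `|r| + 1; have L0 : 0 < L by rewrite ltr_wpDl.
pose chi (y : R) := Num.max 0 (Num.min 1 (L - `|y|)).
have cchi : continuous chi.
  move=> y; apply: (@continuous_max R _ (fun=> 0) (fun y : R => Num.min 1 (L - `|y|))).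
    exact: cst_continuous.
  apply: (@continuous_min R _ (fun=> 1) (fun y : R => L - `|y|)).
    exact: cst_continuous.
  by apply: cvgB; [exact: cvg_cst|apply: cvg_norm; exact: cvg_id].
have chi01 y : 0 <= chi y <= 1.
  by rewrite /chi le_max lexx/= ge_max ler01/= ge_min lexx.
have chi1 y : `|y| <= `|r| -> chi y = 1.
  by move=> yr; rewrite /chi (min_idPl _) ?(max_idPr _)// /L; lra.
have chi0 y : L < `|y| -> chi y = 0.
  move=> yL; rewrite /chi; apply/max_idPl; rewrite ge_min; apply/orP; right; lra.
pose g' y := g y * chi y.
have cg' : continuous g' by move=> y; apply: cvgM; [exact: cg|exact: cchi].
have [M gM] : exists M, forall y, `|g' y| <= M.
  have LL : - L <= L by lra.
  have cgw : {within `[- L, L], continuous (fun y => `|g' y|)}.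
    by apply: continuous_subspaceT => y; apply: cvg_norm; exact: cg'.
  have [c _ cM] := EVT_max LL cgw.
  exists `|g' c| => y; have [yL|yL] := leP `|y| L; last by rewrite /g' chi0// mulr0 normr0.
  by apply: cM; rewrite in_itv/= -ler_norml.
have g'L y : L < `|y| -> g' y = 0 by move=> yL; rewrite /g' chi0// mulr0.
have h := occupation_formula_bounded_support cg' gM g'L.
have mg' : measurable_fun setT g' by exact: continuous_measurable_fun.
have i1 : m.-integrable D (EFin \o (fun z => g' (X z))).
  by apply: (@integrable_bounded_on _ M) => //; exact: measurableT_comp.
pose I := `[- L, L]%classic : set R.
have A0 : 0 <= A by rewrite (le_trans _ (occupation_density_le 0)).
have M0 : 0 <= M by rewrite (le_trans _ (gM 0)).
have i2 : mu.-integrable setT (EFin \o (fun y => g' y * occupation_density y)).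
  have hI : mu.-integrable setT (EFin \o \1_I) by exact: (@integrable_indic_itv R (- L) L true false).
  have hI2 : mu.-integrable setT (EFin \o (fun y => (M * A) * \1_I y)).
    by have := integrableZl measurableT (M * A) hI; exact.
  apply: (@le_integrable _ _ _ mu _ measurableT _ _ _ _ hI2).
  - by apply/measurable_EFinP; apply: measurable_funM; [exact: mg'|exact: measurable_occupation_density].
  - move=> y _ /=; rewrite lee_fin.
    have b0 : 0 <= M * A * \1_I y by apply: mulr_ge0 => //; exact: mulr_ge0.
    rewrite [leRHS]ger0_norm//.
    have [yL|yL] := leP `|y| L; last by rewrite g'L// mul0r normr0.
    rewrite indicE mem_set ?mulr1 /I/= ?in_itv/= -?ler_norml//.
    by rewrite normrM ler_pM// occupation_density_le.
transitivity (\int[m]_(z in D) (g' (X z))%:E)%E.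
  apply: eq_integral => z /set_mem Dz; rewrite /g' chi1 ?mulr1//.
  by rewrite (le_trans (Xr Dz))// ler_norm.
rewrite -[LHS]fineK; last exact: (integrable_fin_num mD i1).
transitivity (\int[mu]_y (g' y * occupation_density y)%:E)%E.
  by rewrite -[RHS]fineK; [congr EFin|exact: (integrable_fin_num measurableT i2)].
apply: eq_integral => y _; rewrite /g'; have [yr|yr] := leP `|y| r.
  by rewrite chi1 ?mulr1// (le_trans yr)// ler_norm.
by rewrite occupation_density_out// !mulr0.
Qed.

End bounded_support.
End occupation_density.

(** * Interpolation inequalities for powers *)

Section power_inequalities.
Context (R : realType).
Implicit Types x w : R.

Lemma powR_le1 x q : 0 <= x <= 1 -> 0 <= q -> x `^ q <= 1.
Proof.
move=> /andP[x0 x1] q0; have -> : 1 = 1 `^ q :> R by rewrite powR1.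
by apply: ge0_ler_powR; rewrite ?nnegrE.
Qed.

(** Each term on the right dominates on one side of the threshold [v], at which x ^ th equals
    [x * w]. The free weight [w] will be a power of the frequency. *)
Lemma powR_young x w (th : R) : 0 <= x -> 0 < w -> 0 < th -> th < 1 ->
  x `^ th <= x * w + w `^ (- (th / (1 - th))).
Proof.
move=> x0 w0 th0 th1; have th10 : 0 < 1 - th by rewrite subr_gt0.
pose v := w `^ (- (1 - th)^-1); have v0 : 0 < v by rewrite powR_gt0.
have [xv|vx] := leP x v.
  apply: (@le_trans _ _ (w `^ (- (th / (1 - th))))); last first.
    by rewrite lerDr mulr_ge0// ltW.
  have -> : - (th / (1 - th)) = - (1 - th)^-1 * th by ring.
  rewrite powRrM -/v; apply: ge0_ler_powR; rewrite ?nnegrE// ltW//.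
have xp : 0 < x by exact: lt_trans vx.
apply: (@le_trans _ _ (x * w)); last by rewrite lerDl powR_ge0.
have -> : x `^ th = x * x `^ (- (1 - th)).
  rewrite -{2}[x]powRr1// -powRD ?(gt_eqF xp) ?implybT//; congr (_ `^ _); ring.
rewrite ler_pM2l// powRN.
have -> : w = (v `^ (1 - th))^-1.
  by rewrite /v -powRrM -powRN mulNr opprK mulVf ?powRr1 ?ltW// gt_eqF.
rewrite lef_pV2 ?posrE ?powR_gt0//; apply: ge0_ler_powR; rewrite ?nnegrE ?ltW//.
Qed.

Lemma min_le_powR x y (q : R) : 0 <= x -> 0 <= y -> 0 <= q -> q <= 1 ->
  Num.min x y <= x `^ q * y `^ (1 - q).
Proof.
move=> x0 y0 q0 q1.
have [->|yn0] := eqVneq y 0.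
  rewrite (_ : Num.min x 0 = 0); first by rewrite mulr_ge0 ?powR_ge0.
  by apply/min_idPr.
have [->|xn0] := eqVneq x 0.
  rewrite (_ : Num.min 0 y = 0); first by rewrite mulr_ge0 ?powR_ge0.
  by apply/min_idPl.
have yp : 0 < y by rewrite lt_neqAle eq_sym yn0.
have xp : 0 < x by rewrite lt_neqAle eq_sym xn0.
have q1' : 0 <= 1 - q by rewrite subr_ge0.
have [xy|yx] := leP x y.
  rewrite -{1}[x]powRr1// -{1}(subrK q 1) addrC powRD ?xn0 ?implybT//.
  by rewrite ler_wpM2l ?powR_ge0//; apply: ge0_ler_powR; rewrite ?nnegrE.
rewrite -{1}[y]powRr1// -{1}(subrK q 1) addrC powRD ?yn0 ?implybT//.
by rewrite ler_wpM2r ?powR_ge0//; apply: ge0_ler_powR => //; rewrite ?nnegrE// ltW.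
Qed.

Lemma min2_le_powR x (q : R) : 0 <= x -> 0 <= q -> q <= 1 -> Num.min 2 x <= 2 * x `^ q.
Proof.
move=> x0 q0 q1; rewrite minC; apply: le_trans (min_le_powR _ _ q0 q1) _ => //.
rewrite mulrC ler_wpM2r ?powR_ge0// -[leRHS]powRr1//.
by apply: ler_powR; [lra|rewrite lerBlDr lerDl].
Qed.

(** Interpolates between the bound [2] and the Lipschitz bound, which trades a moment of order [q]
    in the frequency [p] for a Hoelder exponent [q] in space. *)
Lemma ler_dist_cos_powR (p y z q : R) : 0 <= q -> q <= 1 ->
  `|cos (p * y) - cos (p * z)| <= 2 * (`|p| `^ q * `|y - z| `^ q).
Proof.
move=> q0 q1; rewrite -powRM//; apply: le_trans (min2_le_powR _ q0 q1); last by rewrite mulr_ge0.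
rewrite le_min; apply/andP; split.
  by rewrite (le_trans (ler_normB _ _))//; have := cos_max (p * y); have := cos_max (p * z); lra.
by rewrite -normrM mulrBr ler_dist_cos.
Qed.

Lemma ler_dist_sin_powR (p y z q : R) : 0 <= q -> q <= 1 ->
  `|sin (p * y) - sin (p * z)| <= 2 * (`|p| `^ q * `|y - z| `^ q).
Proof.
move=> q0 q1; rewrite -powRM//; apply: le_trans (min2_le_powR _ q0 q1); last by rewrite mulr_ge0.
rewrite le_min; apply/andP; split.
  by rewrite (le_trans (ler_normB _ _))//; have := sin_max (p * y); have := sin_max (p * z); lra.
by rewrite -normrM mulrBr ler_dist_sin.
Qed.

End power_inequalities.

(** * Integrability at large frequencies *)

Section outer_integrals.
Context (R : realType).
Notation mu := (@lebesgue_measure R).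

Definition outer_set : set R := [set p | 1 <= `|p|].

Lemma outer_setE : outer_set = `]-oo, (- 1)%R] `|` `[1%R, +oo[.
Proof.
apply/seteqP; split => p; rewrite /outer_set /= !in_itv/= andbT ler_normr.
  by move=> /orP[|h]; [right|left; lra].
by move=> [h|->//]; apply/orP; right; lra.
Qed.

Lemma measurable_outer_set : measurable (outer_set : set (measurableTypeR R)).
Proof. by rewrite outer_setE; apply: measurableU; exact: measurable_itv. Qed.

Lemma measurable_powR_norm (q : R) : measurable_fun setT (fun p : R => `|p| `^ q).
Proof. by apply: (measurableT_comp (measurable_powR q)); exact: normr_measurable. Qed.

Lemma integral_outer_powR (q : R) : q < - 1 ->
  (\int[mu]_(p in outer_set) (`|p| `^ q)%:E < +oo)%E.
Proof.
move=> q1.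
have mp (D : set R) : measurable_fun D (fun p => (`|p| `^ q)%:E).
  by apply/measurable_EFinP/measurable_funTS; exact: measurable_powR_norm.
rewrite outer_setE ge0_integral_setU//=; last 2 first.
- exact: mp.
- by apply/disj_setPS => x [] /=; rewrite !in_itv/= andbT; lra.
have h : (\int[mu]_(p in `[1%R, +oo[) (`|p| `^ q)%:E < +oo)%E.
  under eq_integral => p /set_mem/=.
    rewrite in_itv/= andbT => p1; rewrite ger0_norm; last by rewrite (le_trans _ p1).
    over.
  by rewrite (le_lt_trans (integral_powR_tail q1))// ltry.
apply: lte_add_pinfty => //.
rewrite integral_mkcond ge0_integral_opp; last 2 first.
- by apply/(measurable_restrictT _ _).1 => //; exact: mp.
- by move=> x; rewrite patchE; case: ifP => // _; rewrite lee_fin powR_ge0.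
rewrite [X in (X < _)%E](_ : _ = \int[mu]_(p in `[1%R, +oo[) (`|p| `^ q)%:E)%E//.
rewrite [RHS]integral_mkcond; apply: eq_integral => x _.
rewrite !patchE normrN; congr (if _ then _ else _).
by apply/idP/idP; rewrite !inE /= !in_itv/= andbT; lra.
Qed.

(** Majorants of transforms have this shape: a constant is enough for frequencies below [1], so
    integrability is decided on [outer_set]. *)
Lemma integrable_outer (K : R) (w : R -> R) : 0 <= K -> measurable_fun setT w ->
  (forall p, 0 <= w p) -> (\int[mu]_(p in outer_set) (w p)%:E < +oo)%E ->
  mu.-integrable setT (EFin \o (fun p => if 1 <= `|p| then w p else K)).
Proof.
move=> K0 mw w0 iw; have mV := measurable_outer_set.
pose f p := if 1 <= `|p| then w p else K.
have f0 p : 0 <= f p by rewrite /f; case: ifP.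
have mf : measurable_fun setT f.
  apply: measurable_fun_ifT => //; apply: measurable_fun_ler => //; exact: normr_measurable.
apply/integrableP; split; first by apply/measurable_EFinP; exact: mf.
under eq_integral => p _ do rewrite /= -/(f p) ger0_norm//.
rewrite -(setUv outer_set) ge0_integral_setU//=; last 4 first.
- exact: measurableC.
- by rewrite setUv; apply/measurable_EFinP; exact: mf.
- by move=> p _; rewrite lee_fin.
- by apply/disj_setPS => p [].
apply: lte_add_pinfty.
  by under eq_integral => p /set_mem pV do rewrite /f pV.
apply: (@le_lt_trans _ _ (\int[mu]_(p in `[(- 1)%R, 1%R]) K%:E)%E).
  apply: (@le_trans _ _ (\int[mu]_(p in ~` outer_set) K%:E)%E).
    apply: ge0_le_integral => //.
    - exact: measurableC.
    - by move=> p _; rewrite lee_fin.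
    - by apply/measurable_EFinP/measurable_funTS; exact: mf.
    - by move=> p /negP; rewrite /f /= => /negbTE ->.
  apply: ge0_subset_integral => //; first exact: measurableC.
  move=> p /negP; rewrite -ltNge /= in_itv/= -ler_norml; exact: ltW.
rewrite integral_cst//= lebesgue_measure_itv/=; case: ifP => _; first by rewrite -EFinB -EFinM ltry.
by rewrite mule0.
Qed.

End outer_integrals.

(** * Local times of a single path *)

Section simplex.
Context (R : realType).
Notation mu := (@lebesgue_measure R).
Notation plane := (measurableTypeR R * measurableTypeR R)%type.
(** A named copy of the product measure, so that it can carry the structure of a sigma-finite
    measure which the Fubini lemmas ask for. *)
Definition plane_measure : set plane -> \bar R := (mu \x mu)%E.

HB.instance Definition _ := Measure.on plane_measure.

Lemma plane_measure_sigma_finite : sigma_finite setT plane_measure.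
Proof.
pose I n : set (measurableTypeR R) := [set` `[- n%:R : R, n%:R]].
exists (fun n => I n `*` I n).
  apply/seteqP; split => // -[x y] _.
  exists (Num.truncn (Num.max `|x| `|y|)).+1 => //=.
  have := truncnS_gt (Num.max `|x| `|y|); rewrite gt_max => /andP[hx hy].
  by rewrite /I/= !in_itv/= -!ler_norml !ltW.
move=> n; have mI : measurable (I n) by exact: measurable_itv.
split; first exact: measurableX.
have fI : (mu (I n) < +oo)%E by rewrite lebesgue_measure_itv; case: ifP => _; rewrite ltry.
by rewrite /plane_measure product_measure1E// lte_mul_pinfty// ge0_fin_numE.
Qed.

HB.instance Definition _ := Measure_isSigmaFinite.Build _ _ _ plane_measure
  plane_measure_sigma_finite.
Notation mu2 := plane_measure.

(** Here [z.1] is the later time [s] and [z.2] the earlier time [r], in the order of the iterated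
    integral [dint]. *)
Definition simplex (t : R) : set plane := [set z | [/\ 0 < z.2, z.2 < z.1 & z.1 < t]].
Definition strip (t' t : R) : set plane := [set z | [/\ 0 < z.2, z.2 < z.1, t' <= z.1 & z.1 < t]].

Lemma measurable_lt_set (f g : plane -> R) : measurable_fun setT f -> measurable_fun setT g ->
  measurable [set z | f z < g z].
Proof.
move=> mf mg; have := measurable_fun_ltr mf mg measurableT (I : measurable [set true]).
by rewrite setTI.
Qed.

Lemma measurable_simplex t : measurable (simplex t).
Proof.
have -> : simplex t = [set z | 0 < z.2] `&` ([set z | z.2 < z.1] `&` [set z | z.1 < t]).
  by apply/seteqP; split => z /=; [case|move=> [? [? ?]]].
apply: measurableI; first exact: (@measurable_lt_set (fun=> 0) snd).
by apply: measurableI; [exact: (@measurable_lt_set snd fst)|exact: (@measurable_lt_set fst (fun=> t))].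
Qed.

Lemma measurable_strip t' t : measurable (strip t' t).
Proof.
have -> : strip t' t = simplex t `\` [set z | z.1 < t'].
  apply/seteqP; split => z /=.
    by move=> [? ? h ?]; split => //; apply/negP; rewrite -leNgt.
  by move=> [[? ? ?] /negP]; rewrite -leNgt.
apply: measurableD; first exact: measurable_simplex.
exact: (@measurable_lt_set fst (fun=> t')).
Qed.

Lemma simplex_strip t' t : t' <= t -> simplex t = simplex t' `|` strip t' t.
Proof.
move=> tt'; apply/seteqP; split => z /=.
  by move=> [h1 h2 h3]; have [h4|h4] := ltP z.1 t'; [left|right].
by move=> [] [] => [h1 h2 h3|//]; split => //; exact: lt_le_trans tt'.
Qed.

Lemma disjoint_simplex_strip t' t : [disjoint simplex t' & strip t' t].
Proof. by apply/disj_setPS => z [[_ _ h1] [_ _ h2 _]]; move: h1; rewrite ltNge h2. Qed.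

Lemma measure_strip_le (T t' t : R) : 0 <= T -> t' <= t -> t <= T ->
  (mu2 (strip t' t) <= ((t - t') * T)%:E)%E.
Proof.
move=> T0 tt' tT.
have -> : ((t - t') * T)%:E = mu2 (`[t', t[ `*` `]0, T[).
  rewrite [RHS]product_measure1E//= !lebesgue_measure_itv/= !lte_fin.
  have [->|T0'] := eqVneq T 0; first by rewrite ltxx mule0 mulr0.
  have -> : 0 < T by rewrite lt_neqAle eq_sym T0'.
  rewrite oppr0 adde0; case: ltP => h; first by rewrite -EFinB -EFinM.
  by rewrite mul0e (_ : t = t') ?subrr ?mul0r//; lra.
apply: le_measure; rewrite ?inE.
- exact: measurable_strip.
- exact: measurableX.
- move=> z [h1 h2 h3 h4] /=; rewrite !in_itv/= h1 h3 h4 /=; split => //.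
  by rewrite (lt_trans h2)// (lt_le_trans h4).
Qed.

Lemma measure_simplex_le (T t : R) : 0 <= t -> t <= T -> (mu2 (simplex t) <= (T * T)%:E)%E.
Proof.
move=> t0 tT; have -> : simplex t = strip 0 t.
  apply/seteqP; split => z [] // h1 h2 h3; split => //.
  by rewrite ltW// (lt_trans h1).
apply: le_trans (measure_strip_le (le_trans t0 tT) t0 tT) _; rewrite lee_fin subr0 ler_wpM2r//.
exact: le_trans tT.
Qed.

Lemma simplex_fin t : (mu2 (simplex t) < +oo)%E.
Proof.
have [t0|t0] := leP 0 t; first by rewrite (le_lt_trans (measure_simplex_le t0 (lexx t)))// ltry.
have -> : simplex t = set0; last by rewrite measure0.
by apply/seteqP; split => z //= [h1 h2 h3]; move: t0 h1 h2 h3; lra.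
Qed.

Lemma strip_fin t' t : t' <= t -> (mu2 (strip t' t) < +oo)%E.
Proof. by move=> tt'; rewrite (le_lt_trans (measure_strip_le (normr_ge0 t) tt' (ler_norm t)))// ltry. Qed.

Lemma Rintegral_strip (t' t M : R) (f : plane -> R) : t' <= t ->
  measurable_fun setT f -> (forall z, `|f z| <= M) ->
  \int[mu2]_(z in simplex t) f z - \int[mu2]_(z in simplex t') f z =
  \int[mu2]_(z in strip t' t) f z.
Proof.
move=> tt' mf fM; rewrite (simplex_strip tt') Rintegral_setU.
- by rewrite addrAC subrr add0r.
- exact: measurable_simplex.
- exact: measurable_strip.
- rewrite -simplex_strip//; apply: (@integrable_bounded_on _ _ _ _ _ _ _ _ M) => //.
  + exact: measurable_simplex.
  + exact: simplex_fin.
- exact: disjoint_simplex_strip.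
Qed.

Lemma Rintegral_simplex_lip (T t' t M : R) (f : plane -> R) : 0 <= M -> 0 <= t' -> 0 <= t ->
  t' <= T -> t <= T ->
  measurable_fun setT f -> (forall z, `|f z| <= M) ->
  `|\int[mu2]_(z in simplex t) f z - \int[mu2]_(z in simplex t') f z| <= M * T * `|t - t'|.
Proof.
move=> M0; wlog tt' : t t' / t' <= t.
  move=> h t'0 t0 t'T tT mf fM; have [|/ltW] := leP t' t => tt'; first exact: h.
  by rewrite distrC (distrC t); exact: h.
move=> t'0 t0 t'T tT mf fM; rewrite (Rintegral_strip tt' mf fM).
apply: le_trans (le_normr_Rintegral_bounded (measurable_strip t' t) (strip_fin tt') mf (fun z _ => fM z)) _.
rewrite -mulrA ler_wpM2l// ger0_norm ?subr_ge0// mulrC.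
rewrite -lee_fin fineK; first exact: (measure_strip_le (le_trans t0 tT)).
by rewrite ge0_fin_numE// strip_fin.
Qed.

(** The integrand may change sign; boundedness on a simplex of finite measure makes it integrable,
    so that Fubini's theorem applies. *)
Lemma dint_simplex (t M : R) (h : R -> R -> R) :
  measurable_fun [set: plane] (fun z => h z.2 z.1) ->
  (forall z, simplex t z -> `|h z.2 z.1| <= M) ->
  dint t h = (\int[mu2]_(z in simplex t) (h z.2 z.1)%:E)%E.
Proof.
move=> mh hM; pose F := (fun z : plane => (h z.2 z.1)%:E) \_ (simplex t).
have ih : mu2.-integrable (simplex t) (EFin \o (fun z : plane => h z.2 z.1)).
  apply: (@integrable_bounded_on _ _ _ _ _ _ _ _ M) => //.
  - exact: measurable_simplex.
  - exact: simplex_fin.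
have iF : mu2.-integrable setT F by have := (integrable_mkcond (EFin \o (fun z : plane => h z.2 z.1)) (measurable_simplex t)).1 ih; exact.
rewrite [RHS]integral_mkcond -/F -[RHS](integral12_prod_meas1 iF) /dint.
rewrite integral_mkcond; apply: eq_integral => s _.
rewrite patchE; case: ifPn => [/set_mem /=|/negP hs].
  rewrite in_itv/= => /andP[s0 st]; rewrite [LHS]integral_mkcond /fubini_F; apply: eq_integral => r _.
  rewrite /F !patchE; congr (if _ then _ else _).
  apply/idP/idP; rewrite !inE /= in_itv/=; first by move=> /andP[? ?]; split.
  by move=> [? ? ?]; apply/andP.
rewrite /fubini_F integral0_eq// => r _; rewrite /F patchE ifF//.
apply/negP; rewrite inE /= => -[r0 rs st]; apply: hs.
by rewrite inE/= in_itv/= st (lt_trans r0).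
Qed.

End simplex.

(** * Regularity and occupation formula for one continuous path *)

Section path_local_time.
Context (R : realType).
Notation mu := (@lebesgue_measure R).
Notation mu2 := (@plane_measure R).
Notation plane := (measurableTypeR R * measurableTypeR R)%type.
Variables (H T : R) (b : R -> R).
Hypotheses (H0 : 0 < H) (H1 : H < 1) (T0 : 0 < T) (cb : continuous b).

Definition path_increment (z : plane) : R := b z.1 - b z.2.
Notation X := path_increment.
Notation c t := (cos_transform mu2 (simplex t) X).
Notation s t := (sin_transform mu2 (simplex t) X).
Definition path_local_time (t y : R) : R := occupation_density mu2 (simplex t) X y.

Lemma measurable_path : measurable_fun setT b.
Proof. exact: continuous_measurable_fun. Qed.

Lemma measurable_path_increment : measurable_fun setT X.
Proof.
apply: measurable_funB.
- exact: (measurableT_comp measurable_path (@measurable_fst _ _ (measurableTypeR R) (measurableTypeR R))).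
- exact: (measurableT_comp measurable_path (@measurable_snd _ _ (measurableTypeR R) (measurableTypeR R))).
Qed.
Let mX := measurable_path_increment.

Definition dominated_transform (kap : R) (m0 : R -> R) := [/\ measurable_fun setT m0,
  (forall p, 0 <= m0 p),
  (forall t p : R, 0 <= t <= T -> c t p ^+ 2 + s t p ^+ 2 <= m0 p) &
  (\int[mu]_(p in @outer_set R) (`|p| `^ kap * m0 p)%:E < +oo)%E].

Hypothesis hG : forall kap : R, kap < 2 / H - 1 -> exists m0 : R -> R, dominated_transform kap m0.

Lemma transform_norm_le (t p : R) : 0 <= t <= T -> `|c t p| <= T * T /\ `|s t p| <= T * T.
Proof.
move=> /andP[t0 tT].
have h : fine (mu2 (simplex t)) <= T * T.
  by rewrite -lee_fin fineK ?measure_simplex_le// ge0_fin_numE// simplex_fin.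
split.
  apply: le_trans (le_normr_Rintegral_bounded (M := 1) (measurable_simplex t) (simplex_fin t) (measurable_cosX mX p) _) _.
    by move=> z _; exact: cos_max.
  by rewrite mul1r.
apply: le_trans (le_normr_Rintegral_bounded (M := 1) (measurable_simplex t) (simplex_fin t) (measurable_sinX mX p) _) _.
  by move=> z _; exact: sin_max.
by rewrite mul1r.
Qed.

Lemma measurable_powR_normM (kap : R) (m0 : R -> R) : measurable_fun setT m0 ->
  measurable_fun setT (fun p : R => `|p| `^ kap * m0 p).
Proof. by move=> mm0; apply: measurable_funM => //; exact: measurable_powR_norm. Qed.

Lemma outer_integral_add (kap e : R) (m0 : R -> R) : measurable_fun setT m0 ->
  (forall p, 0 <= m0 p) -> e < - 1 ->
  (\int[mu]_(p in @outer_set R) (`|p| `^ kap * m0 p)%:E < +oo)%E ->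
  (\int[mu]_(p in @outer_set R) (`|p| `^ kap * m0 p + `|p| `^ e)%:E < +oo)%E.
Proof.
move=> mm0 m00 e1 im; under eq_integral => p _ do rewrite EFinD.
rewrite ge0_integralD//=; first by rewrite lte_add_pinfty// integral_outer_powR.
- exact: measurable_outer_set.
- by move=> p _; rewrite lee_fin mulr_ge0// powR_ge0.
- by apply/measurable_EFinP/measurable_funTS; exact: measurable_powR_normM.
- by apply/measurable_EFinP/measurable_funTS; exact: measurable_powR_norm.
Qed.

Lemma transform_moment_dominated (gam : R) : 0 <= gam -> gam < H^-1 - 1 ->
  exists G : R -> R, mu.-integrable setT (EFin \o G) /\
    forall t p : R, 0 <= t <= T -> (`|c t p| + `|s t p|) * `|p| `^ gam <= G p.
Proof.
(* By weighted AM-GM the left-hand side is at most [u * m0 p + x ^+ 2 / u], with x = |p| ^ gam and u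
   = |p| ^ kap. This [kap] makes both conditions, [kap < 2 / H - 1] and [2 * gam - kap < - 1],
   equivalent to [gam < H^-1 - 1]. *)
move=> g0 g1; pose kap := gam + H^-1.
have [m0 [mm0 m00 cm0 im0]] : exists m0 : R -> R, dominated_transform kap m0.
  by apply: hG; rewrite /kap; lra.
pose w (p : R) := `|p| `^ kap * m0 p + `|p| `^ (gam - H^-1).
exists (fun p => if 1 <= `|p| then w p else (T * T) *+ 2); split.
  apply: integrable_outer.
  - by rewrite mulrn_wge0// mulr_ge0// ltW.
  - by apply: measurable_funD; [exact: measurable_powR_normM|exact: measurable_powR_norm].
  - by move=> p; rewrite addr_ge0 ?mulr_ge0// powR_ge0.
  - by apply: outer_integral_add => //; lra.
move=> t p tT; have [cT sT] := transform_norm_le p tT; case: (leP 1 `|p|) => p1; last first.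
  have : `|p| `^ gam <= 1 by apply: powR_le1 => //; rewrite normr_ge0 ltW.
  have : 0 <= `|p| `^ gam by exact: powR_ge0.
  have := normr_ge0 (c t p); have := normr_ge0 (s t p).
  set x := `|p| `^ gam; set A := `|c t p| in cT *; set B := `|s t p| in sT *.
  move=> A0 B0 x0 x1; rewrite mulr2n; apply: le_trans (_ : (A + B) * 1 <= _).
    by apply: ler_wpM2l => //; exact: addr_ge0.
  by rewrite mulr1 lerD.
have pp : 0 < `|p| by exact: lt_le_trans p1.
have u0 : 0 < `|p| `^ kap by rewrite powR_gt0.
have -> : w p = `|p| `^ kap * m0 p + (`|p| `^ gam) ^+ 2 / `|p| `^ kap.
  congr (_ + _); rewrite expr2 -powRN -!powRD ?(gt_eqF pp) ?implybT//; congr (_ `^ _); rewrite /kap; ring.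
have := cm0 t p tT; rewrite -(real_normK (num_real (c t p))) -(real_normK (num_real (s t p))).
move: (`|c t p|) (`|s t p|) (`|p| `^ gam) (`|p| `^ kap) u0 (m0 p) => A B x u u0 m hm.
rewrite -subr_ge0 (_ : _ - _ = u * (m - (A ^+ 2 + B ^+ 2)) + ((u * A - x / 2) ^+ 2 + (u * B - x / 2) ^+ 2 + x ^+ 2 / 2) / u).
  rewrite addr_ge0 ?mulr_ge0 ?invr_ge0 ?(ltW u0) ?subr_ge0//.
  have := sqr_ge0 x; have := sqr_ge0 (u * A - x / 2); have := sqr_ge0 (u * B - x / 2).
  by move: (_ ^+ 2) (_ ^+ 2) (_ ^+ 2) => a1 a2 a3; lra.
by field; rewrite gt_eqF.
Qed.

Lemma transform_dist_le (t t' p : R) : 0 <= t <= T -> 0 <= t' <= T ->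
  `|c t p - c t' p| <= T * `|t - t'| /\ `|s t p - s t' p| <= T * `|t - t'|.
Proof.
move=> /andP[t0 tT] /andP[t'0 t'T]; split; rewrite -[T * _]mul1r mulrA.
  apply: Rintegral_simplex_lip => //; first exact: measurable_cosX.
  by move=> z; exact: cos_max.
apply: Rintegral_simplex_lip => //; first exact: measurable_sinX.
by move=> z; exact: sin_max.
Qed.

Lemma transform_increment_dominated (gam : R) : 0 < gam -> gam < 1 - H ->
  exists G : R -> R, mu.-integrable setT (EFin \o G) /\
    forall t t' p : R, 0 <= t <= T -> 0 <= t' <= T ->
      `|c t p - c t' p| + `|s t p - s t' p| <= `|t - t'| `^ gam * G p.
Proof.
move=> g0 g1; have g2 : 0 < 1 - gam by rewrite subr_gt0 (lt_trans g1)// gtrBl.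
(* Young's inequality with th = (1 - gam) / 2 leaves the power [e] of the frequency, and [e < - 1]
   means [kap > 2 / (1 - gam) - 1]. The chosen [kap] is the midpoint of this bound and [2 / H - 1],
   which come in this order because [gam < 1 - H]. *)
pose kap := (1 - gam)^-1 + H^-1 - 1; pose e := - (1 - gam) / (1 + gam) * kap.
have hH : (1 - gam)^-1 < H^-1 by rewrite ltf_pV2 ?posrE//; lra.
have [m0 [mm0 m00 cm0 im0]] : exists m0 : R -> R, dominated_transform kap m0.
  by apply: hG; rewrite /kap; lra.
have e1 : e < - 1.
  rewrite /e mulNr mulNr ltrN2 mulrAC ltr_pdivlMr; last by rewrite addr_gt0.
  rewrite mul1r mulrC; apply: (@lt_le_trans _ _ ((2 * (1 - gam)^-1 - 1 + (H^-1 - (1 - gam)^-1)) * (1 - gam))).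
    have := mulVf (lt0r_neq0 g2); have : 0 < (H^-1 - (1 - gam)^-1) * (1 - gam).
      by rewrite mulr_gt0// subr_gt0.
    move: (_^-1) (_^-1) => x y hx hy.
    have -> : (2 * x - 1 + (y - x)) * (1 - gam) = 2 * (x * (1 - gam)) - (1 - gam) + (y - x) * (1 - gam) by ring.
    by rewrite hy; lra.
  by rewrite ler_pM2r//; rewrite /kap; lra.
pose w (p : R) := `|p| `^ kap * m0 p + `|p| `^ e.
pose K := T `^ gam * 4.
exists (fun p => K * (if 1 <= `|p| then w p else (T * T) `^ (1 - gam))); split.
  have /(integrableZl measurableT K) : mu.-integrable setT
      (EFin \o (fun p : R => if 1 <= `|p| then w p else (T * T) `^ (1 - gam))); last by exact.
  apply: integrable_outer.
  - exact: powR_ge0.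
  - by apply: measurable_funD; [exact: measurable_powR_normM|exact: measurable_powR_norm].
  - by move=> p; rewrite addr_ge0 ?mulr_ge0// powR_ge0.
  - exact: outer_integral_add.
move=> t t' p tT t'T; have [dc ds] := transform_dist_le p tT t'T.
pose Y := if 1 <= `|p| then Num.sqrt (m0 p) else T * T.
have [cY sY] : (forall u, 0 <= u <= T -> `|c u p| <= Y) /\ (forall u, 0 <= u <= T -> `|s u p| <= Y).
  rewrite /Y; case: (leP 1 `|p|) => p1.
    split=> u uT; rewrite -sqrtr_sqr ler_sqrt//; apply: le_trans (cm0 u p uT).
      by rewrite lerDl sqr_ge0.
    by rewrite lerDr sqr_ge0.
  by split=> u uT; have [] := transform_norm_le p uT.
have Y0 : 0 <= Y by rewrite (le_trans _ (cY t tT)).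
have YW : Y `^ (1 - gam) <= if 1 <= `|p| then w p else (T * T) `^ (1 - gam).
  rewrite /Y; case: (leP 1 `|p|) => // p1.
  have pp : 0 < `|p| by exact: lt_le_trans p1.
  rewrite -powR12_sqrt// -powRrM; apply: le_trans (@powR_young _ _ (`|p| `^ kap) _ _ _ _ _) _ => //.
  - by rewrite powR_gt0.
  - by rewrite mulr_gt0// invr_gt0.
  - by lra.
  - rewrite /w mulrC lerD2l -powRrM le_eqVlt; apply/orP; left; apply/eqP; congr (_ `^ _).
    by rewrite /e; field; rewrite gt_eqF//; lra.
(* The increment is at most the Lipschitz bound and at most [2 * Y]; a geometric mean of the two has
   exponent [gam] in time and leaves Y ^ (1 - gam), which [YW] controls. *)
have key (a a' : R) : `|a| <= Y -> `|a'| <= Y -> `|a - a'| <= T * `|t - t'| ->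
    `|a - a'| <= T `^ gam * `|t - t'| `^ gam * (2 * Y `^ (1 - gam)).
  move=> aY a'Y h; rewrite -powRM; [|exact: ltW|exact: normr_ge0].
  have : `|a - a'| <= Num.min (T * `|t - t'|) (2 * Y).
    by rewrite le_min h (le_trans (ler_normB _ _))// mulr2n mulrDl !mul1r lerD.
  move/le_trans; apply; apply: le_trans (@min_le_powR _ _ _ gam _ _ _ _) _; [by rewrite mulr_ge0// ltW|by rewrite mulr_ge0|exact: ltW|lra|].
  apply: ler_wpM2l; first exact: powR_ge0.
  rewrite powRM// ler_wpM2r ?powR_ge0// -[leRHS]powRr1//; apply: ler_powR => //; lra.
apply: le_trans (lerD (key _ _ (cY t tT) (cY t' t'T) dc) (key _ _ (sY t tT) (sY t' t'T) ds)) _.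
have := ler_wpM2l (mulr_ge0 (powR_ge0 T gam) (powR_ge0 `|t - t'| gam)) YW.
rewrite /K; move: (T `^ gam) (`|t - t'| `^ gam) (Y `^ _) (if _ then _ else _) => x1 x2 x3 x4 h.
rewrite -subr_ge0 (_ : _ - _ = 4 * (x1 * x2 * x4 - x1 * x2 * x3)); last ring.
by rewrite mulr_ge0// subr_ge0.
Qed.

Lemma integrable_transform (t : R) : 0 <= t <= T ->
  mu.-integrable setT (EFin \o (fun p => `|c t p| + `|s t p|)).
Proof.
move=> tT; have [||G [iG cG]] := @transform_moment_dominated 0; rewrite ?subr_gt0 ?invf_gt1//.
apply: (le_integrable measurableT _ _ iG).
  apply/measurable_EFinP; apply: measurable_funD.
    by apply: measurableT_comp; [exact: normr_measurable|exact: (measurable_cos_transform _ (measurable_simplex t) mX)].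
  by apply: measurableT_comp; [exact: normr_measurable|exact: (measurable_sin_transform _ (measurable_simplex t) mX)].
move=> p _; rewrite lee_fin/= ger0_norm ?addr_ge0//.
by apply: le_trans (ler_norm _); have := cG t p tT; rewrite powRr0 mulr1.
Qed.

Lemma integrable_shifted_transform (t y : R) : 0 <= t <= T ->
  mu.-integrable setT (EFin \o (fun p => cos (p * y) * c t p + sin (p * y) * s t p)).
Proof.
move=> tT; apply: (le_integrable measurableT _ _ (integrable_transform tT)).
  by apply/measurable_EFinP; exact: (measurable_shifted_transform _ (measurable_simplex t) mX).
move=> p _; rewrite lee_fin/= [leRHS]ger0_norm ?addr_ge0//; apply: le_trans (ler_normD _ _) _; rewrite !normrM lerD// ler_piMl//.
  exact: cos_max.
exact: sin_max.
Qed.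

Lemma Rintegral_dist_le (f g h : R -> R) : mu.-integrable setT (EFin \o f) ->
  mu.-integrable setT (EFin \o g) -> mu.-integrable setT (EFin \o h) ->
  (forall p, `|f p - g p| <= h p) -> `|\int[mu]_p f p - \int[mu]_p g p| <= \int[mu]_p h p.
Proof.
move=> jf jg jh fgh; rewrite -RintegralB//.
have ifg : mu.-integrable setT (EFin \o (fun p => f p - g p)) by have := integrableB measurableT jf jg; exact.
apply: le_trans (le_normr_Rintegral _ _) _ => //.
by apply: le_Rintegral => //; exact: integrable_norm.
Qed.

(** The majorant [G] serves all [t] at once, so the constant is uniform in [t]; the joint estimate
    relies on this. *)
Lemma path_local_time_space (gam : R) : 0 <= gam -> gam <= 1 -> gam < H^-1 - 1 ->
  exists C : R, 0 <= C /\ forall t y y', 0 <= t <= T ->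
    `|path_local_time t y - path_local_time t y'| <= C * `|y - y'| `^ gam.
Proof.
move=> g0 g1 gH; have [G [iG cG]] := transform_moment_dominated g0 gH.
have iG2 (k : R) : mu.-integrable setT (EFin \o (fun p => k * G p)).
  by have := integrableZl measurableT k iG; exact.
exists ((2 * pi)^-1 * (2 * \int[mu]_p G p)); split.
  rewrite !mulr_ge0 ?invr_ge0 ?mulr_ge0 ?pi_ge0//; apply: Rintegral_ge0 => p _.
  have := cG 0 p; rewrite lexx ltW// => /(_ isT); apply: le_trans.
  by rewrite mulr_ge0 ?addr_ge0 ?powR_ge0.
move=> t y y' tT; rewrite /path_local_time /occupation_density -mulrBr normrM.
rewrite ger0_norm ?invr_ge0 ?mulr_ge0 ?pi_ge0// -!mulrA ler_wpM2l ?invr_ge0 ?mulr_ge0 ?pi_ge0//.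
rewrite (_ : 2 * _ = (2 * `|y - y'| `^ gam) * \int[mu]_p G p); last by ring.
rewrite -RintegralZl//; apply: Rintegral_dist_le => //; try exact: integrable_shifted_transform.
move=> p; have hc := @ler_dist_cos_powR _ p y y' _ g0 g1; have hs := @ler_dist_sin_powR _ p y y' _ g0 g1.
rewrite (_ : _ - _ = (cos (p * y) - cos (p * y')) * c t p + (sin (p * y) - sin (p * y')) * s t p); last ring.
apply: le_trans (ler_normD _ _) _; rewrite !normrM.
apply: le_trans (lerD (ler_wpM2r (normr_ge0 _) hc) (ler_wpM2r (normr_ge0 _) hs)) _.
rewrite (_ : _ + _ = (2 * `|y - y'| `^ gam) * ((`|c t p| + `|s t p|) * `|p| `^ gam)); last ring.
by apply: ler_wpM2l; [rewrite mulr_ge0 ?powR_ge0|exact: cG].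
Qed.

Lemma path_local_time_time (gam : R) : 0 < gam -> gam < 1 - H ->
  exists C : R, 0 <= C /\ forall t t' y, 0 <= t <= T -> 0 <= t' <= T ->
    `|path_local_time t y - path_local_time t' y| <= C * `|t - t'| `^ gam.
Proof.
move=> g0 g1; have [G [iG cG]] := transform_increment_dominated g0 g1.
have iG2 (k : R) : mu.-integrable setT (EFin \o (fun p => k * G p)).
  by have := integrableZl measurableT k iG; exact.
exists ((2 * pi)^-1 * \int[mu]_p G p); split.
  rewrite mulr_ge0 ?invr_ge0 ?mulr_ge0 ?pi_ge0//; apply: Rintegral_ge0 => p _.
  have := cG 0 T p; rewrite !lexx ltW// sub0r normrN => /(_ isT isT) h.
  have x0 : 0 < `|T| `^ gam by rewrite powR_gt0// gtr0_norm.
  by rewrite -(pmulr_rge0 _ x0) (le_trans _ h)// addr_ge0.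
move=> t t' y tT t'T; rewrite /path_local_time /occupation_density -mulrBr normrM.
rewrite ger0_norm ?invr_ge0 ?mulr_ge0 ?pi_ge0// -!mulrA ler_wpM2l ?invr_ge0 ?mulr_ge0 ?pi_ge0//.
rewrite mulrC -RintegralZl//; apply: Rintegral_dist_le => //; try exact: integrable_shifted_transform.
move=> p; apply: le_trans (cG t t' p tT t'T).
rewrite (_ : _ - _ = cos (p * y) * (c t p - c t' p) + sin (p * y) * (s t p - s t' p)); last ring.
rewrite (le_trans (ler_normD _ _))// !normrM lerD// ler_piMl//.
  exact: cos_max.
exact: sin_max.
Qed.

Lemma path_local_time_joint (gam : R) : 0 < gam -> gam < 1 - H ->
  exists C : R, forall y y' t t', 0 <= t <= T -> 0 <= t' <= T ->
    `|path_local_time t y - path_local_time t' y'| <= C * (`|y - y'| + `|t - t'|) `^ gam.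
Proof.
move=> g0 g1.
have gH : gam < H^-1 - 1.
  apply: lt_le_trans g1 _; rewrite -subr_ge0 (_ : _ - _ = (1 - H) ^+ 2 / H).
    by rewrite mulr_ge0 ?sqr_ge0// invr_ge0 ltW.
  by field; rewrite gt_eqF.
have gl : gam <= 1 by rewrite ltW// (lt_trans g1)// gtrBl.
have [C1 [C10 h1]] := path_local_time_space (ltW g0) gl gH.
have [C2 [C20 h2]] := path_local_time_time g0 g1.
exists (C1 + C2) => y y' t t' tT t'T.
rewrite -(subrKA (path_local_time t y')).
apply: le_trans (ler_normD _ _) _; apply: le_trans (lerD (h1 _ _ _ tT) (h2 _ _ _ tT t'T)) _.
rewrite mulrDl lerD// ler_wpM2l//; apply: ge0_ler_powR; rewrite ?nnegrE ?addr_ge0//; try exact: ltW.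
  by rewrite lerDl.
by rewrite lerDr.
Qed.

Lemma heat_le_heat0 (eps x : R) : 0 < eps -> `|heat eps x| <= (Num.sqrt (2 * pi * eps))^-1.
Proof.
move=> e0; rewrite ger0_norm ?heat_ge0// heatE// ler_piMr ?invr_ge0 ?sqrtr_ge0//.
by apply: gaussian_le1; rewrite invr_ge0 ltW.
Qed.

Lemma dint_heat_path (eps t y : R) : 0 < eps ->
  fine (dint t (fun r s => heat eps (b s - b r - y))) = \int[mu2]_(z in simplex t) heat eps (X z - y).
Proof.
move=> e0; rewrite (@dint_simplex _ _ (Num.sqrt (2 * pi * eps))^-1)//.
  apply: measurableT_comp; first exact: measurable_heat.
  by apply: measurable_funB.
by move=> z _; exact: heat_le_heat0.
Qed.

Lemma cvg_path_local_time (t y : R) : 0 <= t <= T ->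
  fine (dint t (fun r s => heat eps (b s - b r - y))) @[eps --> 0^'+] --> path_local_time t y.
Proof.
move=> tT; have := cvg_heat_occupation (measurable_simplex t) (simplex_fin t) mX (integrable_transform tT) (y := y).
apply: cvg_trans; apply: near_eq_cvg; near=> eps; rewrite dint_heat_path//.
Unshelve. all: by end_near. Qed.

Lemma path_increment_bounded (t : R) : exists r : R, forall z, simplex t z -> `|X z| <= r.
Proof.
have [t0|t0] := leP t 0; first by exists 0 => z [h1 h2 h3]; exfalso; move: t0 h1 h2 h3; lra.
have cn : {within `[0, t], continuous (fun x => `|b x|)}.
  by apply: continuous_subspaceT => x; apply: continuous_comp; [exact: cb|exact: norm_continuous].
have [x _ hx] := EVT_max (ltW t0) cn; exists (`|b x| + `|b x|) => z [h1 h2 h3].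
rewrite (le_trans (ler_normB _ _))// lerD//; apply: hx; rewrite in_itv/=.
  by rewrite !ltW// (lt_trans h1).
by rewrite !ltW// (lt_trans h2).
Qed.

Lemma path_occupation_formula (t : R) (g : R -> R) : 0 <= t <= T -> continuous g ->
  dint t (fun r s => g (b s - b r)) = (\int[mu]_y (g y * path_local_time t y)%:E)%E.
Proof.
move=> tT cg; have [r Xr] := path_increment_bounded t.
rewrite -(occupation_formula (measurable_simplex t) (simplex_fin t) mX (integrable_transform tT) Xr cg).
have cn : {within `[- `|r|, `|r|], continuous (fun x => `|g x|)}.
  by apply: continuous_subspaceT => x; apply: continuous_comp; [exact: cg|exact: norm_continuous].
have rr : - `|r| <= `|r| by rewrite (@le_trans _ _ 0)// oppr_le0.
have [x _ hx] := EVT_max rr cn.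
rewrite (@dint_simplex _ _ `|g x|)//.
  by apply: measurableT_comp => //; exact: continuous_measurable_fun.
by move=> z /Xr zr; apply: hx; rewrite in_itv/= -ler_norml (le_trans zr)// ler_norm.
Qed.

End path_local_time.

(** * Almost sure domination of the transform *)

Section dyadic_chaining.
Context (R : realType).
Variables (T Q M : R) (F : R -> R).
Hypotheses (T0 : 0 < T) (Q1 : 1 < Q) (F0 : F 0 = 0).
Hypothesis lipF : forall t t', 0 <= t <= T -> 0 <= t' <= T -> `|F t - F t'| <= M * `|t - t'|.

Definition dyadic (n k : nat) : R := T * k%:R / 2 ^+ n.

Definition dyadic_variation (n : nat) : R :=
  \sum_(k < 2 ^ n) (F (dyadic n k.+1) - F (dyadic n k)) ^+ 2.

Lemma dyadic_variation_ge0 n : 0 <= dyadic_variation n.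
Proof. by apply: sumr_ge0 => k _; exact: sqr_ge0. Qed.

Lemma dyadic_double n j : dyadic n.+1 j.*2 = dyadic n j.
Proof. by rewrite /dyadic -mul2n natrM exprS; field; rewrite expf_neq0// pnatr_eq0. Qed.

Lemma dyadic_in_range n k : (k <= 2 ^ n)%N -> 0 <= dyadic n k <= T.
Proof.
move=> kn; have p0 : (0 : R) < 2 ^+ n by rewrite exprn_gt0.
rewrite /dyadic divr_ge0 ?mulr_ge0 ?(ltW T0) ?(ltW p0)//= ler_pdivrMr// ler_pM2l//.
by rewrite -natrX ler_nat.
Qed.

(** Cauchy-Schwarz with weights [c] and [d]; the defect is a multiple of [(d * x - c * y) ^+ 2]. *)
Lemma sqrD_le_weighted (x y c d S s : R) : 0 < c -> 0 < d -> x ^+ 2 <= c * S -> y ^+ 2 <= d * s ->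
  (x + y) ^+ 2 <= (c + d) * (S + s).
Proof.
move=> c0 d0 hx hy.
have hx' : x ^+ 2 / c <= S by rewrite ler_pdivrMr// mulrC.
have hy' : y ^+ 2 / d <= s by rewrite ler_pdivrMr// mulrC.
apply: le_trans (ler_wpM2l (ltW (addr_gt0 c0 d0)) (lerD hx' hy')).
rewrite -subr_ge0 (_ : _ - _ = (d * x - c * y) ^+ 2 / (c * d)).
  by apply: divr_ge0; [exact: sqr_ge0|rewrite mulr_ge0// ltW].
by field; rewrite !gt_eqF.
Qed.

Let w n := \sum_(i < n.+1) Q ^- i.
Let S n := \sum_(i < n.+1) Q ^+ i * dyadic_variation i.
Let Q0 : 0 < Q. Proof. exact: lt_trans Q1. Qed.

(* The increments from level 0 to level [n] along the binary expansion of [k / 2 ^ n] are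
   weighted by [Q ^- i] in the Cauchy-Schwarz inequality. *)
Lemma dyadic_chaining_level n k : (k <= 2 ^ n)%N -> F (dyadic n k) ^+ 2 <= w n * S n.
Proof.
have w0 m : 0 < w m.
  rewrite /w big_ord_recl ltr_wpDr// ?expr0 ?invr1//.
  by apply: sumr_ge0 => i _; rewrite invr_ge0 exprn_ge0// ltW.
have Qn0 m : 0 < Q ^+ m by rewrite exprn_gt0.
have S0 m : 0 <= S m.
  by apply: sumr_ge0 => i _; rewrite mulr_ge0 ?dyadic_variation_ge0// ltW.
elim: n k => [|n IH] k kn.
  rewrite /w /S !big_ord1 expr0 invr1 !mul1r /dyadic_variation big_ord1 /dyadic.
  case: k kn => [|[|]]// _; first by rewrite mulr0 mul0r F0 expr0n/= sqr_ge0.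
  by rewrite mulr0 mul0r F0 subr0.
rewrite /w /S big_ord_recr [X in _ <= _ * X]big_ord_recr/= -/(w n) -/(S n).
set d := Q ^- n.+1; set s := _ * dyadic_variation _.
have d0 : 0 < d by rewrite invr_gt0.
have s0 : 0 <= s by rewrite mulr_ge0 ?dyadic_variation_ge0// ltW.
have hd : dyadic_variation n.+1 = d * s by rewrite /s /d mulKf// gt_eqF.
(* For even [k] the point already belongs to level [n]; for odd [k] it lies one step of level [n.+1]
   to the right of such a point. *)
have hk : k = (odd k + k./2.*2)%N by rewrite odd_double_half.
case ok : (odd k) hk => hk; last first.
  rewrite hk add0n dyadic_double.
  apply: le_trans (IH _ _) _.
    by rewrite -leq_double -[(2 ^ n).*2]mul2n -expnS (leq_trans _ kn)// [leqRHS]hk leq_addl.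
  by apply: ler_pM; rewrite ?(ltW (w0 _))// lerDl// ltW.
have jn : (k./2.*2 < 2 ^ n.+1)%N by rewrite (leq_trans _ kn)// [leqRHS]hk.
rewrite hk -[F _](subrK (F (dyadic n.+1 k./2.*2))) [X in X ^+ 2]addrC.
apply: sqrD_le_weighted => //.
  rewrite dyadic_double; apply: IH.
  by rewrite -leq_double -[(2 ^ n).*2]mul2n -expnS ltnW.
rewrite -hd /dyadic_variation (bigD1 (Ordinal jn))//= add1n lerDl.
by apply: sumr_ge0 => i _; exact: sqr_ge0.
Qed.

(** The Lipschitz bound serves to pass from dyadic points to all [t], so its constant [M] does not
    enter the estimate. The factor in front is the sum of the geometric weights of
    [dyadic_chaining_level]. *)
Lemma dyadic_chaining t : 0 <= t <= T ->
  ((F t ^+ 2)%:E <= (1 - Q^-1)^-1%:E * \sum_(0 <= n <oo) (Q ^+ n * dyadic_variation n)%:E)%E.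
Proof.
move=> /andP[t0 tT]; have Qi : 0 < 1 - Q^-1 by rewrite subr_gt0 invf_lt1.
set C := (1 - Q^-1)^-1; have C0 : 0 < C by rewrite invr_gt0.
have term0 n : (0 <= (Q ^+ n * dyadic_variation n)%:E)%E.
  by rewrite lee_fin mulr_ge0 ?dyadic_variation_ge0// exprn_ge0// ltW.
set V := (\sum_(0 <= n <oo) _)%E; have V0 : (0 <= V)%E by exact: nneseries_ge0.
have wC n : w n <= C.
  have h : w n * (1 - Q^-1) = 1 - Q^-1 ^+ n.+1.
    rewrite -[RHS]opprB subrX1 -mulNr opprB mulrC; congr (_ * _).
    by apply: eq_bigr => i _; rewrite exprVn.
  rewrite -[C]mul1r ler_pdivlMr// h gerBl exprn_ge0// invr_ge0 ltW//.
have SV n : ((S n)%:E <= V)%E.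
  rewrite /S -sumEFin -(big_mkord xpredT (fun i => (Q ^+ i * dyadic_variation i)%:E)).
  exact: nneseries_lim_ge.
have [Vfin|] := boolP (V \is a fin_num); last first.
  by rewrite ge0_fin_numE// -leNgt leye_eq => /eqP ->; rewrite gt0_muley ?leey// lte_fin.
rewrite -(fineK Vfin) -EFinM lee_fin.
have level n k : (k <= 2 ^ n)%N -> `|F (dyadic n k)| <= Num.sqrt (C * fine V).
  move=> kn; rewrite -sqrtr_sqr ler_sqrt; last by rewrite mulr_ge0 ?(ltW C0) ?fine_ge0.
  apply: le_trans (dyadic_chaining_level kn) _; apply: ler_pM => //.
  - by apply: sumr_ge0 => i _; rewrite invr_ge0 exprn_ge0// ltW.
  - by apply: sumr_ge0 => i _; rewrite mulr_ge0 ?dyadic_variation_ge0// exprn_ge0// ltW.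
  - by rewrite -lee_fin fineK.
suff : `|F t| <= Num.sqrt (C * fine V).
  move=> h; rewrite -(real_normK (num_real (F t))) -[leRHS]sqr_sqrtr ?mulr_ge0 ?fine_ge0 ?(ltW C0)//.
  by rewrite ler_sqr ?nnegrE ?sqrtr_ge0.
apply/ler_addgt0Pr => e e0.
(* The point [dyadic n k] approximates [t] from below, and [n] is large enough, since [n < 2 ^ n],
   for the Lipschitz error to be at most [e]. *)
pose n := Num.truncn (`|M| * T / e); pose k := Num.truncn (t / T * 2 ^+ n).
have p0 : (0 : R) < 2 ^+ n by rewrite exprn_gt0.
have x0 : 0 <= t / T * 2 ^+ n.
  by apply: mulr_ge0; [apply: divr_ge0 => //; exact: ltW|exact: ltW].
have /andP[k1 k2] : k%:R <= t / T * 2 ^+ n < k.+1%:R by exact: truncn_itv.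
have kn : (k <= 2 ^ n)%N.
  rewrite -(ler_nat R) (le_trans k1)// natrX ler_piMl ?(ltW p0)//.
  by rewrite ler_pdivrMr// mul1r.
rewrite -[F t](subrK (F (dyadic n k))) addrC (le_trans (ler_normD _ _))// lerD ?level//.
apply: le_trans (lipF _ (dyadic_in_range kn)) _; first by rewrite t0.
have dt : `|t - dyadic n k| <= T / 2 ^+ n.
  have k1' : dyadic n k <= t by rewrite /dyadic ler_pdivrMr// mulrC -ler_pdivlMr// mulrAC.
  have k2' : t < dyadic n k + T / 2 ^+ n.
    have -> : dyadic n k + T / 2 ^+ n = T * (k.+1%:R / 2 ^+ n).
      by rewrite /dyadic -[k.+1%:R]natr1 mulrDl mulrDr mul1r mulrA.
    by rewrite mulrC -ltr_pdivrMr// ltr_pdivlMr.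
  by rewrite ger0_norm ?subr_ge0// lerBlDl ltW.
have n1 : `|M| * T / e < 2 ^+ n.
  apply: lt_le_trans (truncnS_gt _) _; rewrite -/n -natrX ler_nat; exact: ltn_expl.
apply: le_trans (_ : `|M| * (T / 2 ^+ n) <= _).
  apply: le_trans (ler_wpM2r (normr_ge0 _) (ler_norm M)) _; exact: ler_wpM2l.
by rewrite mulrA ler_pdivrMr// [leRHS]mulrC -ler_pdivrMr// ltW.
Qed.

End dyadic_chaining.

(** * Variance of the difference of two increments *)

Section four_points.
Context (R : realType).
Notation mu := (@lebesgue_measure R).

(** Up to the constant [k], the characteristic function at [p] of an increment over a time [|u|]; it
    is what a gap of that length contributes. *)
Definition stretched_kernel (k H p u : R) : R := expR (- (k * p ^+ 2 * `|u| `^ (2 * H))).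

Lemma stretched_kernel_ge0 k H p u : 0 <= stretched_kernel k H p u.
Proof. exact: expR_ge0. Qed.

Lemma measurable_stretched_kernel k H p : measurable_fun setT (stretched_kernel k H p).
Proof.
apply: measurableT_comp; first exact: measurable_expR.
apply: measurableT_comp => //; apply: measurable_funM => //.
exact: measurable_powR_norm.
Qed.

(** Weights and times of [p * ((B s - B r) - (B s' - B r'))], the phase that appears when the
    squared modulus of the transform is expanded. *)
Definition double_increment (p r s r' s' : R) : seq (R * R) :=
  [:: (p, s); (- p, r); (- p, s'); (p, r')].

Lemma double_increment_sum p r s r' s' : \sum_(x <- double_increment p r s r' s') x.1 = 0.
Proof. by rewrite /double_increment !big_cons big_nil /=; ring. Qed.

(* [i] tells on which side of the gap [(u, v)] the time [x] lies. *)
Definition on_side (u v x : R) (i : bool) := if i then v <= x else x <= u.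

Lemma double_increment_gap (H k p r s r' s' u v : R) (i1 i2 i3 i4 : bool) :
  gap_lower_bound H k -> u < v -> on_side u v s i1 -> on_side u v r i2 -> on_side u v s' i3 -> on_side u v r' i4 ->
  k * (p * (i1%:R - i2%:R - i3%:R + i4%:R)) ^+ 2 * `|u - v| `^ (2 * H) <=
    increment_var H (double_increment p r s r' s').
Proof.
move=> lnd uv h1 h2 h3 h4; rewrite distrC ger0_norm ?subr_ge0; last exact: ltW.
have sideE x i : on_side u v x i -> (v <= x) = i.
  by rewrite /on_side; case: i => // xu; apply/negbTE; rewrite -ltNge (le_lt_trans xu).
have -> : p * (i1%:R - i2%:R - i3%:R + i4%:R) =
    \sum_(x <- double_increment p r s r' s' | v <= x.2) x.1.
  rewrite !big_cons big_nil/= (sideE _ _ h1) (sideE _ _ h2) (sideE _ _ h3) (sideE _ _ h4).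
  by case: (i1); case: (i2); case: (i3); case: (i4) => /=; ring.
apply: lnd => //; first exact: double_increment_sum.
have orside x i : on_side u v x i -> x <= u \/ v <= x by rewrite /on_side; case: i; [right|left].
by move=> x; rewrite !inE => /or4P[] /eqP -> /=;
  [exact: orside h1|exact: orside h2|exact: orside h3|exact: orside h4].
Qed.

(* Each order of the four times leaves two gaps across which the total weight jumps by [+-p]:
   the left gap and the right gap of the two intervals if these overlap, the intervals themselves
   if they are disjoint. *)
Lemma four_point_nondeterminism (H : R) : 0 < H -> H < 1 -> exists2 k : R, 0 < k &
  forall p r s r' s', r < s -> r' < s' ->
    expR (- increment_var H (double_increment p r s r' s') / 2) <=
    stretched_kernel k H p (r - r') * stretched_kernel k H p (s - s') +
    stretched_kernel k H p (s' - r') * stretched_kernel k H p (s - r).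
Proof.
move=> H0 H1; have [k k0 lnd] := local_nondeterminism H0 H1.
(* The variance dominates the bound of each of the two gaps, hence their mean; together with the
   division by [2] in the characteristic function this gives [k / 4]. *)
exists (k / 4) => [|p r s r' s' rs rs']; first by rewrite divr_gt0.
set l := double_increment p r s r' s'.
set V := increment_var H l.
(* A gap to the right of all four times, across which the weight [0] jumps, shows that the variance
   is nonnegative; this settles gaps of length zero, when two times coincide. *)
have V0 : 0 <= V.
  pose u := Num.max s s'.
  have su : s <= u by rewrite le_max lexx.
  have s'u : s' <= u by rewrite le_max lexx orbT.
  move: u su s'u => u su s'u.
  have := @lnd l u (u + 1) (double_increment_sum _ _ _ _ _) _ _; rewrite big_seq_cond big1.
    rewrite expr0n/= mulr0 mul0r; apply; first by rewrite ltrDl.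
    by move=> x; rewrite !inE => /or4P[] /eqP -> /=; left; clear lnd; lra.
  by move=> x /andP[]; clear lnd; rewrite !inE => /or4P[] /eqP -> /= ?; lra.
have eqgap (x : R) : k * p ^+ 2 * `|x - x| `^ (2 * H) <= V.
  by rewrite subrr normr0 powR0 ?mulr0// mulf_neq0// gt_eqF.
have bound a b c e : k * p ^+ 2 * `|a - b| `^ (2 * H) <= V -> k * p ^+ 2 * `|c - e| `^ (2 * H) <= V ->
    expR (- V / 2) <= stretched_kernel (k / 4) H p (a - b) * stretched_kernel (k / 4) H p (c - e).
  move=> h1 h2; rewrite /stretched_kernel -expRD ler_expR.
  by rewrite -![k / 4 * _]mulrAC -![k * _ / 4 * _]mulrAC; lra.
suff pick : expR (- V / 2) <= stretched_kernel (k / 4) H p (r - r') * stretched_kernel (k / 4) H p (s - s') \/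
    expR (- V / 2) <= stretched_kernel (k / 4) H p (s' - r') * stretched_kernel (k / 4) H p (s - r).
  case: pick => h; apply: (le_trans h); [rewrite lerDl|rewrite lerDr];
    by apply: mulr_ge0; exact: stretched_kernel_ge0.
have gap u v i1 i2 i3 i4 := @double_increment_gap H k p r s r' s' u v i1 i2 i3 i4 lnd.
clear lnd V0.
have gap1 u v i1 i2 i3 i4 : u < v -> on_side u v s i1 -> on_side u v r i2 -> on_side u v s' i3 ->
    on_side u v r' i4 -> (i1%:R - i2%:R - i3%:R + i4%:R : R) ^+ 2 = 1 ->
    k * p ^+ 2 * `|u - v| `^ (2 * H) <= V.
  move=> uv h1 h2 h3 h4 hi; have := gap u v i1 i2 i3 i4 uv h1 h2 h3 h4.
  by rewrite exprMn hi mulr1.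
clear gap; clearbody V; have [rr'|r'r|rr'] := ltgtP r r'.
- have [sr'|r's] := leP s r'.
    right; apply: bound; rewrite distrC.
      have := gap1 r' s' false false true false; rewrite /on_side/=; clear gap1; apply; [lra|lra|lra|lra|lra|ring].
    have := gap1 r s true false true true; rewrite /on_side/=; clear gap1; apply; [lra|lra|lra|lra|lra|ring].
  left; apply: bound.
    have := gap1 r r' true false true true; rewrite /on_side/=; clear gap1; apply; [lra|lra|lra|lra|lra|ring].
  have [ss'|s's|ss'] := ltgtP s s'.
  + have := gap1 s s' false false true false; rewrite /on_side/=; clear gap1; apply; [lra|lra|lra|lra|lra|ring].
  + rewrite distrC; have := gap1 s' s true false false false; rewrite /on_side/=; clear gap1; apply; [lra|lra|lra|lra|lra|ring].
  + by rewrite ss'; exact: eqgap.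
- have [s'r|rs''] := leP s' r.
    right; apply: bound; rewrite distrC.
      have := gap1 r' s' true true true false; rewrite /on_side/=; clear gap1; apply; [lra|lra|lra|lra|lra|ring].
    have := gap1 r s true false false false; rewrite /on_side/=; clear gap1; apply; [lra|lra|lra|lra|lra|ring].
  left; apply: bound.
    rewrite distrC; have := gap1 r' r true true true false; rewrite /on_side/=; clear gap1; apply; [lra|lra|lra|lra|lra|ring].
  have [ss'|s's|ss'] := ltgtP s s'.
  + have := gap1 s s' false false true false; rewrite /on_side/=; clear gap1; apply; [lra|lra|lra|lra|lra|ring].
  + rewrite distrC; have := gap1 s' s true false false false; rewrite /on_side/=; clear gap1; apply; [lra|lra|lra|lra|lra|ring].
  + by rewrite ss'; exact: eqgap.
- left; apply: bound; first by rewrite rr'; exact: eqgap.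
  have [ss'|s's|ss'] := ltgtP s s'.
  + have := gap1 s s' false false true false; rewrite /on_side/=; clear gap1; apply; [lra|lra|lra|lra|lra|ring].
  + rewrite distrC; have := gap1 s' s true false false false; rewrite /on_side/=; clear gap1; apply; [lra|lra|lra|lra|lra|ring].
  + by rewrite ss'; exact: eqgap.
Qed.

End four_points.

(** * Integrals of the kernel over strips *)

Section kernel_integrals.
Context (R : realType).
Notation mu := (@lebesgue_measure R).
Notation mu2 := (@plane_measure R).
Notation plane := (measurableTypeR R * measurableTypeR R)%type.
Variables (k H : R).
Hypotheses (k0 : 0 < k) (H0 : 0 < H).
Notation G := (stretched_kernel k H).

Let G0 p u : (0 <= (G p u)%:E)%E. Proof. by rewrite lee_fin stretched_kernel_ge0. Qed.

Let mG p : measurable_fun setT (fun u : R => (G p u)%:E).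
Proof. by apply/measurable_EFinP; exact: measurable_stretched_kernel. Qed.

Lemma expRN_le_powR (n : nat) (y : R) : 0 < y -> expR (- y) <= (n.+1%:R / y) ^+ n.+1.
Proof.
move=> y0; have n0 : (0 : R) < n.+1%:R by rewrite ltr0n.
rewrite expRN (_ : (n.+1%:R / y) ^+ n.+1 = ((y / n.+1%:R) ^+ n.+1)^-1); last by rewrite -exprVn invf_div.
rewrite lef_pV2 ?posrE ?expR_gt0 ?exprn_gt0 ?divr_gt0//.
have -> : expR y = expR (y / n.+1%:R) ^+ n.+1 by rewrite -expRM_natl mulrC divfK// gt_eqF.
rewrite ler_pXn2r// ?nnegrE ?expR_ge0 ?divr_ge0 ?(ltW y0) ?(ltW n0)//.
by rewrite (le_trans _ (expR_ge1Dx _))// lerDr.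
Qed.

Lemma integral_stretched_kernel1 : (\int[mu]_u (G 1 u)%:E < +oo)%E.
Proof.
(* With [n.+1] at least [H^-1], the bound of the exponential by the power [n.+1] decays at least
   like |u| ^ (-2) at infinity. *)
pose n := Num.truncn H^-1.
pose C := (n.+1%:R / k) ^+ n.+1.
have C0 : 0 <= C by rewrite exprn_ge0// divr_ge0// ltW.
have Hn : 1 <= H * n.+1%:R.
  by rewrite -ler_pdivrMl// mulr1 ltW// truncnS_gt.
have /integrableP[_] : mu.-integrable setT
    (EFin \o (fun u : R => if 1 <= `|u| then C * `|u| `^ (- 2) else 1)).
  apply: integrable_outer => //.
  - by apply: measurable_funM => //; exact: measurable_powR_norm.
  - by move=> p; rewrite mulr_ge0// powR_ge0.
  - under eq_integral do rewrite EFinM.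
    rewrite ge0_integralZl//=.
    + by rewrite lte_mul_pinfty ?lee_fin// integral_outer_powR// ltrN2 ltr1n.
    + exact: measurable_outer_set.
    + by apply/measurable_EFinP/measurable_funTS; exact: measurable_powR_norm.
apply: le_lt_trans; apply: ge0_le_integral => //.
- exact: mG.
- apply/measurable_EFinP; apply: measurableT_comp; first exact: normr_measurable.
  apply: measurable_fun_ifT => //.
    by apply: measurable_fun_ler => //; exact: normr_measurable.
  by apply: measurable_funM => //; exact: measurable_powR_norm.
move=> u _; rewrite lee_fin/=; apply: le_trans (ler_norm _).
rewrite /stretched_kernel expr1n mulr1; case: (leP 1 `|u|) => u1; last first.
  by rewrite -expR0 ler_expR oppr_le0 mulr_ge0 ?powR_ge0// ltW.
have up : 0 < `|u| by exact: lt_le_trans u1.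
apply: le_trans (expRN_le_powR n _) _; first by rewrite mulr_gt0// powR_gt0.
rewrite invfM mulrA exprMn -/C ler_wpM2l// exprVn -powR_mulrn ?powR_ge0// -powRrM -powRN.
apply: ler_powR => //; rewrite lerN2; nra.
Qed.

(** Rescaling [u] by |p| ^ (- 1 / H) removes [p]. All decay of the transform in the frequency comes
    from this factor, one for each free time integration. *)
Lemma integral_stretched_kernel p : p != 0 ->
  (\int[mu]_u (G p u)%:E = (`|p| `^ (- H^-1))%:E * \int[mu]_u (G 1 u)%:E)%E.
Proof.
move=> p0; have pp : 0 < `|p| by rewrite normr_gt0.
rewrite (@ge0_integral_shift_scale _ (`|p| `^ (- H^-1)) 0); [|by rewrite powR_gt0|exact: mG|exact: G0].
suff key (u : R) : G p (`|p| `^ (- H^-1) * u + 0) = G 1 u by under eq_integral do rewrite key.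
rewrite /stretched_kernel addr0 normrM powRM// [`| _ `^ _|]ger0_norm ?powR_ge0// -powRrM.
have -> : - H^-1 * (2 * H) = - 2 by field; rewrite gt_eqF.
rewrite powRN powR_mulrn// real_normK ?num_real// expr1n mulr1.
have -> : k * p ^+ 2 * (p ^- 2 * `|u| `^ (2 * H)) = k * `|u| `^ (2 * H); last by [].
by rewrite mulrA mulfK// expf_neq0.
Qed.

Lemma integral_stretched_kernel_sub p a : (\int[mu]_u (G p (a - u))%:E = \int[mu]_u (G p u)%:E)%E.
Proof.
have e1 := ge0_integral_opp (mG p) (G0 p); rewrite e1.
have mGN : measurable_fun setT (fun u : R => (G p (- u))%:E).
  by apply: (measurableT_comp (mG p)); exact: measurable_funN.
have e2 := ge0_integral_shift (- a) mGN (fun u => G0 p (- u)); rewrite e2.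
by apply: eq_integral => u _; rewrite opprD opprK addrC.
Qed.

(** The strip is enlarged by letting [r] range over the whole line, which is affordable because the
    kernels are integrable there. *)
Lemma integral_strip_le (t' t : R) (f : plane -> \bar R) :
  measurable_fun setT f -> (forall z, 0 <= f z)%E ->
  (\int[mu2]_(z in strip t' t) f z <=
   \int[mu]_(s in `[t', t[) \int[mu]_r f (s, r))%E.
Proof.
move=> mf f0; have mI : measurable (`[t', t[%classic : set (measurableTypeR R)) by exact: measurable_itv.
have := @ge0_integral_prod_on _ _ _ _ R mu mu `[t', t[%classic setT (fun s r => f (s, r)) mI measurableT _ _.
move=> <-; last 2 first.
- by apply: eq_measurable_fun mf => -[].
- by move=> x y; exact: f0.
under [leRHS]eq_integral => z _ do rewrite -surjective_pairing.
apply: ge0_subset_integral => //; first exact: measurable_strip.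
  exact: measurableX.
- exact: measurable_funTS.
- by move=> [s r] [h1 h2 h3 h4] /=; rewrite in_itv/= h3 h4.
Qed.

Variables (K t' t T p : R).
Hypotheses (K0 : 0 <= K) (intG : (\int[mu]_u (G p u)%:E <= K%:E)%E).
Hypotheses (t'0 : 0 <= t') (tt' : t' <= t) (tT : t <= T).

Let measurable_G_diff (f g : plane -> R) : measurable_fun setT f -> measurable_fun setT g ->
  measurable_fun setT (fun z => (G p (f z - g z))%:E).
Proof.
move=> mf mg; apply/measurable_EFinP; apply: (measurableT_comp (measurable_stretched_kernel k H p)).
exact: measurable_funB.
Qed.

Let mI : measurable (`[t', t[%classic : set (measurableTypeR R)).
Proof. exact: measurable_itv. Qed.

Let mu_itv : mu `[t', t[%classic = (t - t')%:E.
Proof.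
rewrite lebesgue_measure_itv/= lte_fin; case: ltP => [_|tt]; first by rewrite -EFinB.
have ett : t = t' by apply/eqP; rewrite eq_le tt tt'.
by rewrite ett subrr.
Qed.

Let mGs b : measurable_fun setT (fun s : R => (G p (b - s))%:E).
Proof. by apply: (measurableT_comp (mG p)); exact: measurable_funB. Qed.

(** Combines the bound [1] of the kernel with its total mass. Keeping the minimum leaves room to
    trade decay in [p] for a power of [t - t'] greater than one. *)
Lemma integral_itv_kernel b : (\int[mu]_(s in `[t', t[) (G p (b - s))%:E <= (Num.min (t - t') K)%:E)%E.
Proof.
rewrite EFin_min le_min; apply/andP; split.
  apply: (@le_trans _ _ (\int[mu]_(s in `[t', t[) 1%:E)%E); last first.
    by rewrite integral_cst//= mul1e mu_itv.
  apply: ge0_le_integral => //.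
    by apply: measurable_funTS; exact: mGs.
  move=> s _; rewrite lee_fin -expR0 ler_expR oppr_le0 mulr_ge0 ?powR_ge0//.
  by rewrite mulr_ge0 ?sqr_ge0// ltW.
apply: le_trans intG; rewrite -(integral_stretched_kernel_sub p b).
by apply: ge0_subset_integral => //; exact: mGs.
Qed.

Lemma integral_strip_kernel_product a b :
  (\int[mu2]_(z in strip t' t) (G p (a - z.2) * G p (b - z.1))%:E <= (K * Num.min (t - t') K)%:E)%E.
Proof.
have h := @integral_strip_le t' t (fun z => (G p (a - z.2) * G p (b - z.1))%:E).
have mf : measurable_fun [set: plane] (fun z => (G p (a - z.2) * G p (b - z.1))%:E).
  under eq_fun do rewrite EFinM; apply: emeasurable_funM.
    exact: (measurable_G_diff (measurable_cst a) measurable_snd).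
  exact: (measurable_G_diff (measurable_cst b) measurable_fst).
have f0 (z : plane) : (0 <= (G p (a - z.2) * G p (b - z.1))%:E)%E.
  by rewrite lee_fin mulr_ge0 ?stretched_kernel_ge0.
apply: le_trans (h mf f0) _.
apply: (@le_trans _ _ (\int[mu]_(s in `[t', t[) (K%:E * (G p (b - s))%:E))%E).
  apply: ge0_le_integral => //.
  - by move=> s _; apply: integral_ge0 => r _; exact: f0.
  - apply: measurable_funTS.
    by apply: (@measurable_eint _ _ _ _ _ mu setT (fun s r : measurableTypeR R => (G p (a - r) * G p (b - s))%:E)) => // s r; exact: (f0 (s, r)).
  - by apply: measurable_funTS; apply: emeasurable_funM => //; exact: mGs.
  - move=> s _; under eq_integral do rewrite EFinM muleC /=.
    rewrite ge0_integralZl//; last exact: mGs.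
    rewrite [leRHS]muleC; apply: lee_wpmul2l; first exact: G0.
    by have -> := integral_stretched_kernel_sub p a; exact: intG.
rewrite ge0_integralZl//=; last by apply: measurable_funTS; exact: mGs.
by rewrite EFinM lee_wpmul2l ?lee_fin// integral_itv_kernel.
Qed.

Lemma integral_strip_kernel_diff :
  (\int[mu2]_(z in strip t' t) (G p (z.1 - z.2))%:E <= ((t - t') * K)%:E)%E.
Proof.
have mf : measurable_fun [set: plane] (fun z => (G p (z.1 - z.2))%:E).
  exact: (measurable_G_diff measurable_fst measurable_snd).
apply: le_trans (integral_strip_le t' t mf (fun z => G0 p _)) _.
under eq_integral do rewrite integral_stretched_kernel_sub.
by rewrite integral_cst//= mu_itv EFinM muleC lee_wpmul2l// lee_fin subr_ge0.
Qed.

Lemma measurable_four_points : measurable_fun [set: plane * plane] (fun x =>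
  G p (x.1.2 - x.2.2) * G p (x.1.1 - x.2.1) + G p (x.2.1 - x.2.2) * G p (x.1.1 - x.1.2)).
Proof.
have mf (f g : plane * plane -> R) : measurable_fun setT f -> measurable_fun setT g ->
    measurable_fun setT (fun x => G p (f x - g x)).
  by move=> mf mg; apply: (measurableT_comp (measurable_stretched_kernel k H p)); exact: measurable_funB.
have m12 : measurable_fun [set: plane * plane] (fun x => x.1.1) by exact: (measurableT_comp measurable_fst).
have m11 : measurable_fun [set: plane * plane] (fun x => x.1.2) by exact: (measurableT_comp measurable_snd).
have m22 : measurable_fun [set: plane * plane] (fun x => x.2.1) by exact: (measurableT_comp measurable_fst).
have m21 : measurable_fun [set: plane * plane] (fun x => x.2.2) by exact: (measurableT_comp measurable_snd).
apply: measurable_funD; apply: measurable_funM.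
- exact: (mf (fun x => x.1.2) (fun x => x.2.2)).
- exact: (mf (fun x => x.1.1) (fun x => x.2.1)).
- exact: (mf (fun x => x.2.1) (fun x => x.2.2)).
- exact: (mf (fun x => x.1.1) (fun x => x.1.2)).
Qed.

(** In the first product, integrating [z'] gives [K * Num.min (t - t') K] and [z] only the area of
    the strip; in the second, [z] and [z'] separate and each gives [(t - t') * K]. *)
Lemma integral_strip_four_points :
  (\int[mu2]_(z in strip t' t) \int[mu2]_(z' in strip t' t)
     (G p (z.2 - z'.2) * G p (z.1 - z'.1) + G p (z'.1 - z'.2) * G p (z.1 - z.2))%:E
   <= (K * Num.min (t - t') K * ((t - t') * T) + ((t - t') * K) ^+ 2)%:E)%E.
Proof.
have mS := @measurable_strip R t' t.
have mG1 : measurable_fun [set: plane] (fun z => (G p (z.1 - z.2))%:E).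
  exact: (measurable_G_diff measurable_fst measurable_snd).
have mG2 (z : plane) : measurable_fun [set: plane] (fun z' => (G p (z.2 - z'.2) * G p (z.1 - z'.1))%:E).
  under eq_fun do rewrite EFinM; apply: emeasurable_funM.
    exact: (measurable_G_diff (measurable_cst _) measurable_snd).
  exact: (measurable_G_diff (measurable_cst _) measurable_fst).
have P0 a b c e : 0 <= G p a * G p b + G p c * G p e.
  by rewrite addr_ge0// mulr_ge0// stretched_kernel_ge0.
have d0 : 0 <= t - t' by rewrite subr_ge0.
apply: (@le_trans _ _ (\int[mu2]_(z in strip t' t)
    ((K * Num.min (t - t') K)%:E + ((t - t') * K)%:E * (G p (z.1 - z.2))%:E))%E).
  apply: ge0_le_integral => //.
  - by move=> z _; apply: integral_ge0 => z' _; rewrite lee_fin.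
  - apply: measurable_funTS.
    apply: (@measurable_eint _ _ _ _ _ mu2 (strip t' t) (fun z z' : plane => (G p (z.2 - z'.2) * G p (z.1 - z'.1) + G p (z'.1 - z'.2) * G p (z.1 - z.2))%:E)) => //.
    + by apply/measurable_EFinP; exact: measurable_four_points.
    + by move=> x y; rewrite lee_fin.
  - apply: measurable_funTS; apply: emeasurable_funD => //; exact: emeasurable_funM.
  move=> z _; under eq_integral do rewrite EFinD.
  rewrite ge0_integralD//=; last 4 first.
  - by move=> x _; rewrite lee_fin mulr_ge0 ?stretched_kernel_ge0.
  - exact: measurable_funTS.
  - by move=> x _; rewrite lee_fin mulr_ge0 ?stretched_kernel_ge0.
  - apply: measurable_funTS; apply/measurable_EFinP; apply: measurable_funM; last exact: measurable_cst.
    by apply/measurable_EFinP; exact: mG1.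
  apply: leeD; first exact: integral_strip_kernel_product.
  under eq_integral do rewrite EFinM muleC.
  rewrite ge0_integralZl//=; last exact: measurable_funTS.
  by rewrite muleC lee_wpmul2r// integral_strip_kernel_diff.
have m0 : 0 <= K * Num.min (t - t') K by rewrite mulr_ge0// le_min d0.
rewrite ge0_integralD//=; last 2 first.
- by move=> z _; rewrite mule_ge0// lee_fin mulr_ge0.
- by apply: measurable_funTS; exact: emeasurable_funM.
rewrite integral_cst//= EFinD; apply: leeD.
  by rewrite [leRHS]EFinM lee_wpmul2l ?lee_fin// measure_strip_le// (le_trans t'0)// (le_trans tt').
rewrite ge0_integralZl//=; last 2 first.
- exact: measurable_funTS.
- by rewrite lee_fin mulr_ge0.
by rewrite expr2 [leRHS]EFinM lee_wpmul2l ?lee_fin ?mulr_ge0// integral_strip_kernel_diff.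
Qed.

End kernel_integrals.

(** * Joint measurability of continuous processes *)

Section joint_measurability.
Context (R : realType) d (Omega : measurableType d).

(* A process with continuous paths is the pointwise limit of its step approximations. *)
Lemma measurable_continuous_process (X : R -> Omega -> R) :
  (forall t : R, 0 <= t -> measurable_fun setT (X t)) ->
  (forall w, continuous (fun t : R => X (Num.max t 0) w)) ->
  measurable_fun [set: measurableTypeR R * Omega] (fun z => X (Num.max (z.1 : R) 0) z.2).
Proof.
move=> mX cX; pose k (n : nat) (t : R) := Num.truncn (Num.max t 0 * n.+1%:R).
pose f (n : nat) (z : measurableTypeR R * Omega) := X ((k n z.1)%:R / n.+1%:R) z.2.
have x0 (n : nat) (t : R) : 0 <= Num.max t 0 * n.+1%:R by rewrite mulr_ge0// le_max lexx orbT.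
apply: (@measurable_fun_cvg _ _ _ _ f).
  move=> n _ Y mY; rewrite setTI.
  have -> : f n @^-1` Y = \bigcup_j ([set t : measurableTypeR R | k n t = j] `*` (X (j%:R / n.+1%:R) @^-1` Y)).
    apply/seteqP; split => [[t w] /= h|[t w] /= [j _ [/= <-]]] //.
    by exists (k n t).
  apply: bigcupT_measurable => j; apply: measurableX.
    have -> : [set t : measurableTypeR R | k n t = j] = setT `&`
        (fun t : measurableTypeR R => Num.max (t : R) 0 * n.+1%:R) @^-1` [set` `[j%:R, j.+1%:R[].
      rewrite setTI; apply/seteqP; split => t /=; rewrite in_itv/= -truncn_eq// => /eqP//.
    have mf : measurable_fun [set: measurableTypeR R] (fun t : measurableTypeR R => Num.max (t : R) 0 * n.+1%:R).
      apply: measurable_funM => //.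
      by apply: (@measurable_maxr _ _ _ _ (fun t : measurableTypeR R => (t : R)) (fun=> 0)).
    by apply: mf.
  by rewrite -[_ @^-1` _]setTI; apply: mX => //; rewrite divr_ge0.
move=> [t w] _ /=; rewrite /f /=.
set x := Num.max t 0.
have cv : (k n t)%:R / n.+1%:R @[n --> \oo] --> x.
  have hl : x - n.+1%:R^-1 @[n --> \oo] --> x.
    by rewrite -[X in _ --> X]subr0; apply: cvgB; [exact: cvg_cst|exact: cvg_harmonic].
  apply: (squeeze_cvgr _ hl (cvg_cst x)); near=> n.
  have n0 : (0 : R) < n.+1%:R by rewrite ltr0n.
  have /andP[h1 h2] := truncn_itv (x0 n t); rewrite -/(k n t) -/x in h1 h2.
  rewrite ler_pdivrMr// h1 andbT ler_pdivlMr// mulrBl mulVf ?gt_eqF// lerBlDr.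
  by rewrite natr1 ltW.
have hx : x = Num.max x 0 by rewrite /x; case: (leP 0 t) => // h; [rewrite max_l|rewrite maxxx].
rewrite hx; have := cvg_comp _ _ cv (cX w x).
apply: cvg_trans; apply: near_eq_cvg; near=> n => /=.
by rewrite max_l// divr_ge0.
Unshelve. all: by end_near. Qed.

Lemma continuous_max_path (X : R -> R) : {within `[0, +oo[, continuous X} ->
  continuous (fun t : R => X (Num.max t 0)).
Proof.
move=> /subspace_continuousP cX t.
have x0 : `[0, +oo[%classic (Num.max t 0) by rewrite /= in_itv/= andbT le_max lexx orbT.
have maxc : (fun u : R => Num.max u 0) @ t --> Num.max t 0.
  have maxE (u : R) : Num.max u 0 = (u + `|u|) / 2 by rewrite maxr_absE subr0 addr0.
  rewrite maxE (_ : (fun u : R => _) = fun u => (u + `|u|) / 2); last by apply/funext => u; exact: maxE.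
  by apply: cvgM; [apply: cvgD; [exact: cvg_id|exact: norm_continuous]|exact: cvg_cst].
apply: cvg_comp (cX _ x0) => S /= hS.
have h : \forall u \near t, `[0, +oo[%classic (Num.max u 0) -> S (Num.max u 0) by exact: maxc _ hS.
near=> u; suff : `[0, +oo[%classic (Num.max u 0) by near: u; exact: h.
by rewrite /= in_itv/= andbT le_max lexx orbT.
Unshelve. all: by end_near. Qed.

End joint_measurability.

(** * Second moment of the transform over a strip *)

Section fbm_energy.
Context (R : realType) d (Omega : measurableType d) (P : probability Omega R) (H : R)
  (B : R -> Omega -> R).
Hypotheses (H0 : 0 < H) (H1 : H < 1) (hB : is_fBm H P B).
Notation mu := (@lebesgue_measure R).
Notation mu2 := (@plane_measure R).
Notation plane := (measurableTypeR R * measurableTypeR R)%type.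

(* Freezing [B] at negative times makes the path continuous on the whole line. *)
Definition fbm_path (w : Omega) (t : R) : R := B (Num.max t 0) w.

Lemma fbm_pathE w t : 0 <= t -> fbm_path w t = B t w.
Proof. by move=> t0; rewrite /fbm_path max_l. Qed.

Lemma continuous_fbm_path w : continuous (fbm_path w).
Proof. by case: hB => _ cB _ _; exact: (continuous_max_path (cB w)). Qed.

Lemma measurable_fbm_increment :
  measurable_fun [set: Omega * plane] (fun x => path_increment (fbm_path x.1) x.2).
Proof.
have mb := measurable_continuous_process (fbm_measurable hB) continuous_fbm_path.
apply: measurable_funB.
- apply: (measurableT_comp mb (g := fun x : Omega * plane => (x.2.1, x.1))).
  by apply: measurable_fun_pair; [exact: (measurableT_comp measurable_fst measurable_snd)|exact: measurable_fst].
- apply: (measurableT_comp mb (g := fun x : Omega * plane => (x.2.2, x.1))).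
  by apply: measurable_fun_pair; [exact: (measurableT_comp measurable_snd measurable_snd)|exact: measurable_fst].
Qed.

Lemma measurable_fbm_increment1 z : measurable_fun setT (fun w => path_increment (fbm_path w) z).
Proof. by apply: measurable_funB; apply: (fbm_measurable hB); rewrite le_max lexx orbT. Qed.

Section domain.
Variable D : set plane.
Hypotheses (mD : measurable D) (Dfin : (mu2 D < +oo)%E).

Definition transform_energy (p : R) (w : Omega) : R :=
  cos_transform mu2 D (path_increment (fbm_path w)) p ^+ 2 +
  sin_transform mu2 D (path_increment (fbm_path w)) p ^+ 2.

Let measurable_fbm_phase : measurable_fun [set: (measurableTypeR R * Omega) * plane]
  (fun x => (x.1.1 : R) * path_increment (fbm_path x.1.2) x.2).
Proof.
apply: measurable_funM; first exact: (measurableT_comp measurable_fst).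
apply: (measurableT_comp measurable_fbm_increment (g := fun x : (measurableTypeR R * Omega) * plane => (x.1.2, x.2))).
by apply: measurable_fun_pair; [exact: (measurableT_comp measurable_snd measurable_fst)|exact: measurable_snd].
Qed.

Lemma measurable_fbm_cos_transform : measurable_fun [set: measurableTypeR R * Omega]
  (fun x => cos_transform mu2 D (path_increment (fbm_path x.2)) x.1).
Proof.
apply: (measurable_Rint _ (f := fun (x : measurableTypeR R * Omega) z => cos ((x.1 : R) * path_increment (fbm_path x.2) z)) mD).
by apply: measurableT_comp; [exact: measurable_cos|exact: measurable_fbm_phase].
Qed.

Lemma measurable_fbm_sin_transform : measurable_fun [set: measurableTypeR R * Omega]
  (fun x => sin_transform mu2 D (path_increment (fbm_path x.2)) x.1).
Proof.
apply: (measurable_Rint _ (f := fun (x : measurableTypeR R * Omega) z => sin ((x.1 : R) * path_increment (fbm_path x.2) z)) mD).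
by apply: measurableT_comp; [exact: measurable_sin|exact: measurable_fbm_phase].
Qed.

Lemma measurable_transform_energy : measurable_fun [set: measurableTypeR R * Omega]
  (fun x => transform_energy x.1 x.2).
Proof.
apply: measurable_funD.
- exact: (measurable_funX 2 measurable_fbm_cos_transform).
- exact: (measurable_funX 2 measurable_fbm_sin_transform).
Qed.

Let mX w := measurable_path_increment (@continuous_fbm_path w).

Let integrable_on (f : plane -> R) (M : R) : measurable_fun setT f ->
  (forall z, `|f z| <= M) -> mu2.-integrable D (EFin \o f).
Proof. by move=> mf fM; apply: (integrable_bounded_on mD Dfin mf) => z _; exact: fM. Qed.

(** Expanding the squared modulus into a double integral lets the expectation fall on the
    characteristic function of a difference of two increments. *)
Lemma transform_energyE p w : transform_energy p w =
  \int[mu2]_(z in D) \int[mu2]_(z' in D)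
    cos (p * (path_increment (fbm_path w) z' - path_increment (fbm_path w) z)).
Proof.
under eq_Rintegral do rewrite (shifted_transform mD Dfin (mX w)).
have ic := integrable_on (measurable_cosX (mX w) p) (fun z => cos_max _).
have is_ := integrable_on (measurable_sinX (mX w) p) (fun z => sin_max _).
rewrite RintegralD//=.
- by rewrite !RintegralZr.
- by have := integrableZr mD (cos_transform mu2 D (path_increment (fbm_path w)) p) ic; exact.
- by have := integrableZr mD (sin_transform mu2 D (path_increment (fbm_path w)) p) is_; exact.
Qed.

Definition pair_characteristic (p : R) (z z' : plane) : R :=
  \int[P]_w cos (p * (path_increment (fbm_path w) z' - path_increment (fbm_path w) z)).

Let measurable_pair_phase p : measurable_fun [set: (plane * plane) * Omega]
  (fun x => p * (path_increment (fbm_path x.2) x.1.2 - path_increment (fbm_path x.2) x.1.1)).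
Proof.
apply: measurable_funM => //; apply: measurable_funB.
- apply: (measurableT_comp measurable_fbm_increment (g := fun x : (plane * plane) * Omega => (x.2, x.1.2))).
  by apply: measurable_fun_pair; [exact: measurable_snd|exact: (measurableT_comp measurable_snd measurable_fst)].
- apply: (measurableT_comp measurable_fbm_increment (g := fun x : (plane * plane) * Omega => (x.2, x.1.1))).
  by apply: measurable_fun_pair; [exact: measurable_snd|exact: (measurableT_comp measurable_fst measurable_fst)].
Qed.

Let measurable_pair_cos p : measurable_fun [set: (plane * plane) * Omega]
  (fun x => cos (p * (path_increment (fbm_path x.2) x.1.2 - path_increment (fbm_path x.2) x.1.1))).
Proof. by apply: measurableT_comp; [exact: measurable_cos|exact: measurable_pair_phase]. Qed.

Lemma measurable_pair_characteristic p :
  measurable_fun [set: plane * plane] (fun x => pair_characteristic p x.1 x.2).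
Proof.
exact: (measurable_Rint P (f := fun (x : plane * plane) w => cos (p * (path_increment (fbm_path w) x.2 - path_increment (fbm_path w) x.1))) measurableT (measurable_pair_cos p)).
Qed.

Lemma expectation_transform_energy p : \int[P]_w transform_energy p w =
  \int[mu2]_(z in D) \int[mu2]_(z' in D) pair_characteristic p z z'.
Proof.
have mphase : measurable_fun [set: (Omega * plane) * plane]
    (fun x => cos (p * (path_increment (fbm_path x.1.1) x.2 - path_increment (fbm_path x.1.1) x.1.2))).
  apply: (measurableT_comp (measurable_pair_cos p) (g := fun x : (Omega * plane) * plane => ((x.1.2, x.2), x.1.1))).
  apply: measurable_fun_pair; last exact: (measurableT_comp measurable_fst measurable_fst).
  by apply: measurable_fun_pair; [exact: (measurableT_comp measurable_snd measurable_fst)|exact: measurable_snd].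
have icst (m : R) : mu2.-integrable D (EFin \o cst m).
  by apply: (@integrable_on (cst m) `|m|) => //; exact: measurable_cst.
have iP : P.-integrable setT (EFin \o cst (1 : R)) by exact: finite_measure_integrable_cst.
transitivity (\int[P]_w \int[mu2]_(z in D) \int[mu2]_(z' in D)
    cos (p * (path_increment (fbm_path w) z' - path_increment (fbm_path w) z))).
  by apply: eq_Rintegral => w _; exact: transform_energyE.
rewrite (@fubini_on _ _ _ _ _ P mu2 setT D _ (cst 1) (cst (1 * fine (mu2 D))))//; last 2 first.
- exact: (measurable_Rint mu2 (f := fun (x : Omega * plane) z' =>
    cos (p * (path_increment (fbm_path x.1) z' - path_increment (fbm_path x.1) x.2))) mD mphase).
- move=> w z _ _; rewrite [leRHS]mul1r; apply: (le_normr_Rintegral_bounded mD Dfin) => [|z' _]; last exact: cos_max.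
  exact: (measurable_cosM (mX w)).
apply: eq_Rintegral => z _.
rewrite (@fubini_on _ _ _ _ _ P mu2 setT D _ (cst 1) (cst 1))//; last first.
  by move=> w z' _ _; rewrite [leRHS]mul1r; exact: cos_max.
apply: (measurableT_comp (measurable_pair_cos p) (g := fun x : Omega * plane => ((z, x.2), x.1))).
apply: measurable_fun_pair; last exact: measurable_fst.
by apply: measurable_fun_pair; [exact: measurable_cst|exact: measurable_snd].
Qed.

End domain.

Lemma pair_characteristicE p z z' : 0 < z.2 -> z.2 < z.1 -> 0 < z'.2 -> z'.2 < z'.1 ->
  pair_characteristic p z z' = expR (- increment_var H (double_increment p z.2 z.1 z'.2 z'.1) / 2).
Proof.
move=> h1 h2 h3 h4; have z10 := ltW (lt_trans h1 h2); have z'10 := ltW (lt_trans h3 h4).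
have l0 x : x \in double_increment p z.2 z.1 z'.2 z'.1 -> 0 <= x.2.
  by rewrite !inE => /or4P[] /eqP -> //=; exact: ltW.
have := fbm_char hB 0 l0 (double_increment_sum _ _ _ _ _); rewrite cos0 mul1r => <-.
apply: eq_Rintegral => w _; rewrite add0r /double_increment !big_cons big_nil/= -[LHS]cosN.
rewrite /path_increment !fbm_pathE ?(ltW h1) ?(ltW h3)//; congr cos; ring.
Qed.

Lemma EFin_Rintegral d' (Z : measurableType d') (m : {measure set Z -> \bar R}) (D : set Z) (f : Z -> R) :
  measurable D -> m.-integrable D (EFin \o f) ->
  (\int[m]_(x in D) f x)%:E = (\int[m]_(x in D) (f x)%:E)%E.
Proof. by move=> mD jf; rewrite /Rintegral fineK//; exact: integrable_fin_num. Qed.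

Lemma pair_characteristic_le1 p z z' : `|pair_characteristic p z z'| <= 1.
Proof.
have := @le_normr_Rintegral_bounded _ _ _ P setT measurableT _
  (fun w => cos (p * (path_increment (fbm_path w) z' - path_increment (fbm_path w) z))) 1 _ (fun w _ => cos_max _).
have PT : fine (P setT) = 1 by rewrite probability_setT.
rewrite PT mul1r; apply; first by have := probability_setT P; move=> /= ->; rewrite ltry.
apply: measurableT_comp; first exact: measurable_cos.
by apply: measurable_funM => //; apply: measurable_funB; exact: measurable_fbm_increment1.
Qed.

Section strip_energy.
Variables (k K t' t T p : R).
Hypotheses (k0 : 0 < k) (hk : forall p r s r' s', r < s -> r' < s' ->
    expR (- increment_var H (double_increment p r s r' s') / 2) <=
    stretched_kernel k H p (r - r') * stretched_kernel k H p (s - s') +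
    stretched_kernel k H p (s' - r') * stretched_kernel k H p (s - r)).
Hypotheses (K0 : 0 <= K) (intG : (\int[mu]_u (stretched_kernel k H p u)%:E <= K%:E)%E).
Hypotheses (t'0 : 0 <= t') (tt' : t' <= t) (tT : t <= T).

Lemma expectation_strip_energy :
  (\int[P]_w (transform_energy (strip t' t) p w)%:E <=
   (K * Num.min (t - t') K * ((t - t') * T) + ((t - t') * K) ^+ 2)%:E)%E.
Proof.
have mD := @measurable_strip R t' t; have Dfin := strip_fin tt'.
have h4 := integral_strip_four_points k0 K0 intG t'0 tt' tT.
apply: le_trans h4.
set c := fine (mu2 (strip t' t)).
have mchi z : measurable_fun [set: plane] (pair_characteristic p z).
  exact: (measurableT_comp (measurable_pair_characteristic p) (pair1_measurable z)).
have ichi z : mu2.-integrable (strip t' t) (EFin \o pair_characteristic p z).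
  by apply: (integrable_bounded_on (M := 1) mD Dfin (mchi z)) => z' _; exact: pair_characteristic_le1.
have mI : measurable_fun [set: plane] (fun z => \int[mu2]_(z' in strip t' t) pair_characteristic p z z').
  exact: (measurable_Rint mu2 mD (measurable_pair_characteristic p)).
rewrite -EFin_Rintegral//; last first.
  apply: (@integrable_bounded_prob _ _ _ _ _ ((1 * c) ^+ 2 + (1 * c) ^+ 2)).
    exact: (measurableT_comp (measurable_transform_energy mD) (pair1_measurable (p : measurableTypeR R))).
  move=> w; have mX := measurable_path_increment (@continuous_fbm_path w).
  rewrite ger0_norm ?addr_ge0 ?sqr_ge0//; apply: lerD; rewrite -real_normK ?num_real//;
    apply: lerXn2r; rewrite ?nnegrE ?normr_ge0 ?mul1r ?fine_ge0//.
    by have := le_normr_Rintegral_bounded mD Dfin (measurable_cosX mX p) (fun z _ => cos_max _); rewrite mul1r.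
  by have := le_normr_Rintegral_bounded mD Dfin (measurable_sinX mX p) (fun z _ => sin_max _); rewrite mul1r.
rewrite (expectation_transform_energy mD Dfin) EFin_Rintegral//; last first.
  apply: (integrable_bounded_on (M := 1 * c) mD Dfin mI) => z _.
  by apply: (le_normr_Rintegral_bounded mD Dfin (mchi z)) => z' _; exact: pair_characteristic_le1.
have chi0 z z' : strip t' t z -> strip t' t z' -> 0 <= pair_characteristic p z z'.
  by move=> [? ? _ _] [? ? _ _]; rewrite pair_characteristicE// expR_ge0.
apply: ge0_le_integral => //.
- by move=> z Dz; rewrite lee_fin; apply: Rintegral_ge0 => z' Dz'; exact: chi0.
- by apply/measurable_EFinP; apply: measurable_funTS.
- apply: measurable_funTS; apply: (@measurable_eint _ _ _ _ _ mu2 (strip t' t) (fun z z' : plane =>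
    (stretched_kernel k H p (z.2 - z'.2) * stretched_kernel k H p (z.1 - z'.1) +
     stretched_kernel k H p (z'.1 - z'.2) * stretched_kernel k H p (z.1 - z.2))%:E)) => //.
    by apply/measurable_EFinP; exact: (measurable_four_points k H p).
  by move=> z z'; rewrite lee_fin addr_ge0// mulr_ge0// stretched_kernel_ge0.
move=> z Dz; rewrite EFin_Rintegral//; apply: ge0_le_integral => //.
- by move=> z' Dz'; rewrite lee_fin chi0.
- by apply/measurable_EFinP; apply: measurable_funTS.
- apply: measurable_funTS; apply/measurable_EFinP.
  exact: (measurableT_comp (measurable_four_points k H p) (pair1_measurable z)).
move=> z' Dz'; rewrite lee_fin; case: Dz Dz' => [? ? _ _] [? ? _ _].
by rewrite pair_characteristicE//; exact: hk.
Qed.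

End strip_energy.
End fbm_energy.

(** * Domination uniform in time, almost surely *)

Section fbm_dominated_transform.
Context (R : realType) d (Omega : measurableType d) (P : probability Omega R) (H T : R)
  (B : R -> Omega -> R).
Hypotheses (H0 : 0 < H) (H1 : H < 1) (T0 : 0 < T) (hB : is_fBm H P B).
Notation mu := (@lebesgue_measure R).
Notation mu2 := (@plane_measure R).
Notation X w := (path_increment (fbm_path B w)).

(** With [K] of order |p| ^ (- 1 / H) and [D = t - t'], the strip bound is of order
    [D * K * Num.min D K], since [D * K] is itself at most a constant times the minimum.
    Interpolating the minimum gives D ^ (1 + th) K ^ (2 - th). *)
Lemma expectation_energy_powR (th : R) : 0 <= th <= 1 -> exists C : R, 0 <= C /\
  forall p, 1 <= `|p| -> forall t' t, 0 <= t' -> t' <= t -> t <= T ->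
  (\int[P]_w (transform_energy B (strip t' t) p w)%:E <=
   (C * ((t - t') `^ (1 + th) * `|p| `^ (- ((2 - th) / H))))%:E)%E.
Proof.
move=> /andP[th0 th1]; have [k k0 hk] := four_point_nondeterminism H0 H1.
pose K1 := fine (\int[mu]_u (stretched_kernel k H 1 u)%:E)%E.
have I0 : (0 <= \int[mu]_u (stretched_kernel k H 1 u)%:E)%E.
  by apply: integral_ge0 => u _; rewrite lee_fin stretched_kernel_ge0.
have K10 : 0 <= K1 by rewrite fine_ge0.
have K1E : (\int[mu]_u (stretched_kernel k H 1 u)%:E)%E = K1%:E.
  by rewrite fineK// ge0_fin_numE// (integral_stretched_kernel1 k0 H0).
exists ((2 * T + K1) * K1 `^ (2 - th)); split.
  by rewrite mulr_ge0 ?powR_ge0// addr_ge0// mulr_ge0// ltW.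
move=> p p1 t' t t'0 tt' tT; have pp : 0 < `|p| by exact: lt_le_trans p1.
set kp := `|p| `^ (- H^-1); have kp0 : 0 <= kp by exact: powR_ge0.
have kp1 : kp <= 1.
  by rewrite /kp -(powRr0 `|p|) ler_powR// oppr_le0 invr_ge0 ltW.
pose K := kp * K1; have K0 : 0 <= K by exact: mulr_ge0.
have iK : (\int[mu]_u (stretched_kernel k H p u)%:E <= K%:E)%E.
  by rewrite integral_stretched_kernel -?normr_gt0// K1E.
apply: le_trans (expectation_strip_energy hB k0 hk K0 iK t'0 tt' tT) _.
rewrite lee_fin; set D := t - t'; have D0 : 0 <= D by rewrite subr_ge0.
have DT : D <= T by rewrite /D; lra.
have KK : K <= K1 by rewrite /K ler_piMl.
set m := Num.min D K; have m0 : 0 <= m by rewrite le_min D0.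
have DKm : D * K <= (T + K1) * m.
  rewrite /m; case: (leP D K) => _.
    by rewrite mulrC ler_wpM2r// (le_trans KK)// lerDr ltW.
  by rewrite ler_wpM2r// (le_trans DT)// lerDl.
have mth : m <= D `^ th * K `^ (1 - th) by exact: min_le_powR.
apply: (@le_trans _ _ ((2 * T + K1) * (D * K * m))).
  have : (D * K) ^+ 2 <= D * K * ((T + K1) * m) by rewrite expr2 ler_wpM2l// mulr_ge0.
  move=> h; rewrite -subr_ge0.
  have -> : (2 * T + K1) * (D * K * m) - (K * m * (D * T) + (D * K) ^+ 2) =
    D * K * ((T + K1) * m) - (D * K) ^+ 2 by ring.
  by rewrite subr_ge0.
have -> : (2 * T + K1) * K1 `^ (2 - th) * (D `^ (1 + th) * `|p| `^ (- ((2 - th) / H))) =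
    (2 * T + K1) * (D * K * (D `^ th * K `^ (1 - th))).
  have -> : `|p| `^ (- ((2 - th) / H)) = kp `^ (2 - th) by rewrite /kp -powRrM; congr (_ `^ _); ring.
  have eD : D `^ (1 + th) = D * D `^ th.
    by rewrite powRD ?powRr1// gt_eqF//= ltr_pwDl.
  have eK : K1 `^ (2 - th) * kp `^ (2 - th) = K * K `^ (1 - th).
    rewrite -powRM// [K1 * _]mulrC -/K (_ : 2 - th = 1 + (1 - th)); last ring.
    rewrite powRD ?powRr1// gt_eqF//=; lra.
  rewrite eD; transitivity ((2 * T + K1) * (D * D `^ th * (K1 `^ (2 - th) * kp `^ (2 - th)))); first by ring.
  by rewrite eK; ring.
have A0 : 0 <= (2 * T + K1) by rewrite addr_ge0// mulr_ge0// ltW.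
by apply: ler_wpM2l => //; apply: ler_wpM2l => //; exact: mulr_ge0.
Qed.

(** Majorizes the chaining sums of the cosine and sine transforms together, since the squared
    increment of either is at most the energy of the strip. Unlike a supremum over [t], it has an
    expectation that can be computed term by term. *)
Definition energy_sum (Q : R) (w : Omega) (p : R) : \bar R :=
  (\sum_(0 <= n <oo) (Q ^+ n * \sum_(k < 2 ^ n)
     transform_energy B (strip (dyadic T n k) (dyadic T n k.+1)) p w)%:E)%E.

Lemma transform_energy_ge0 D p w : 0 <= transform_energy B D p w.
Proof. by rewrite addr_ge0// sqr_ge0. Qed.

Lemma simplex0 : simplex 0 = set0 :> set (measurableTypeR R * measurableTypeR R).
Proof. by apply/seteqP; split => z //= [h1 h2 h3]; lra. Qed.

Lemma energy_sum_ge0 Q w p : 0 <= Q -> (0 <= energy_sum Q w p)%E.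
Proof.
move=> Q0; apply: nneseries_ge0 => n _ _; rewrite lee_fin mulr_ge0 ?exprn_ge0//.
by apply: sumr_ge0 => k _; exact: transform_energy_ge0.
Qed.

Lemma transform_le_energy_sum (Q : R) w p t : 1 < Q -> 0 <= t <= T ->
  ((cos_transform mu2 (simplex t) (X w) p ^+ 2)%:E <= (1 - Q^-1)^-1%:E * energy_sum Q w p)%E /\
  ((sin_transform mu2 (simplex t) (X w) p ^+ 2)%:E <= (1 - Q^-1)^-1%:E * energy_sum Q w p)%E.
Proof.
move=> Q1 tT; have Q0 : 0 < Q by exact: lt_trans Q1.
have cb := @continuous_fbm_path _ _ _ _ _ _ hB w; have mX := measurable_path_increment cb.
have C0 : 0 <= (1 - Q^-1)^-1 by rewrite invr_ge0 subr_ge0 invf_le1// ltW.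
have step n k : (dyadic T n k) <= (dyadic T n k.+1).
  rewrite /dyadic ler_pM2r ?invr_gt0 ?exprn_gt0// ler_pM2l// ler_nat//.
have dc n k : cos_transform mu2 (simplex (dyadic T n k.+1)) (X w) p -
    cos_transform mu2 (simplex (dyadic T n k)) (X w) p =
    cos_transform mu2 (strip (dyadic T n k) (dyadic T n k.+1)) (X w) p.
  by apply: (@Rintegral_strip _ _ _ 1) => //; [exact: measurable_cosX|move=> z; exact: cos_max].
have ds n k : sin_transform mu2 (simplex (dyadic T n k.+1)) (X w) p -
    sin_transform mu2 (simplex (dyadic T n k)) (X w) p =
    sin_transform mu2 (strip (dyadic T n k) (dyadic T n k.+1)) (X w) p.
  by apply: (@Rintegral_strip _ _ _ 1) => //; [exact: measurable_sinX|move=> z; exact: sin_max].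
split.
  have F0 : cos_transform mu2 (simplex 0) (X w) p = 0 by rewrite /cos_transform simplex0 Rintegral_set0.
  have lipF t1 t2 : 0 <= t1 <= T -> 0 <= t2 <= T ->
      `|cos_transform mu2 (simplex t1) (X w) p - cos_transform mu2 (simplex t2) (X w) p| <= T * `|t1 - t2|.
    by move=> h1 h2; have [] := transform_dist_le cb p h1 h2.
  apply: le_trans (dyadic_chaining T0 Q1 F0 lipF tT) _.
  apply: lee_wpmul2l; first by rewrite lee_fin.
  apply: lee_nneseries => n _.
    by rewrite lee_fin mulr_ge0 ?exprn_ge0 ?(ltW Q0)//; exact: dyadic_variation_ge0.
  rewrite lee_fin ler_wpM2l ?exprn_ge0 ?(ltW Q0)//; apply: ler_sum => k _.
  by rewrite dc lerDl sqr_ge0.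
have F0 : sin_transform mu2 (simplex 0) (X w) p = 0 by rewrite /sin_transform simplex0 Rintegral_set0.
have lipF t1 t2 : 0 <= t1 <= T -> 0 <= t2 <= T ->
    `|sin_transform mu2 (simplex t1) (X w) p - sin_transform mu2 (simplex t2) (X w) p| <= T * `|t1 - t2|.
  by move=> h1 h2; have [] := transform_dist_le cb p h1 h2.
apply: le_trans (dyadic_chaining T0 Q1 F0 lipF tT) _.
apply: lee_wpmul2l; first by rewrite lee_fin.
apply: lee_nneseries => n _.
  by rewrite lee_fin mulr_ge0 ?exprn_ge0 ?(ltW Q0)//; exact: dyadic_variation_ge0.
rewrite lee_fin ler_wpM2l ?exprn_ge0 ?(ltW Q0)//; apply: ler_sum => k _.
by rewrite ds lerDr sqr_ge0.
Qed.

Lemma measurable_energy_sum Q : 0 <= Q ->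
  measurable_fun [set: Omega * measurableTypeR R] (fun x => energy_sum Q x.1 x.2).
Proof.
move=> Q0; apply: ge0_emeasurable_sum => [n x _ _|n _].
  rewrite lee_fin mulr_ge0 ?exprn_ge0//.
  by apply: sumr_ge0 => k _; exact: transform_energy_ge0.
apply/measurable_EFinP; apply: measurable_funM => //; apply: measurable_sum => k.
apply: (measurableT_comp (measurable_transform_energy hB (@measurable_strip R _ _))
  (g := fun x : Omega * measurableTypeR R => (x.2, x.1))).
by apply: measurable_fun_pair; [exact: measurable_snd|exact: measurable_fst].
Qed.

Lemma nneseries_le_bound (u : nat -> \bar R) (M : \bar R) : (forall n, 0 <= u n)%E ->
  (forall n, \sum_(0 <= i < n) u i <= M)%E -> (\sum_(0 <= i <oo) u i <= M)%E.
Proof.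
move=> u0 uM; apply: lime_le; first by apply: is_cvg_nneseries => n _ _.
by apply: nearW => n; exact: uM.
Qed.

Lemma expectation_energy_sum (th : R) : 0 < th <= 1 -> exists Q C : R, [/\ 1 < Q, 0 <= C &
  forall p, 1 <= `|p| ->
  (\int[P]_w energy_sum Q w p <= (C * `|p| `^ (- ((2 - th) / H)))%:E)%E].
Proof.
(* The [2 ^ n] strips of level [n] have width [T / 2 ^+ n] and contribute together a multiple of 2 ^
   (- n th) = Q ^ (- 2 n); the weight [Q ^+ n] leaves the summable Q ^ (- n). *)
move=> /andP[th0 th1]; pose Q : R := 2 `^ (th / 2).
have [|C [C0 hC]] := @expectation_energy_powR th; first by rewrite ltW.
have Q1 : 1 < Q.
  have -> : 1 = 1 `^ (th / 2) :> R by rewrite powR1.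
  by apply: gt0_ltr_powR; rewrite ?nnegrE ?ltr1n// divr_gt0.
have Q0 : 0 < Q by exact: lt_trans Q1.
have Qi : 0 < 1 - Q^-1 by rewrite subr_gt0 invf_lt1.
exists Q, (C * T `^ (1 + th) * (1 - Q^-1)^-1); split => //.
  by rewrite !mulr_ge0 ?powR_ge0// invr_ge0 ltW.
move=> p p1.
have mE n k : measurable_fun setT (fun w => (transform_energy B (strip (dyadic T n k) (dyadic T n k.+1)) p w)%:E).
  apply/measurable_EFinP.
  exact: (measurableT_comp (measurable_transform_energy hB (@measurable_strip R _ _)) (pair1_measurable (p : measurableTypeR R))).
rewrite /energy_sum integral_nneseries//; last 2 first.
- move=> n; apply/measurable_EFinP; apply: measurable_funM => //; apply: measurable_sum => k.
  by apply/measurable_EFinP; exact: mE.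
- move=> n w _; rewrite lee_fin mulr_ge0 ?exprn_ge0 ?(ltW Q0)//.
  by apply: sumr_ge0 => k _; exact: transform_energy_ge0.
set A := C * T `^ (1 + th) * `|p| `^ (- ((2 - th) / H)).
have A0 : 0 <= A by rewrite !mulr_ge0 ?powR_ge0.
have term n : (\int[P]_w (Q ^+ n * \sum_(k < 2 ^ n)
     transform_energy B (strip (dyadic T n k) (dyadic T n k.+1)) p w)%:E <= (A * Q^-1 ^+ n)%:E)%E.
  under eq_integral do rewrite EFinM -sumEFin.
  rewrite ge0_integralZl//=; last 3 first.
  - by apply: emeasurable_sum => k; exact: mE.
  - by move=> w _; apply: sume_ge0 => k _; rewrite lee_fin transform_energy_ge0.
  - by rewrite lee_fin exprn_ge0// ltW.
  rewrite ge0_integral_sum//; last by move=> k w _; rewrite lee_fin transform_energy_ge0.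
  pose D := T / 2 ^+ n; have D0 : 0 <= D by rewrite divr_ge0 ?exprn_ge0// ltW.
  have dE (k : nat) : dyadic T n k.+1 - dyadic T n k = D.
    by rewrite /dyadic -mulrBl -mulrBr -[k.+1%:R]natr1 addrC addKr mulr1.
  have dle (k : nat) : dyadic T n k <= dyadic T n k.+1 by rewrite -subr_ge0 dE.
  apply: (@le_trans _ _ ((Q ^+ n)%:E * (\sum_(k < 2 ^ n) (C * (D `^ (1 + th) * `|p| `^ (- ((2 - th) / H)))))%:E)%E).
    rewrite lee_wpmul2l ?lee_fin ?exprn_ge0 ?(ltW Q0)// -sumEFin; apply: lee_sum => k _.
    have /andP[d1 _] := dyadic_in_range T0 (ltnW (ltn_ord k)); have /andP[_ d2] := dyadic_in_range T0 (ltn_ord k).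
    by rewrite -(dE k); exact: hC.
  rewrite sumr_const card_ord -EFinM lee_fin -[(C * _) *+ _]mulr_natl natrX.
  have e1 : D `^ (1 + th) = T `^ (1 + th) * ((2 ^- n) * (Q^-1 ^+ n * Q^-1 ^+ n)).
    have i0 : (0 : R) <= 2 ^- n by rewrite invr_ge0 exprn_ge0.
    rewrite /D powRM// ?ltW//; congr (_ * _).
    rewrite powRD ?powRr1//; last by rewrite gt_eqF//= ltr_pwDl// ltW.
    congr (_ * _); rewrite -exprMn -exprVn -powR_mulrn ?invr_ge0// -powRrM mulrC powRrM powR_mulrn ?powR_ge0//.
    congr (_ ^+ _); rewrite -powR_inv1// -powRrM mulN1r powRN -invfM /Q -powRD ?pnatr_eq0 ?implybT//.
    by rewrite -splitr.
  rewrite e1 /A le_eqVlt; apply/orP; left; apply/eqP.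
  rewrite exprVn; field; rewrite !expf_neq0 ?pnatr_eq0// gt_eqF//.
apply: nneseries_le_bound => n.
  apply: integral_ge0 => w _; rewrite lee_fin mulr_ge0 ?exprn_ge0 ?(ltW Q0)//.
  by apply: sumr_ge0 => k _; exact: transform_energy_ge0.
apply: (@le_trans _ _ (\sum_(0 <= i < n) (A * Q^-1 ^+ i)%:E)%E).
  by apply: lee_sum => i _; exact: term.
rewrite sumEFin lee_fin -mulr_sumr big_mkord.
have -> : C * T `^ (1 + th) / (1 - Q^-1) * `|p| `^ (- ((2 - th) / H)) = A / (1 - Q^-1).
  by rewrite /A mulrAC.
apply: ler_wpM2l => //; rewrite -[leRHS]mul1r ler_pdivlMr// mulrC -opprB mulNr -subrX1 opprB.
by rewrite gerBl exprn_ge0// invr_ge0 ltW.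
Qed.

Lemma fbm_dominated_transform_at (kap : R) : kap < 2 / H - 1 ->
  {ae P, forall w, exists m0, dominated_transform T (fbm_path B w) kap m0}.
Proof.
move=> kH; pose g := 2 / H - 1 - kap; have g0 : 0 < g by rewrite subr_gt0.
(* With th / H at most g / 2, the exponent kap - (2 - th) / H is at most - 1 - g / 2, hence
   integrable at infinity. *)
pose th := Num.min 1 (H * g / 2).
have th0 : 0 < th by rewrite lt_min ltr01 !mulr_gt0.
have th1 : th <= 1 by rewrite ge_min lexx.
have thg : th / H <= g / 2.
  rewrite ler_pdivrMr// (_ : g / 2 * H = H * g / 2); last by ring.
  by rewrite ge_min lexx orbT.
have [|Q [C [Q1 C0 hC]]] := @expectation_energy_sum th; first by rewrite th0.
have Q0 : 0 <= Q by rewrite ltW// (lt_trans _ Q1).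
pose f w p := ((`|p| `^ kap)%:E * energy_sum Q w p)%E.
have f0 w p : (0 <= f w p)%E by rewrite mule_ge0 ?lee_fin ?powR_ge0// energy_sum_ge0.
have mf : measurable_fun [set: Omega * measurableTypeR R] (fun x => f x.1 x.2).
  apply: emeasurable_funM; last exact: measurable_energy_sum.
  apply/measurable_EFinP; exact: (measurableT_comp (measurable_powR_norm kap) measurable_snd).
have mO := @measurable_outer_set R.
have mfw w : measurable_fun [set: measurableTypeR R] (f w).
  exact: (measurableT_comp mf (pair1_measurable w)).
have mS p : measurable_fun setT (energy_sum Q ^~ p).
  exact: (measurableT_comp (measurable_energy_sum Q0) (pair2_measurable (p : measurableTypeR R))).
pose F w := (\int[mu]_(p in @outer_set R) f w p)%E.
have mF : measurable_fun setT F by exact: measurable_eint.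
have F0 w : (0 <= F w)%E by exact: integral_ge0.
have Flt : (\int[P]_w F w < +oo)%E.
  rewrite /F (tonelli_on P mu measurableT mO mf f0).
  apply: (@le_lt_trans _ _ (\int[mu]_(p in @outer_set R) (C%:E * (`|p| `^ (kap - (2 - th) / H))%:E))%E).
    apply: ge0_le_integral => //.
    - by move=> p _; exact: integral_ge0.
    - apply: measurable_funTS.
      apply: (@measurable_eint _ _ _ _ _ P setT (fun (p : measurableTypeR R) w => f w p)) => //.
      apply: (measurableT_comp mf (g := fun x : measurableTypeR R * Omega => (x.2, x.1))).
      by apply: measurable_fun_pair; [exact: measurable_snd|exact: measurable_fst].
    - apply: measurable_funTS; apply: emeasurable_funM => //.
      by apply/measurable_EFinP; exact: measurable_powR_norm.
    move=> p p1; have pp : 0 < `|p| by exact: lt_le_trans p1.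
    rewrite ge0_integralZl//; last by move=> w _; exact: energy_sum_ge0.
    apply: le_trans (lee_wpmul2l _ (hC p p1)) _; first by rewrite lee_fin powR_ge0.
    by rewrite -!EFinM lee_fin mulrCA -powRD// (gt_eqF pp) implybT.
  rewrite ge0_integralZl//=; last first.
    by apply: measurable_funTS; apply/measurable_EFinP; exact: measurable_powR_norm.
  rewrite lte_mul_pinfty// integral_outer_powR//.
  rewrite mulrBl; move: thg kH; rewrite /g; move: (2 / H) (th / H) => x y; lra.
have iF : P.-integrable setT F.
  by apply/integrableP; split => //; under eq_integral do rewrite gee0_abs//.
have := integrable_ae measurableT iF; apply: filterS => w /(_ I) Fw.
have Fw' : (F w < +oo)%E by rewrite -ge0_fin_numE.
have cb := @continuous_fbm_path _ _ _ _ _ _ hB w.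
have Qi : 0 <= (1 - Q^-1)^-1 by rewrite invr_ge0 subr_ge0 invf_le1 ?(lt_trans _ Q1)// ltW.
pose V p := ((2 * (1 - Q^-1)^-1)%:E * energy_sum Q w p)%E.
have V0 p : (0 <= V p)%E by rewrite mule_ge0 ?lee_fin ?mulr_ge0// energy_sum_ge0.
(* Finiteness of [F w] makes [V p] finite for almost every [p] of [outer_set] only. Capping by the
   deterministic bound [M] of the energy keeps the domination valid at every [p] once [fine] is
   applied. *)
pose M := (T * T) ^+ 2 + (T * T) ^+ 2.
have M0 : 0 <= M by rewrite addr_ge0// sqr_ge0.
have mfin p : mine (V p) M%:E \is a fin_num.
  rewrite ge0_fin_numE; first by rewrite gt_min ltry orbT.
  by rewrite le_min V0 lee_fin.
have mV : measurable_fun [set: measurableTypeR R] V.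
  apply: emeasurable_funM => //.
  exact: (measurableT_comp (measurable_energy_sum Q0) (pair1_measurable w)).
exists (fun p => fine (mine (V p) M%:E)); split.
- apply: measurableT_comp; first exact: fine_measurable.
  by apply: measurable_mine => //; exact: measurable_cst.
- by move=> p; rewrite fine_ge0// le_min V0 lee_fin.
- move=> t p tT; rewrite -lee_fin fineK// le_min; apply/andP; split.
    have [hc hs] := transform_le_energy_sum w p Q1 tT.
    rewrite EFinD; apply: le_trans (leeD hc hs) _.
    by rewrite /V -ge0_muleDl ?lee_fin// -EFinD -mulr2n mulr_natl.
  have [hc hs] := transform_norm_le cb p tT.
  have TT : 0 <= T * T by rewrite mulr_ge0// ltW.
  by rewrite lee_fin /M lerD// -real_normK ?num_real// lerXn2r ?nnegrE.
- apply: (@le_lt_trans _ _ (\int[mu]_(p in @outer_set R) ((2 * (1 - Q^-1)^-1)%:E * f w p))%E).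
    apply: ge0_le_integral => //.
    + by move=> p _; rewrite lee_fin mulr_ge0 ?powR_ge0// fine_ge0// le_min V0 lee_fin.
    + apply: measurable_funTS; apply/measurable_EFinP; apply: measurable_funM; first exact: measurable_powR_norm.
      apply: measurableT_comp; first exact: fine_measurable.
      by apply: measurable_mine => //; exact: measurable_cst.
    + by apply: measurable_funTS; apply: emeasurable_funM.
    move=> p _; rewrite EFinM fineK// /f muleCA lee_wpmul2l ?lee_fin ?powR_ge0//.
    by rewrite ge_min lexx.
  rewrite ge0_integralZl//=; first by rewrite lte_mul_pinfty ?lee_fin ?mulr_ge0.
  + exact: measurable_funTS.
  + by rewrite lee_fin mulr_ge0.
Qed.

(** The null set of [fbm_dominated_transform_at] depends on [kap]. Countably many exponents
    approaching the threshold suffice, because on [outer_set] the power of [|p|] increases with its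
    exponent. *)
Lemma fbm_dominated_transform : {ae P, forall w, forall kap : R, kap < 2 / H - 1 ->
  exists m0, dominated_transform T (fbm_path B w) kap m0}.
Proof.
have : {ae P, forall w, forall n : nat, exists m0,
    dominated_transform T (fbm_path B w) (2 / H - 1 - n.+1%:R^-1) m0}.
  apply: ae_foralln => n; apply: fbm_dominated_transform_at.
  by rewrite ltrBlDr ltrDl invr_gt0.
apply: filterS => w hw kap kH; pose e := 2 / H - 1 - kap.
have e0 : 0 < e by rewrite subr_gt0.
have [m0 [h1 h2 h3 h4]] := hw (Num.truncn e^-1).
exists m0; split; [exact: h1|exact: h2|exact: h3|]; apply: le_lt_trans h4.
apply: ge0_le_integral => //.
- exact: measurable_outer_set.
- by move=> p _; rewrite lee_fin mulr_ge0 ?powR_ge0.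
- by apply/measurable_EFinP/measurable_funTS; exact: measurable_powR_normM.
- by apply/measurable_EFinP/measurable_funTS; exact: measurable_powR_normM.
move=> p p1; rewrite lee_fin ler_wpM2r// ler_powR//.
have : (Num.truncn e^-1).+1%:R^-1 <= e.
  by rewrite -[leRHS]invrK lef_pV2 ?posrE ?invr_gt0// ltW// truncnS_gt.
by rewrite /e => hx; rewrite lerBrDr [Y in Y <= _]addrC -lerBrDr.
Qed.

End fbm_dominated_transform.

(** * Moments of the regularizations *)

Section fourier_stripping.
Context (R : realType) d (Omega : measurableType d) (P : probability Omega R) (H : R)
  (B : R -> Omega -> R).
Hypotheses (H0 : 0 < H) (H1 : H < 1) (hB : is_fBm H P B).
Notation mu := (@lebesgue_measure R).

(* A list [l] of pairs (frequency, time), with times decreasing from [a]. *)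
Fixpoint gap_weight (l : seq (R * R)) (a : R) : R :=
  if l is x :: l' then (\sum_(z <- l) z.1) ^+ 2 * (a - x.2) `^ (2 * H) + gap_weight l' x.2 else 0.

Lemma gap_weight_ge0 l a : 0 <= gap_weight l a.
Proof. by elim: l a => //= x l IH a; rewrite addr_ge0// mulr_ge0 ?sqr_ge0 ?powR_ge0. Qed.

(** Weights and times of [pinned_phase s l] up to sign conventions of a linear combination: the
    total weight sits at [s], so the sum of all weights is zero. *)
Definition pinned_increments (s : R) (l : seq (R * R)) : seq (R * R) :=
  (\sum_(z <- l) z.1, s) :: [seq (- z.1, z.2) | z <- l].

Lemma pinned_increments_sum s l : \sum_(z <- pinned_increments s l) z.1 = 0.
Proof. by rewrite /pinned_increments big_cons big_map /= sumrN subrr. Qed.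

Definition descending (a : R) (l : seq (R * R)) := path (fun u v : R => v < u) a (unzip2 l).

Lemma descending_min a l z : descending a l -> z \in l -> z.2 < a.
Proof.
move=> dl zl; have tr : transitive (fun u v : R => v < u).
  by move=> x y w h1 h2; exact: lt_trans h1.
have /allP/(_ z.2) := order_path_min tr dl; apply.
by apply/mapP; exists z.
Qed.

Section nondeterminism.
Variables (k s : R) (l0 : seq (R * R)).
Hypothesis lnd : gap_lower_bound H k.

(** The list [l1] holds the times already passed. Weights at times at least [a] add up to the sum
    over the remaining list, so each gap alone is bounded by the full variance, and adding all gaps
    costs the factor [size l]. *)
Lemma gap_weight_le_split l1 l a : l0 = l1 ++ l -> (forall z, z \in l1 -> a <= z.2) -> a <= s ->
  descending a l -> k * gap_weight l a <= (size l)%:R * increment_var H (pinned_increments s l0).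
Proof.
set V := increment_var H _.
elim: l l1 a => [|x l IH] l1 a e h1 as_ dl; first by rewrite mulr0 mul0r.
have /andP[xa dl'] : (x.2 < a) && descending x.2 l by [].
have lx z : z \in l -> z.2 < x.2 by exact: descending_min.
rewrite /= mulrDr -[(size l).+1%:R]natr1 [leRHS]mulrDl mul1r [leLHS]addrC lerD//.
  apply: (IH (rcons l1 x)) => //; first by rewrite cat_rcons.
  - by move=> z; rewrite mem_rcons inE => /orP[/eqP ->//|/h1]; apply: le_trans; exact: ltW.
  - by rewrite (le_trans _ as_)// ltW.
have -> : \sum_(z <- x :: l) z.1 = \sum_(z <- pinned_increments s l0 | a <= z.2) z.1.
  have e1 : \sum_(z <- l1 | a <= z.2) - z.1 = - \sum_(z <- l1) z.1.
    rewrite -sumrN big_seq_cond [RHS]big_seq; apply: eq_bigl => z.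
    by case zl : (z \in l1) => //=; rewrite h1.
  have e2 : \sum_(z <- x :: l | a <= z.2) - z.1 = 0.
    rewrite big_seq_cond big1// => z /andP[]; rewrite inE => /orP[/eqP ->|/lx zx].
      by rewrite leNgt xa.
    by rewrite leNgt (lt_trans zx).
  rewrite /pinned_increments [RHS]big_cons/= as_ big_map/= [in RHS]e !big_cat/= e1 e2 addr0.
  by rewrite [_ + \sum_(i <- x :: l) _]addrC addrK.
rewrite mulrA; apply: lnd => //; first exact: pinned_increments_sum.
move=> z; rewrite inE => /orP[/eqP ->|/mapP[u ul ->]] /=; first by right.
move: ul; rewrite e mem_cat => /orP[/h1|]; first by right.
by rewrite inE => /orP[/eqP ->|/lx/ltW]; left.
Qed.

Lemma gap_weight_le : descending s l0 ->
  k * gap_weight l0 s <= (size l0)%:R * increment_var H (pinned_increments s l0).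
Proof. by move=> dl; apply: (@gap_weight_le_split [::] l0). Qed.

End nondeterminism.

Definition pinned_phase (s : R) (l : seq (R * R)) (w : Omega) : R :=
  \sum_(z <- l) z.1 * (B s w - B z.2 w).

(** Allowing any [n] above the number of frequencies keeps the constant in the exponent fixed while
    [l] grows in the induction of [strip_bound]. *)
Lemma pinned_phase_char (k s th : R) (n : nat) (l : seq (R * R)) : 0 < k -> 0 <= s ->
  gap_lower_bound H k ->
  (forall z, z \in l -> 0 <= z.2) -> descending s l -> (size l <= n)%N -> (0 < n)%N ->
  `|\int[P]_w cos (th + pinned_phase s l w)| <= expR (- (k / (2 * n%:R) * gap_weight l s)).
Proof.
move=> k0 s0 lnd l0 dl ln n0; have hw := gap_weight_le lnd dl.
have -> : \int[P]_w cos (th + pinned_phase s l w) =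
    cos th * expR (- increment_var H (pinned_increments s l) / 2).
  rewrite -(fbm_char hB); last 2 first.
  - by move=> z; rewrite inE => /orP[/eqP ->//|/mapP[u ul ->]] /=; apply: l0.
  - exact: pinned_increments_sum.
  apply: eq_Rintegral => w _; congr (cos (_ + _)).
  rewrite /pinned_phase /pinned_increments big_cons/= big_map/= mulr_suml -big_split/=.
  by apply: eq_bigr => z _; rewrite mulNr mulrBr.
rewrite normrM [`|expR _|]ger0_norm ?expR_ge0// (le_trans (ler_piMl _ (cos_max _))) ?expR_ge0//.
have n0' : (0 : R) < n%:R by rewrite ltr0n.
rewrite ler_expR mulNr lerN2.
set V := increment_var H _ in hw *.
have W0 : 0 <= k * gap_weight l s by rewrite mulr_ge0 ?gap_weight_ge0// ltW.
have hV : k * gap_weight l s <= n%:R * V.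
  (* A negative [V] would contradict [hw] when [l] is nonempty, and [V] is zero when it is empty. *)
  have [V0|V0] := leP 0 V; first by rewrite (le_trans hw)// ler_wpM2r// ler_nat.
  have [l00|ln0] := eqVneq (size l) 0%N.
    move: V0; rewrite /V (size0nil l00) /pinned_increments /increment_var !big_cons !big_nil/=.
    by rewrite mul0r !mul0r !addr0 mulr0 ltxx.
  have : (size l)%:R * V < 0 by rewrite nmulr_llt0// ltr0n lt0n.
  by move=> h; have := le_lt_trans hw h; rewrite ltNge W0.
have -> : k / (2 * n%:R) * gap_weight l s = k * gap_weight l s / n%:R / 2.
  by field; rewrite gt_eqF.
by rewrite ler_pM2r ?invr_gt0// ler_pdivrMr// [leRHS]mulrC.
Qed.

Section stripping.
Variables (k s y eps : R) (n : nat).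
Hypotheses (k0 : 0 < k) (s0 : 0 <= s) (eps0 : 0 < eps) (n0 : (0 < n)%N).
Hypothesis lnd : gap_lower_bound H k.

Let c := k / (2 * n%:R).
Let c0 : 0 < c. Proof. by rewrite divr_gt0// mulr_gt0// ltr0n. Qed.

Definition heat_at (r : R) (w : Omega) : R := heat eps (B s w - B r w - y).

(** The factor [(2 * pi)^-1] of Fourier inversion times the integral of [expR (- (c * x ^+ 2))]: the
    cost of integrating out one frequency across a gap of unit length. *)
Definition strip_const : R := (2 * pi)^-1 * Num.sqrt (pi / c).

Lemma strip_const_ge0 : 0 <= strip_const.
Proof. by rewrite mulr_ge0 ?sqrtr_ge0// invr_ge0 mulr_ge0// pi_ge0. Qed.

(** The times increase along the list, and [head s rs'] is the time that follows [r], namely [s]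
    after the last one. *)
Fixpoint gap_prod (rs : seq R) : R :=
  if rs is r :: rs' then strip_const * (head s rs' - r) `^ (- H) * gap_prod rs' else 1.

Lemma gap_prod_ge0 rs : 0 <= gap_prod rs.
Proof. elim: rs => //= r rs IH; apply: mulr_ge0 => //.
by apply: mulr_ge0; [exact: strip_const_ge0|exact: powR_ge0]. Qed.

Let M := (Num.sqrt (2 * pi * eps))^-1.
Let M0 : 0 <= M. Proof. by rewrite invr_ge0 sqrtr_ge0. Qed.

Lemma heat_at_ge0 r w : 0 <= heat_at r w. Proof. exact: heat_ge0. Qed.

Lemma heat_at_le r w : heat_at r w <= M.
Proof. by rewrite -[leLHS]ger0_norm ?heat_at_ge0//; exact: heat_le_heat0. Qed.

Lemma measurable_heat_at r : 0 <= r -> measurable_fun setT (heat_at r).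
Proof.
move=> r0; apply: (measurableT_comp (measurable_heat eps)); apply: measurable_funB => //.
by apply: measurable_funB; exact: (fbm_measurable hB).
Qed.

Definition heat_prod (rs : seq R) (w : Omega) : R := \prod_(r <- rs) heat_at r w.

Lemma heat_prod_ge0 rs w : 0 <= heat_prod rs w.
Proof. by apply: prodr_ge0 => r _; exact: heat_at_ge0. Qed.

Lemma heat_prod_le rs w : heat_prod rs w <= M ^+ size rs.
Proof.
elim: rs => [|r rs IH]; first by rewrite /heat_prod big_nil expr0.
rewrite /heat_prod big_cons exprS; apply: ler_pM => //.
- exact: heat_at_ge0.
- exact: heat_prod_ge0.
- exact: heat_at_le.
Qed.

Lemma measurable_heat_prod rs : (forall r, r \in rs -> 0 <= r) ->
  measurable_fun setT (heat_prod rs).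
Proof.
elim: rs => [|r rs IH] h.
  by rewrite (_ : heat_prod [::] = cst 1)//; apply/funext => w; rewrite /heat_prod big_nil.
rewrite (_ : heat_prod (r :: rs) = fun w => heat_at r w * heat_prod rs w).
  apply: measurable_funM; first by apply: measurable_heat_at; apply: h; rewrite mem_head.
  by apply: IH => u ur; apply: h; rewrite inE ur orbT.
by apply/funext => w; rewrite /heat_prod big_cons.
Qed.

Lemma measurable_pinned_phase l : (forall z, z \in l -> 0 <= z.2) ->
  measurable_fun setT (pinned_phase s l).
Proof.
elim: l => [|x l IH] h.
  by rewrite (_ : pinned_phase s [::] = cst 0)//; apply/funext => w; rewrite /pinned_phase big_nil.
rewrite (_ : pinned_phase s (x :: l) = fun w => x.1 * (B s w - B x.2 w) + pinned_phase s l w).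
  apply: measurable_funD; last by apply: IH => u ur; apply: h; rewrite inE ur orbT.
  apply: measurable_funM => //; apply: measurable_funB; apply: (fbm_measurable hB) => //.
  by apply: h; rewrite mem_head.
by apply/funext => w; rewrite /pinned_phase big_cons.
Qed.

Lemma sqrt_pi_gap (l : R) : 0 < l ->
  (2 * pi)^-1 * Num.sqrt (2 * pi / (2 * c * l `^ (2 * H))) = strip_const * l `^ (- H).
Proof.
move=> l0; rewrite /strip_const -[RHS]mulrA; congr (_ * _).
have lH : 0 < l `^ H by rewrite powR_gt0.
have e : l `^ (2 * H) = (l `^ H) ^+ 2 by rewrite mulrC powRrM powR_mulrn ?powR_ge0.
have -> : 2 * pi / (2 * c * l `^ (2 * H)) = (pi / c) * (l `^ (- H)) ^+ 2 :> R.
  by rewrite e powRN; field; rewrite gt_eqF// gt_eqF.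
rewrite (@sqrtrM _ (pi / c)); last by apply: divr_ge0; [exact: pi_ge0|exact: ltW].
by rewrite sqrtr_sqr ger0_norm// powR_ge0.
Qed.

Lemma integral_gaussian_shift (A q : R) : 0 < A ->
  (\int[mu]_x (gaussian A (x + q))%:E = (Num.sqrt (2 * pi / A))%:E)%E.
Proof.
move=> A0; have mg : measurable_fun setT (fun x : R => (gaussian A x)%:E).
  by apply/measurable_EFinP; exact: measurable_gaussian.
have := ge0_integral_shift q mg (fun x => gaussian_ge0 A x).
by rewrite integral_gaussian// => ->.
Qed.

Lemma integrable_gaussian_shift (A q : R) : 0 < A ->
  mu.-integrable setT (EFin \o (fun x => gaussian A (x + q))).
Proof.
move=> A0; apply/integrableP; split.
  apply/measurable_EFinP; apply: (measurableT_comp (measurable_gaussian A)).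
  exact: measurable_funD.
under eq_integral do rewrite /= ger0_norm ?gaussian_ge0//.
by rewrite integral_gaussian_shift// ltry.
Qed.

(* Induction on [rs], increasing in time: the heat kernel at [r] is a Gaussian average of phases of
   frequency [x], and [(x, r)] joins the list [l] of frequencies at earlier times.  The resulting
   Gaussian integral over [x] is centred at [- \sum_(z <- l) z.1] and gives the factor
   [(a - r) `^ (- H)], where [a] is the next time. *)
Lemma strip_bound rs l th : (size l + size rs <= n)%N ->
  (forall z, z \in l -> 0 <= z.2) -> (forall r, r \in rs -> 0 <= r) ->
  descending (head s rs) l -> path <%R (head s rs) (behead (rcons rs s)) ->
  `|\int[P]_w (cos (th + pinned_phase s l w) * heat_prod rs w)| <=
  gap_prod rs * expR (- (c * gap_weight l (head s rs))).
Proof.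
elim: rs l th => [|r rs IH] l th ln l0 rs0 dl asc.
  rewrite mul1r; apply: le_trans (pinned_phase_char th k0 s0 lnd l0 dl _ n0); last by rewrite addn0 in ln.
  by under eq_Rintegral do rewrite /heat_prod big_nil mulr1.
set a := head s rs.
have /andP[ra asc'] : (r < a) && path <%R a (behead (rcons rs s)).
  by move: asc; rewrite /a; case: (rs) => //=.
have r0 : 0 <= r by apply: rs0; rewrite mem_head.
have rs0' u : u \in rs -> 0 <= u by move=> ur; apply: rs0; rewrite inE ur orbT.
pose h x w := cos ((th - y * x) + pinned_phase s ((x, r) :: l) w) * heat_prod rs w.
have mP := measurable_heat_prod rs0'.
have mh0 : measurable_fun [set: Omega * measurableTypeR R] (fun z => h z.2 z.1).
  apply: measurable_funM; last exact: (measurableT_comp mP measurable_fst).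
  apply: measurableT_comp; first exact: measurable_cos.
  apply: measurable_funD.
    apply: measurable_funB => //; apply: measurable_funM => //; exact: measurable_snd.
  rewrite (_ : (fun z : Omega * measurableTypeR R => _) = fun z : Omega * measurableTypeR R =>
      (z.2 : R) * (B s z.1 - B r z.1) + pinned_phase s l z.1); last first.
    by apply/funext => z; rewrite /pinned_phase big_cons.
  apply: measurable_funD; last exact: (measurableT_comp (measurable_pinned_phase l0) measurable_fst).
  apply: measurable_funM; first exact: measurable_snd.
  apply: measurable_funB.
    exact: (measurableT_comp (fbm_measurable hB s0) measurable_fst).
  exact: (measurableT_comp (fbm_measurable hB r0) measurable_fst).
have mh : measurable_fun [set: Omega * measurableTypeR R] (fun z => h z.2 z.1 * gaussian eps z.2).
  apply: measurable_funM => //; exact: (measurableT_comp (measurable_gaussian eps) measurable_snd).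
have hM x w : `|h x w| <= M ^+ size rs.
  rewrite normrM [`|heat_prod _ _|]ger0_norm ?heat_prod_ge0//.
  by rewrite (le_trans _ (heat_prod_le rs w))// ler_piMl ?heat_prod_ge0// cos_max.
have iP : P.-integrable setT (EFin \o cst (M ^+ size rs)) by exact: finite_measure_integrable_cst.
have ig := integrable_gaussian eps0.
have hg w x : setT w -> setT x -> `|h x w * gaussian eps x| <= cst (M ^+ size rs) w * gaussian eps x.
  by move=> _ _; rewrite normrM [`|gaussian _ _|]ger0_norm ?gaussian_ge0// ler_wpM2r ?gaussian_ge0.
have e1 : \int[P]_w (cos (th + pinned_phase s l w) * heat_prod (r :: rs) w) =
    (2 * pi)^-1 * \int[mu]_x (\int[P]_w (h x w * gaussian eps x)).
  transitivity (\int[P]_w ((2 * pi)^-1 * \int[mu]_x (h x w * gaussian eps x))).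
    apply: eq_Rintegral => w _; rewrite /heat_prod big_cons mulrA [cos _ * _]mulrC /heat_at heat_fourier// -!mulrA.
    congr (_ * _); rewrite -RintegralZr//; last first.
      apply: (le_integrable measurableT _ _ ig).
        apply/measurable_EFinP; apply: measurable_funM; last exact: measurable_gaussian.
        apply: measurableT_comp; first exact: measurable_cos.
        by apply: measurable_funD => //; exact: measurable_funM.
      move=> x _; rewrite lee_fin/= normrM ler_piMl//; exact: cos_max.
    apply: eq_Rintegral => x _; rewrite /h /pinned_phase big_cons/= mulrAC; congr (cos _ * _ * _).
    ring.
  rewrite RintegralZl//; last exact: (integrable_Rint measurableT measurableT mh iP ig hg).
  by congr (_ * _); exact: (fubini_on measurableT measurableT mh iP ig hg).
rewrite e1 normrM ger0_norm ?invr_ge0 ?mulr_ge0 ?pi_ge0//.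
(* Chosen so that [gaussian A (x + q)] is the exponential of the first term of
   [- (c * gap_weight ((x, r) :: l) a)]. *)
pose A := 2 * c * (a - r) `^ (2 * H).
have A0 : 0 < A.
  by apply: mulr_gt0; [exact: mulr_gt0|rewrite powR_gt0// subr_gt0].
pose q := \sum_(z <- l) z.1.
pose K := gap_prod rs * expR (- (c * gap_weight l r)).
have K0 : 0 <= K by rewrite mulr_ge0 ?gap_prod_ge0 ?expR_ge0.
have ib : mu.-integrable setT (EFin \o (fun x => K * gaussian A (x + q))).
  by have := integrableZl measurableT K (integrable_gaussian_shift q A0); exact.
have hb x : `|\int[P]_w (h x w * gaussian eps x)| <= K * gaussian A (x + q).
  have ih : P.-integrable setT (EFin \o h x).
    apply: (@integrable_bounded_prob _ _ _ _ _ (M ^+ size rs)) => //.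
    exact: (measurableT_comp mh0 (pair2_measurable (x : measurableTypeR R))).
  rewrite RintegralZr// normrM [`|gaussian _ _|]ger0_norm ?gaussian_ge0//.
  (* The factor [gaussian eps x] is bounded by [1]; the decay in [x] comes from the variance
     instead, and this makes the estimate uniform in [eps]. *)
  apply: (@le_trans _ _ `|\int[P]_w h x w|).
    by rewrite ler_piMr// gaussian_le1// ltW.
  apply: le_trans (IH ((x, r) :: l) (th - y * x) _ _ _ _ _) _ => //.
  - by rewrite /= addSnnS.
  - by move=> z; rewrite inE => /orP[/eqP ->//|]; exact: l0.
  - by rewrite /descending /= -/a ra.
  rewrite -/a /K /= big_cons/= -/q -mulrA ler_wpM2l ?gap_prod_ge0// /gaussian -expRD ler_expR.
  rewrite le_eqVlt; apply/orP; left; apply/eqP; rewrite /A; by field.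
have iI : mu.-integrable setT (EFin \o (fun x => \int[P]_w (h x w * gaussian eps x))).
  apply: (@integrable_Rint _ _ _ _ _ mu P setT setT (fun x w => h x w * gaussian eps x) (gaussian eps) (cst (M ^+ size rs))) => //.
    apply: (measurableT_comp mh (g := fun z : measurableTypeR R * Omega => (z.2, z.1))).
    by apply: measurable_fun_pair; [exact: measurable_snd|exact: measurable_fst].
  by move=> x w _ _; rewrite [leRHS]mulrC; exact: hg.
have hR : \int[mu]_x (K * gaussian A (x + q)) = K * Num.sqrt (2 * pi / A).
  rewrite RintegralZl//; last exact: integrable_gaussian_shift.
  by rewrite /Rintegral integral_gaussian_shift.
apply: (@le_trans _ _ ((2 * pi)^-1 * (K * Num.sqrt (2 * pi / A)))).
  apply: ler_wpM2l; first by rewrite invr_ge0 mulr_ge0 ?pi_ge0.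
  rewrite -hR; apply: le_trans (le_normr_Rintegral measurableT iI) _.
  by apply: le_Rintegral => //; exact: integrable_norm.
have hs := sqrt_pi_gap (_ : 0 < a - r); rewrite mulrCA hs ?subr_gt0// /K /= -/a.
rewrite le_eqVlt; apply/orP; left; apply/eqP; ring.
Qed.

End stripping.
End fourier_stripping.

(** * Powers of a primitive as integrals *)

Section primitive_powers.
Context (R : realType).
Notation mu := (@lebesgue_measure R).

Lemma primitive_power (f : R -> R) (k : nat) (a : R) : continuous f -> 0 <= a ->
  (((\int[mu]_(r in `[0, a]) f r) ^+ k.+1)%:E =
   \int[mu]_(x in `[0%R, a]) (k.+1%:R * (f x * (\int[mu]_(r in `[0, x]) f r) ^+ k))%:E)%E.
Proof.
move=> cf; rewrite le_eqVlt => /predU1P[<-|a0].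
  rewrite set_itv1 Rintegral_set1 expr0n/= integral_set1//.
have jf (u v : R) : mu.-integrable `[u, v] (EFin \o f).
  by apply: continuous_compact_integrable; [exact: segment_compact|exact: continuous_subspaceT].
(* Starting the primitive at [- 1] makes it differentiable around the whole of [[0, a]], the
   endpoint [0] included. *)
pose F (x : R) : R := \int[mu]_(r in `[(- 1)%R, x]) f r.
have dF (x : R) : - 1 < x -> is_derive x (1 : R) F (f x).
  move=> x1; have xx : x < x + 1 by rewrite ltrDl.
  have [h1 h2] := continuous_FTC1_closed xx (jf (- 1) (x + 1)) x1 (cf x).
  by apply: DeriveDef; [exact: h1|rewrite -derive1E].
have FE (x : R) : 0 <= x -> F x - F 0 = \int[mu]_(r in `[0, x]) f r.
  move=> x0; have n1 : (- 1 : R) <= 0 by rewrite oppr_le0.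
  rewrite /F (Rintegral_itvB (jf (- 1) x)); [|by rewrite bnd_simp|by rewrite bnd_simp].
  apply: Rintegral_itv_obnd_cbnd; apply: integrableS (jf 0 x) => //.
  by apply: subset_itvr; rewrite bnd_simp.
pose G (x : R) : R := (F x - F 0) ^+ k.+1.
have dG (x : R) : - 1 < x -> is_derive x (1 : R) G (k.+1%:R * (f x * (F x - F 0) ^+ k)).
  move=> x1; have dFx := dF x x1.
  have h : is_derive x (1 : R) ((F - cst (F 0)) ^+ k.+1) ((k.+1%:R * (F - cst (F 0)) x ^+ k) *: (f x - 0)).
    by apply: is_deriveX; apply: is_deriveB.
  rewrite (_ : G = (F - cst (F 0)) ^+ k.+1).
    by apply: is_derive_eq; rewrite subr0 /GRing.scale/= mulrAC mulrA.
  by apply/funext => z; rewrite /G exprfctE.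
have cG (x : R) : - 1 < x -> {for x, continuous G}.
  by move=> x1; apply: differentiable_continuous; apply/derivable1_diffP; case: (dG x x1).
have cF (x : R) : - 1 < x -> {for x, continuous F}.
  by move=> x1; apply: differentiable_continuous; apply/derivable1_diffP; case: (dF x x1).
have ftc : (\int[mu]_(x in `[0%R, a]) (k.+1%:R * (f x * (F x - F 0) ^+ k))%:E = (G a)%:E - (G 0)%:E)%E.
  apply: continuous_FTC2 => //.
  - apply: continuous_in_subspaceT => x /set_mem /=; rewrite in_itv/= => /andP[x0 _].
    have x1 : - 1 < x by lra.
    apply: cvgM; first exact: cvg_cst.
    apply: cvgM; first exact: cf.
    apply: (@continuous_comp _ _ _ (fun z => F z - F 0) (fun z => z ^+ k)); last exact: exprn_continuous.
    by apply: cvgB; [exact: cF|exact: cvg_cst].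
  - split.
    + by move=> x; rewrite in_itv/= => /andP[x0 _]; case: (dG x _) => //; lra.
    + by apply: cvg_at_right_filter; apply: cG; lra.
    + by apply: cvg_at_left_filter; apply: cG; lra.
  - move=> x; rewrite in_itv/= => /andP[x0 _].
    by rewrite derive1E; case: (dG x _) => //; lra.
rewrite -(FE _ (ltW a0)) -/(G a).
have -> : (G a)%:E = ((G a)%:E - (G 0)%:E)%E by rewrite /G subrr expr0n/= sube0.
rewrite -ftc; apply: eq_integral => x /set_mem/=; rewrite in_itv/= => /andP[x0 _].
by rewrite FE.
Qed.

End primitive_powers.

(** * Moments of the inner integral *)

Section heat_moments.
Context (R : realType) d (Omega : measurableType d) (P : probability Omega R) (H : R)
  (B : R -> Omega -> R).
Hypotheses (H0 : 0 < H) (H1 : H < 1) (hB : is_fBm H P B).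
Notation mu := (@lebesgue_measure R).
Variables (k s y eps : R) (n : nat).
Hypotheses (k0 : 0 < k) (s0 : 0 <= s) (eps0 : 0 < eps) (n0 : (0 < n)%N).
Hypothesis lnd : gap_lower_bound H k.
Notation f := (heat_at B s y eps).
Notation Pi := (heat_prod B s y eps).
Notation gprod := (gap_prod H k s n).
Notation K := (@strip_const R k n).

Lemma expectation_heat_prod (rs : seq R) : (size rs <= n)%N -> (forall r, r \in rs -> 0 <= r) ->
  path <%R (head s rs) (behead (rcons rs s)) ->
  (\int[P]_w (Pi rs w)%:E <= (gprod rs)%:E)%E.
Proof.
move=> sn rs0 asc; have := @strip_bound _ _ _ _ _ _ hB k s y eps n k0 s0 eps0 n0 lnd rs [::] 0 sn _ rs0 _ asc.
rewrite mulr0 oppr0 expR0 mulr1 => h.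
have iPi : P.-integrable setT (EFin \o Pi rs).
  apply: integrable_bounded_prob; first exact: (measurable_heat_prod hB y eps s0 rs0).
  by move=> w; rewrite ger0_norm ?heat_prod_ge0//; exact: heat_prod_le.
rewrite -EFin_Rintegral// lee_fin; apply: le_trans (h _ _) => //.
apply: le_trans (ler_norm _); rewrite le_eqVlt; apply/orP; left; apply/eqP; apply: eq_Rintegral => w _.
by rewrite /pinned_phase big_nil addr0 cos0 mul1r.
Qed.

Definition heat_path (w : Omega) (r : R) : R := heat eps (fbm_path B w s - fbm_path B w r - y).

Lemma heat_pathE w r : 0 <= r -> heat_path w r = f r w.
Proof. by move=> r0; rewrite /heat_path !fbm_pathE. Qed.

Lemma heat_path_ge0 w r : 0 <= heat_path w r. Proof. exact: heat_ge0. Qed.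

Lemma continuous_heat : continuous (@heat R eps).
Proof.
rewrite (_ : heat eps = (fun x => (Num.sqrt (2 * pi * eps))^-1 * gaussian eps^-1 x)); last first.
  by apply/funext => x; rewrite heatE.
by move=> x; apply: cvgM; [exact: cvg_cst|exact: continuous_gaussian].
Qed.

Lemma continuous_heat_path w : continuous (heat_path w).
Proof.
move=> r; apply: (@continuous_comp _ _ _ (fun r => fbm_path B w s - fbm_path B w r - y) (heat eps)); last exact: continuous_heat.
apply: cvgB; last exact: cvg_cst.
by apply: cvgB; [exact: cvg_cst|exact: continuous_fbm_path hB w r].
Qed.

Lemma measurable_heat_path : measurable_fun [set: Omega * measurableTypeR R] (fun z => heat_path z.1 z.2).
Proof.
apply: (measurableT_comp (measurable_heat eps)); apply: measurable_funB => //.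
apply: (measurableT_comp (measurable_fbm_increment hB) (g := fun z : Omega * measurableTypeR R => (z.1, (s : measurableTypeR R, z.2)))).
apply: measurable_fun_pair; first exact: measurable_fst.
by apply: measurable_fun_pair; [exact: measurable_cst|exact: measurable_snd].
Qed.

Definition heat_primitive (w : Omega) (a : R) : R := \int[mu]_(r in `[0, a]) heat_path w r.

Lemma heat_primitive_ge0 w a : 0 <= heat_primitive w a.
Proof. by apply: Rintegral_ge0 => r _; exact: heat_path_ge0. Qed.

Lemma measurable_heat_primitive :
  measurable_fun [set: Omega * measurableTypeR R] (fun z => heat_primitive z.1 z.2).
Proof.
pose g (z : Omega * measurableTypeR R) (r : measurableTypeR R) : R :=
  if (0 <= r) && (r <= z.2) then heat_path z.1 r else 0.
rewrite (_ : (fun z => _) = fun z => \int[mu]_r g z r); last first.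
  apply/funext => z; rewrite /heat_primitive Rintegral_mkcond; apply: eq_Rintegral => r _.
  rewrite patchE /g (_ : (r \in `[0, z.2]%classic) = (0 <= r <= z.2))//.
  by apply/idP/idP; rewrite inE/= in_itv/=.
apply: (measurable_Rint mu (f := g)) => //.
apply: measurable_fun_ifT => //.
  apply: measurable_and; apply: measurable_fun_ler => //.
  exact: (measurableT_comp measurable_snd measurable_fst).
apply: (measurableT_comp measurable_heat_path (g := fun x : (Omega * measurableTypeR R) * measurableTypeR R => (x.1.1, x.2))).
by apply: measurable_fun_pair; [exact: (measurableT_comp measurable_fst measurable_fst)|exact: measurable_snd].
Qed.

Lemma integral_gap_powR (h T : R) : 0 <= h -> h <= T ->
  (\int[mu]_(r in `[0%R, h[) ((h - r) `^ (- H))%:E <= (T `^ (1 - H) / (1 - H))%:E)%E.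
Proof.
rewrite le_eqVlt => /predU1P[<-|h0] hT.
  rewrite set_itvco0 integral_set0 lee_fin divr_ge0 ?powR_ge0// subr_ge0.
  exact: ltW.
pose g := (fun r : R => ((h - r) `^ (- H))%:E) \_ `[0%R, h[.
have mp : measurable_fun setT (fun r : R => ((h - r) `^ (- H))%:E).
  apply/measurable_EFinP; apply: (measurableT_comp (measurable_powR (- H))).
  exact: measurable_funB.
have mg : measurable_fun setT g.
  by apply/(measurable_restrictT _ _).1; [exact: measurable_itv|exact: measurable_funTS].
have g0 x : (0 <= g x)%E by rewrite /g patchE; case: ifP => // _; rewrite lee_fin powR_ge0.
have mgN : measurable_fun setT (fun x : R => g (- x)) by apply: (measurableT_comp mg); exact: measurable_funN.
rewrite integral_mkcond -/g (ge0_integral_opp mg g0) (ge0_integral_shift (- h) mgN (fun x => g0 (- x))).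
rewrite (_ : \int[mu]_x g (- (x - h))%R = \int[mu]_(x in `]0%R, h]) (x `^ (- H))%:E)%E; last first.
  rewrite [RHS]integral_mkcond; apply: eq_integral => x _; rewrite /g !patchE.
  rewrite opprB subKr; congr (if _ then _ else _).
  by apply/idP/idP; rewrite !inE/= !in_itv/=; lra.
apply: le_trans (integral_powR_origin _ h0) _; first by rewrite ltrN2.
rewrite lee_fin addrC ler_pM2r ?invr_gt0 ?subr_gt0//.
by apply: ge0_ler_powR; rewrite ?nnegrE ?subr_ge0 ?(ltW H1) ?(ltW h0)// (le_trans (ltW h0)).
Qed.

(* The [j]-th power of the primitive is an iterated integral over ordered times, by
   [primitive_power]; each of them is moved in turn into the product [Pi]. *)
Lemma expectation_primitive_heat_prod (T : R) (j : nat) (rs : seq R) : s <= T -> (j + size rs <= n)%N ->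
  (forall r, r \in rs -> 0 <= r) -> path <%R (head s rs) (behead (rcons rs s)) ->
  (\int[P]_w (heat_primitive w (head s rs) ^+ j * Pi rs w)%:E <=
   (j`!%:R * (K * (T `^ (1 - H) / (1 - H))) ^+ j * gprod rs)%:E)%E.
Proof.
move=> sT; elim: j rs => [|j IH] rs sn rs0 asc.
  under eq_integral do rewrite expr0 mul1r.
  by rewrite expr0 !mul1r; apply: expectation_heat_prod.
set h := head s rs.
have h0 : 0 <= h.
  by rewrite /h; case: (rs) rs0 => //= r rs' rs0; apply: rs0; rewrite mem_head.
have hs : h <= s.
  rewrite /h; case: (rs) asc => //= r rs' asc.
  have /allP/(_ s) := order_path_min lt_trans asc; rewrite mem_rcons mem_head => /(_ isT); exact: ltW.
have hT : h <= T by exact: le_trans sT.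
have K0 := @strip_const_ge0 R k n.
set D := K * _.
have mhr : measurable_fun setT (fun r : R => ((h - r) `^ (- H))%:E).
  apply/measurable_EFinP; apply: (measurableT_comp (measurable_powR (- H))).
  exact: measurable_funB.
have D0 : 0 <= D by rewrite mulr_ge0// divr_ge0 ?powR_ge0 ?subr_ge0 ?(ltW H1).
have mI : measurable (`[0%R, h[%classic : set (measurableTypeR R)) by exact: measurable_itv.
pose g w (r : R) : \bar R := (j.+1%:R * (heat_path w r * heat_primitive w r ^+ j) * Pi rs w)%:E.
have g0 w r : (0 <= g w r)%E.
  rewrite lee_fin mulr_ge0 ?heat_prod_ge0// mulr_ge0// mulr_ge0 ?heat_path_ge0//.
  by rewrite exprn_ge0// heat_primitive_ge0.
have mg : measurable_fun [set: Omega * measurableTypeR R] (fun z => g z.1 z.2).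
  apply/measurable_EFinP; apply: measurable_funM; last first.
    exact: (measurableT_comp (measurable_heat_prod hB y eps s0 rs0) measurable_fst).
  apply: measurable_funM => //; apply: measurable_funM; first exact: measurable_heat_path.
  exact: (measurable_funX j measurable_heat_primitive).
have -> : (\int[P]_w (heat_primitive w h ^+ j.+1 * Pi rs w)%:E = \int[P]_w \int[mu]_(r in `[0%R, h[) g w r)%E.
  apply: eq_integral => w _; rewrite EFinM (primitive_power _ (@continuous_heat_path w) h0).
  have mq : measurable_fun setT (fun r : R => (j.+1%:R * (heat_path w r * (\int[mu]_(x in `[0, r]) heat_path w x) ^+ j))%:E).
    apply/measurable_EFinP; apply: measurable_funM => //; apply: measurable_funM.
      exact: (measurableT_comp measurable_heat_path (pair1_measurable w)).
    by apply: measurable_funX; exact: (measurableT_comp measurable_heat_primitive (pair1_measurable w)).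
  (* The right endpoint is removed so that the new time is strictly below [h], as the ordering of
     [rs] demands. *)
  rewrite -integral_itv_bndo_bndc; last exact: measurable_funTS.
  rewrite -ge0_integralZr//=.
  - exact: measurable_funTS.
  - move=> r _; rewrite lee_fin mulr_ge0// mulr_ge0 ?heat_path_ge0// exprn_ge0//.
    exact: heat_primitive_ge0.
  - by rewrite lee_fin heat_prod_ge0.
rewrite (tonelli_on P mu measurableT mI mg g0).
apply: (@le_trans _ _ (\int[mu]_(r in `[0%R, h[) ((j.+1%:R * (j`!%:R * D ^+ j * K * gprod rs))%:E * ((h - r) `^ (- H))%:E))%E).
  apply: ge0_le_integral => //.
  - by move=> r _; apply: integral_ge0.
  - apply: measurable_funTS.
    apply: (@measurable_eint _ _ _ _ _ P setT (fun (r : measurableTypeR R) w => g w r)) => //.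
    apply: (measurableT_comp mg (g := fun x : measurableTypeR R * Omega => (x.2, x.1))).
    by apply: measurable_fun_pair; [exact: measurable_snd|exact: measurable_fst].
  - by apply: measurable_funTS; exact: emeasurable_funM.
  move=> r; rewrite /= in_itv/= => /andP[r0 rh].
  rewrite (_ : (\int[P]_w g w r = j.+1%:R%:E * \int[P]_w (heat_primitive w r ^+ j * Pi (r :: rs) w)%:E)%E); last first.
    rewrite -ge0_integralZl//; last 2 first.
    - apply/measurable_EFinP; apply: measurable_funM.
        by apply: measurable_funX; exact: (measurableT_comp measurable_heat_primitive (pair2_measurable (r : measurableTypeR R))).
      by apply: (measurable_heat_prod hB y eps s0) => u; rewrite inE => /orP[/eqP ->//|]; exact: rs0.
    - by move=> w _; rewrite lee_fin mulr_ge0 ?heat_prod_ge0// exprn_ge0// heat_primitive_ge0.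
    apply: eq_integral => w _; rewrite -EFinM /g heat_pathE//; congr (_%:E).
    by rewrite /heat_prod big_cons; ring.
  have sn' : (j + size (r :: rs) <= n)%N by rewrite /= addnS.
  have rs0' u : u \in r :: rs -> 0 <= u by rewrite inE => /orP[/eqP ->//|]; exact: rs0.
  have asc' : path <%R (head s (r :: rs)) (behead (rcons (r :: rs) s)).
    move: asc rh; rewrite /h; case: (rs) => [|u us] /=; first by move=> _ ->.
    by move=> -> ->.
  apply: le_trans (lee_wpmul2l _ (IH _ sn' rs0' asc')) _; first by rewrite lee_fin.
  rewrite -!EFinM lee_fin -/D /= -/h le_eqVlt; apply/orP; left; apply/eqP; ring.
have c0 : 0 <= j.+1%:R * (j`!%:R * D ^+ j * K * gprod rs).
  apply: mulr_ge0 => //; apply: mulr_ge0; last by apply: gap_prod_ge0.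
  by apply: mulr_ge0; [apply: mulr_ge0 => //; exact: exprn_ge0|exact: K0].
rewrite ge0_integralZl//=; last 2 first.
- exact: measurable_funTS.
- by move=> r _; rewrite lee_fin powR_ge0.
apply: le_trans (lee_wpmul2l _ (integral_gap_powR h0 hT)) _; first by rewrite lee_fin.
rewrite -EFinM lee_fin factS natrM exprS /D le_eqVlt; apply/orP; left; apply/eqP; ring.
Qed.

End heat_moments.

(** * Moments of the double integral, uniformly in [eps] *)

Section approximation_moments.
Context (R : realType) d (Omega : measurableType d) (P : probability Omega R) (H T : R)
  (B : R -> Omega -> R).
Hypotheses (H0 : 0 < H) (H1 : H < 1) (T0 : 0 < T) (hB : is_fBm H P B).
Notation mu := (@lebesgue_measure R).

Lemma ler_tangent_pow (n : nat) (x m : R) : 0 <= x -> 0 <= m ->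
  m ^+ n.+1 + n.+1%:R * m ^+ n * (x - m) <= x ^+ n.+1.
Proof.
move=> x0 m0; elim: n => [|n IH]; first by rewrite expr0 !mul1r !expr1 addrC subrK.
rewrite exprS [leRHS]exprS; apply: le_trans (ler_wpM2l x0 IH).
rewrite -subr_ge0 exprS -[n.+2%:R]natr1.
have -> : x * (m * m ^+ n + n.+1%:R * m ^+ n * (x - m)) -
   (m * (m * m ^+ n) + (n.+1%:R + 1) * (m * m ^+ n) * (x - m)) = n.+1%:R * m ^+ n * (x - m) ^+ 2 by ring.
by apply: mulr_ge0; [rewrite mulr_ge0// exprn_ge0|exact: sqr_ge0].
Qed.

Lemma dint_eq (t : R) (h h' : R -> R -> R) : (forall r s, 0 < r -> r < s -> s < t -> h r s = h' r s) ->
  dint t h = dint t h'.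
Proof.
move=> hh; rewrite /dint; apply: eq_integral => s /set_mem/=; rewrite in_itv/= => /andP[s0 st].
apply: eq_integral => r /set_mem/=; rewrite in_itv/= => /andP[r0 rs].
by rewrite hh.
Qed.

Lemma alpha_epsE eps t y w : alpha_eps B eps t y w =
  fine (dint t (fun r s => heat eps (fbm_path B w s - fbm_path B w r - y))).
Proof.
rewrite /alpha_eps; have <- : dint t (fun r s => heat eps (B s w - B r w - y)) =
    dint t (fun r s => heat eps (fbm_path B w s - fbm_path B w r - y)); last by [].
apply: dint_eq => r s r0 rs st.
by rewrite (fbm_pathE B w (ltW r0)) (fbm_pathE B w (ltW (lt_trans r0 rs))).
Qed.

(** The inner integral of [dint] at the outer time [s]: a primitive evaluated at the very time to
    which it is pinned. *)
Definition heat_column (eps y : R) (w : Omega) (s : R) : R := heat_primitive B s y eps w s.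

Section fixed_eps.
Variables (eps y : R).
Hypothesis (eps0 : 0 < eps).
Let M := (Num.sqrt (2 * pi * eps))^-1.
Let M0 : 0 <= M. Proof. by rewrite invr_ge0 sqrtr_ge0. Qed.

Lemma measurable_heat_column :
  measurable_fun [set: Omega * measurableTypeR R] (fun z => heat_column eps y z.1 z.2).
Proof.
pose g (z : Omega * measurableTypeR R) (r : measurableTypeR R) : R :=
  if (0 <= r) && (r <= z.2) then heat_path B z.2 y eps z.1 r else 0.
rewrite (_ : (fun z => _) = fun z => \int[mu]_r g z r); last first.
  apply/funext => z; rewrite /heat_column /heat_primitive Rintegral_mkcond; apply: eq_Rintegral => r _.
  rewrite patchE /g (_ : (r \in `[0, z.2]%classic) = (0 <= r <= z.2))//.
  by apply/idP/idP; rewrite inE/= in_itv/=.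
apply: (measurable_Rint mu (f := g)) => //.
apply: measurable_fun_ifT => //.
  apply: measurable_and; apply: measurable_fun_ler => //.
  exact: (measurableT_comp measurable_snd measurable_fst).
apply: (measurableT_comp (measurable_heat eps)); apply: measurable_funB => //.
apply: (measurableT_comp (measurable_fbm_increment hB) (g := fun x : (Omega * measurableTypeR R) * measurableTypeR R => (x.1.1, (x.1.2, x.2)))).
apply: measurable_fun_pair; first exact: (measurableT_comp measurable_fst measurable_fst).
by apply: measurable_fun_pair; [exact: (measurableT_comp measurable_snd measurable_fst)|exact: measurable_snd].
Qed.

Lemma heat_column_ge0 w s : 0 <= heat_column eps y w s.
Proof. exact: heat_primitive_ge0. Qed.

Lemma heat_columnE w s : ((heat_column eps y w s)%:E =
  \int[mu]_(r in `]0%R, s[) (heat eps (fbm_path B w s - fbm_path B w r - y))%:E)%E.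
Proof.
rewrite /heat_column /heat_primitive EFin_Rintegral//; last first.
  apply: continuous_compact_integrable; first exact: segment_compact.
  apply: continuous_subspaceT; exact: (continuous_heat_path hB).
apply: integral_itv_bndoo; apply: measurable_funTS; apply/measurable_EFinP.
by apply: continuous_measurable_fun; exact: (continuous_heat_path hB).
Qed.

Lemma heat_column_le w s : 0 <= s -> heat_column eps y w s <= M * s.
Proof.
move=> s_; rewrite -lee_fin heat_columnE.
apply: (@le_trans _ _ (\int[mu]_(r in `]0%R, s[) M%:E)%E).
  apply: ge0_le_integral => //.
  - by move=> r _; rewrite lee_fin heat_ge0.
  - apply: measurable_funTS; apply/measurable_EFinP.
    by apply: continuous_measurable_fun; exact: (continuous_heat_path hB).
  - by move=> r _; rewrite lee_fin (le_trans (ler_norm _))// heat_le_heat0.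
rewrite integral_cst//= lebesgue_measure_itv/= lte_fin; case: ltP => _.
  by rewrite oppr0 adde0 -EFinM.
by rewrite mule0 lee_fin mulr_ge0.
Qed.

Lemma alpha_eps_column t w : 0 <= t ->
  alpha_eps B eps t y w = \int[mu]_(s in `]0, t[) heat_column eps y w s.
Proof.
move=> t0; rewrite alpha_epsE /dint /Rintegral; congr fine; apply: eq_integral => s _.
by rewrite heat_columnE.
Qed.

Lemma alpha_eps_ge0 t w : 0 <= t -> 0 <= alpha_eps B eps t y w.
Proof. by move=> t0; rewrite alpha_eps_column//; apply: Rintegral_ge0 => s _; exact: heat_column_ge0. Qed.

Lemma measurable_alpha_eps t : 0 <= t -> measurable_fun setT (alpha_eps B eps t y).
Proof.
move=> t0; rewrite (_ : alpha_eps B eps t y = fun w => \int[mu]_(s in `]0, t[) heat_column eps y w s); last first.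
  by apply/funext => w; exact: alpha_eps_column.
by apply: (measurable_Rint mu (f := heat_column eps y)); [exact: measurable_itv|exact: measurable_heat_column].
Qed.

(* Jensen's inequality, by comparison with the tangent of [x ^+ n.+1] at the mean. *)
Lemma alpha_eps_pow_le (n : nat) t w : 0 < t ->
  ((alpha_eps B eps t y w ^+ n.+1)%:E <= (t ^+ n)%:E * \int[mu]_(s in `]0%R, t[) (heat_column eps y w s ^+ n.+1)%:E)%E.
Proof.
move=> t0; have mI : measurable (`]0%R, t[%classic : set (measurableTypeR R)) by exact: measurable_itv.
have mc : measurable_fun setT (heat_column eps y w) by exact: (measurableT_comp measurable_heat_column (pair1_measurable w)).
have tE : mu `]0%R, t[ = t%:E.
  by rewrite lebesgue_measure_itv/= lte_fin t0 oppr0 adde0.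
have fI : (mu `]0%R, t[ < +oo)%E by rewrite tE ltry.
set a := alpha_eps B eps t y w; pose m := a / t.
have a0 : 0 <= a by apply: alpha_eps_ge0; exact: ltW.
have m0 : 0 <= m by rewrite divr_ge0// ltW.
have cM s : `]0, t[%classic s -> 0 <= heat_column eps y w s <= M * t.
  rewrite /= in_itv/= => /andP[s_ st]; rewrite heat_column_ge0/= (le_trans (heat_column_le w (ltW s_)))//.
  by rewrite ler_wpM2l// ltW.
have ic : mu.-integrable `]0%R, t[ (EFin \o heat_column eps y w).
  apply: (integrable_bounded_on (M := M * t) mI fI mc).
  by move=> s /cM /andP[h1 h2]; rewrite ger0_norm.
have icn : mu.-integrable `]0%R, t[ (EFin \o (fun s => heat_column eps y w s ^+ n.+1)).
  apply: (integrable_bounded_on (M := (M * t) ^+ n.+1) mI fI (measurable_funX n.+1 mc)).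
  by move=> s /cM /andP[h1 h2]; rewrite ger0_norm ?exprn_ge0// lerXn2r ?nnegrE// (le_trans h1).
rewrite -EFin_Rintegral// -EFinM lee_fin.
have icst (c : R) : mu.-integrable `]0%R, t[ (EFin \o (fun=> c)).
  exact: (integrable_bounded_on (M := `|c|) mI fI (measurable_cst c)).
have lin : \int[mu]_(s in `]0, t[) (m ^+ n.+1 + n.+1%:R * m ^+ n * (heat_column eps y w s - m)) = t * m ^+ n.+1.
  have iB : mu.-integrable `]0%R, t[ (EFin \o (fun s => heat_column eps y w s - m)).
    by have := integrableB mI ic (icst m); exact.
  have iZ : mu.-integrable `]0%R, t[ (EFin \o (fun s => n.+1%:R * m ^+ n * (heat_column eps y w s - m))).
    by have := integrableZl mI (n.+1%:R * m ^+ n) iB; exact.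
  rewrite RintegralD// RintegralZl// RintegralB// !Rintegral_cst// -alpha_eps_column ?(ltW t0)//.
  rewrite (_ : fine (mu `]0%R, t[) = t); last by rewrite tE.
  rewrite -/a (_ : a - m * t = 0) ?mulr0 ?addr0 1?mulrC//.
  by rewrite /m mulrCA divff ?mulr1 ?subrr// gt_eqF.
have : t * m ^+ n.+1 <= \int[mu]_(s in `]0, t[) (heat_column eps y w s ^+ n.+1).
  rewrite -lin; apply: le_Rintegral => //; last by move=> s _; apply: ler_tangent_pow => //; exact: heat_column_ge0.
  have iB := integrableZl mI (n.+1%:R * m ^+ n) (integrableB mI ic (icst m)).
  by have := integrableD mI (icst (m ^+ n.+1)) iB; exact.
move/(ler_wpM2l (exprn_ge0 n (ltW t0))); apply: le_trans.
by rewrite mulrA -exprSr -exprMn /m mulrCA divff ?gt_eqF// mulr1.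
Qed.

End fixed_eps.

Lemma alpha_eps_moment (n : nat) : exists C : R, 0 <= C /\ forall eps t y, 0 < eps -> 0 <= t <= T ->
  (\int[P]_w (alpha_eps B eps t y w ^+ n.+1)%:E <= C%:E)%E.
Proof.
have [k k0 lnd] := local_nondeterminism H0 H1.
pose D := strip_const k n.+1 * (T `^ (1 - H) / (1 - H)).
have D0 : 0 <= D by rewrite mulr_ge0 ?strip_const_ge0// divr_ge0 ?powR_ge0// subr_ge0 ltW.
pose C := (n.+1)`!%:R * D ^+ n.+1.
have C0 : 0 <= C by rewrite mulr_ge0// exprn_ge0.
exists (T ^+ n.+1 * C); split; first by rewrite mulr_ge0 ?exprn_ge0// ltW.
move=> eps t y eps0 /andP[]; rewrite le_eqVlt => /predU1P[<- _|t0 tT].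
  rewrite integral0_eq ?lee_fin ?mulr_ge0 ?exprn_ge0 ?(ltW T0)// => w _.
  by rewrite alpha_eps_column// set_itvoo0 Rintegral_set0 expr0n.
have mI : measurable (`]0%R, t[%classic : set (measurableTypeR R)) by exact: measurable_itv.
pose g w s : \bar R := ((heat_column eps y w s) ^+ n.+1)%:E.
have g0 w s : (0 <= g w s)%E by rewrite lee_fin exprn_ge0// heat_column_ge0.
have mg : measurable_fun [set: Omega * measurableTypeR R] (fun z => g z.1 z.2).
  by apply/measurable_EFinP; apply: measurable_funX; exact: measurable_heat_column.
apply: (@le_trans _ _ (\int[P]_w ((t ^+ n)%:E * \int[mu]_(s in `]0%R, t[) g w s))%E).
  apply: ge0_le_integral => //.
  - by move=> w _; rewrite lee_fin exprn_ge0// alpha_eps_ge0// ltW.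
  - by apply/measurable_EFinP; apply: measurable_funX; apply: measurable_alpha_eps => //; exact: ltW.
  - by apply: emeasurable_funM => //; exact: (measurable_eint mu mI mg g0).
  - by move=> w _; exact: alpha_eps_pow_le.
rewrite ge0_integralZl//=; last 3 first.
- exact: (measurable_eint mu mI mg g0).
- by move=> w _; exact: integral_ge0.
- by rewrite lee_fin exprn_ge0// ltW.
rewrite (tonelli_on P mu measurableT mI mg g0).
apply: (@le_trans _ _ ((t ^+ n)%:E * \int[mu]_(s in `]0%R, t[) C%:E)%E).
  rewrite lee_wpmul2l ?lee_fin ?exprn_ge0 ?(ltW t0)//; apply: ge0_le_integral => //.
  - by move=> s _; exact: integral_ge0.
  - apply: measurable_funTS.
    apply: (@measurable_eint _ _ _ _ _ P setT (fun (s : measurableTypeR R) w => g w s)) => //.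
    apply: (measurableT_comp mg (g := fun x : measurableTypeR R * Omega => (x.2, x.1))).
    by apply: measurable_fun_pair; [exact: measurable_snd|exact: measurable_fst].
  move=> s; rewrite /= in_itv/= => /andP[s_ st].
  have := @expectation_primitive_heat_prod _ _ _ _ _ _ H1 hB k s y eps n.+1 k0 (ltW s_) eps0 (ltn0Sn n) lnd T n.+1 [::].
  rewrite addn0 leqnn => /(_ (ltW (lt_le_trans st tT)) isT) h.
  have /= := h _ _; rewrite mulr1; under eq_integral do rewrite /heat_prod big_nil mulr1.
  by apply.
rewrite integral_cst//= lebesgue_measure_itv/= lte_fin t0 oppr0 adde0 -!EFinM lee_fin.
rewrite mulrCA [leRHS]mulrC ler_wpM2l// -exprSr lerXn2r// nnegrE ltW//.
Qed.

End approximation_moments.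

(** * Convergence in [L^p] from almost sure convergence and bounded moments *)

Section Lp_convergence.
Context (R : realType) d (Omega : measurableType d) (P : probability Omega R).

(** Above the level [N], the exponent [n.+1 - p] is at least [1], so replacing z ^ p by the higher
    power gains a factor [N]. A bounded moment of order [n.+1] thus controls the tail. *)
Lemma powR_truncation (N z p : R) (n : nat) : 1 <= N -> 0 <= z -> 0 < p -> p + 1 <= n.+1%:R ->
  z `^ p <= Num.min z N `^ p + z ^+ n.+1 / N.
Proof.
move=> N1 z0 p0 pn; have N0 : 0 < N by exact: lt_le_trans N1.
have [zN|Nz] := leP z N; first by rewrite lerDl divr_ge0// ?exprn_ge0// ltW.
have zp : 0 < z by exact: lt_trans Nz.
apply: (@le_trans _ _ (z ^+ n.+1 / N)); last by rewrite lerDr powR_ge0.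
rewrite ler_pdivlMr//; apply: (@le_trans _ _ (z `^ p * z `^ (n.+1%:R - p))).
  rewrite ler_wpM2l ?powR_ge0//; apply: (le_trans (ltW Nz)).
  rewrite -[leLHS]powRr1//; apply: ler_powR; first by rewrite (le_trans N1)// ltW.
  by rewrite lerBrDr addrC.
by rewrite -powRD ?(gt_eqF zp) ?implybT// addrC subrK powR_mulrn// ltW.
Qed.

Lemma exprD_le (x y : R) (n : nat) : 0 <= x -> 0 <= y -> (x + y) ^+ n <= 2 ^+ n * (x ^+ n + y ^+ n).
Proof.
wlog xy : x y / x <= y.
  move=> h x0 y0; have [|/ltW] := leP x y => xy; first exact: h.
  by rewrite addrC [X in _ * X]addrC; exact: h.
move=> x0 y0; apply: (@le_trans _ _ (2 ^+ n * y ^+ n)); last by rewrite ler_wpM2l ?exprn_ge0// lerDr exprn_ge0.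
by rewrite -exprMn lerXn2r ?nnegrE ?addr_ge0 ?mulr_ge0// mulr2n mulrDl !mul1r lerD2r.
Qed.

Variables (X : nat -> Omega -> R) (Y : Omega -> R).
Hypotheses (mX : forall k, measurable_fun setT (X k)) (mY : measurable_fun setT Y)
  (X0 : forall k w, 0 <= X k w) (XY : {ae P, forall w, X k w @[k --> \oo] --> Y w})
  (XC : forall n, exists C : R, 0 <= C /\ forall k, (\int[P]_w (X k w ^+ n.+1)%:E <= C%:E)%E).

(** Fatou's lemma; the absolute value is there because [Y] is known to be nonnegative only almost
    surely. *)
Let limit_moment (n : nat) (C : R) : (forall k, \int[P]_w (X k w ^+ n.+1)%:E <= C%:E)%E ->
  (\int[P]_w (`|Y w| ^+ n.+1)%:E <= C%:E)%E.
Proof.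
move=> hC; have mXn k : measurable_fun setT (fun w => (X k w ^+ n.+1)%:E).
  by apply/measurable_EFinP; exact: measurable_funX.
have Xn0 k w : (0 <= (X k w ^+ n.+1)%:E)%E by rewrite lee_fin exprn_ge0.
apply: (@le_trans _ _ (\int[P]_w limn_einf (fun k => (X k w ^+ n.+1)%:E))%E).
  rewrite le_eqVlt; apply/orP; left; apply/eqP; apply: ae_eq_integral => //.
  - by apply/measurable_EFinP; apply: measurable_funX; apply: measurableT_comp => //.
  - rewrite (_ : (fun w => _) = fun w => (- limn_esup (fun k => - (X k w ^+ n.+1)%:E))%E); last first.
      by apply/funext => w; rewrite -limn_einfN; congr limn_einf; apply/funext => k; rewrite /= opprK.
    apply: measurableT_comp => //; apply: measurable_fun_limn_esup => k.
    by apply: measurableT_comp => //; exact: mXn.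
  apply: filterS XY => w cw _; rewrite /=.
  have h : (X k w ^+ n.+1)%:E @[k --> \oo] --> (`|Y w| ^+ n.+1)%:E.
    apply: cvg_EFin; first exact: nearW.
    have Y0 : 0 <= Y w by apply: (cvgr_to_ge cw); exact: nearW.
    by rewrite ger0_norm//; exact: (cvg_comp _ _ cw (@exprn_continuous _ n.+1 (Y w))).
  by have [-> _] := cvg_limn_einf_sup h.
apply: le_trans (fatou P measurableT mXn (fun k w _ => Xn0 k w)) _.
rewrite limn_einf_lim; apply: lime_le; first exact: is_cvg_einfs.
by apply: nearW => k; apply: le_trans (hC k); apply: ereal_inf_lbound; exists k => /=.
Qed.

(** Uniform integrability: for fixed [N] the truncated distances [m N k] tend to zero by dominated
    convergence, and the tail is at most [C' / N] whatever [k] is. *)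
Lemma Lp_cvg_of_moments (p : R) : 0 < p ->
  (\int[P]_w (`|X k w - Y w| `^ p)%:E @[k --> \oo] --> 0)%E.
Proof.
move=> p0; pose n := (Num.truncn p).+1.
have pn : p + 1 <= n.+1%:R.
  by rewrite /n -[in leRHS]natr1 lerD2r ltW// truncnS_gt.
have [C [C0 hC]] := XC n; have hY := limit_moment hC.
pose Z k w := `|X k w - Y w|.
have Z0 k w : 0 <= Z k w by exact: normr_ge0.
have mZ k : measurable_fun setT (Z k).
  by apply: measurableT_comp; [exact: normr_measurable|exact: measurable_funB].
pose C' := 2 ^+ n.+1 * (C + C).
have C'0 : 0 <= C' by rewrite mulr_ge0 ?exprn_ge0// addr_ge0.
have hZ k : (\int[P]_w (Z k w ^+ n.+1)%:E <= C'%:E)%E.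
  apply: (@le_trans _ _ (\int[P]_w ((2 ^+ n.+1)%:E * ((X k w ^+ n.+1)%:E + (`|Y w| ^+ n.+1)%:E)))%E).
    apply: ge0_le_integral => //.
    - by move=> w _; rewrite lee_fin exprn_ge0.
    - by apply/measurable_EFinP; exact: measurable_funX.
    - apply: emeasurable_funM => //; apply: emeasurable_funD; apply/measurable_EFinP; apply: measurable_funX => //.
      exact: measurableT_comp.
    move=> w _; rewrite -EFinD -EFinM lee_fin.
    have : Z k w <= X k w + `|Y w| by rewrite /Z (le_trans (ler_normB _ _))// ger0_norm.
    move=> h; apply: le_trans (lerXn2r _ _ _ h) _; rewrite ?nnegrE ?addr_ge0//.
    exact: exprD_le.
  rewrite ge0_integralZl//=; last 2 first.
  - apply: emeasurable_funD; apply/measurable_EFinP; apply: measurable_funX => //.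
    exact: measurableT_comp.
  - by move=> w _; rewrite adde_ge0// lee_fin exprn_ge0.
  rewrite ge0_integralD//=.
  - by rewrite /C' [leRHS]EFinM EFinD lee_wpmul2l ?lee_fin ?exprn_ge0// leeD.
  - by move=> w _; rewrite lee_fin exprn_ge0.
  - by apply/measurable_EFinP; exact: measurable_funX.
  - by apply/measurable_EFinP; apply: measurable_funX; exact: measurableT_comp.
pose m (N : R) k := (\int[P]_w (Num.min (Z k w) N `^ p)%:E)%E.
have mmin N k : measurable_fun setT (fun w => Num.min (Z k w) N `^ p).
  apply: (measurableT_comp (measurable_powR p)).
  by apply: (@measurable_minr _ _ _ _ (Z k) (fun=> N)).
have min0 (N : R) k w : 1 <= N -> 0 <= Num.min (Z k w) N by move=> N1; rewrite le_min Z0 (le_trans ler01 N1).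
have cm N : 1 <= N -> (m N k @[k --> \oo] --> 0)%E.
  move=> N1; have N0 : 0 <= N by exact: le_trans N1.
  have ig : P.-integrable setT (EFin \o cst (N `^ p)) by exact: finite_measure_integrable_cst.
  have mk k : measurable_fun setT (fun w => (Num.min (Z k w) N `^ p)%:E) by apply/measurable_EFinP.
  have m0 : measurable_fun setT (cst 0%E : Omega -> \bar R) by exact: measurable_cst.
  have cae : {ae P, forall w, setT w -> (Num.min (Z k w) N `^ p)%:E @[k --> \oo] --> 0%E}.
    apply: filterS XY => w cw _; apply: cvg_EFin; first exact: nearW.
    apply/cvgrPdist_le => e e0; have e1 : 0 < e `^ p^-1 by rewrite powR_gt0.
    have /cvgrPdist_le /(_ _ e1) := cw; apply: filterS => k /= h.
    rewrite sub0r normrN ger0_norm ?powR_ge0//.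
    have -> : e = (e `^ p^-1) `^ p by rewrite -powRrM mulVf ?gt_eqF// powRr1// ltW.
    apply: ge0_ler_powR; rewrite ?nnegrE ?min0 ?powR_ge0//; first exact: ltW.
    by rewrite ge_min /Z distrC h.
  have dom : {ae P, forall w k, setT w -> (`|(Num.min (Z k w) N `^ p)%:E| <= (N `^ p)%:E)%E}.
    apply: nearW => w k _; rewrite gee0_abs ?lee_fin ?powR_ge0//.
    by apply: ge0_ler_powR; rewrite ?nnegrE ?min0// ?(ltW p0)// ge_min lexx orbT.
  have [_ _] := dominated_convergence measurableT mk m0 cae ig dom.
  by rewrite integral0.
have aN N k : 1 <= N -> (\int[P]_w (Z k w `^ p)%:E <= m N k + (C' / N)%:E)%E.
  move=> N1; have N0 : 0 < N by exact: lt_le_trans N1.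
  apply: (@le_trans _ _ (\int[P]_w ((Num.min (Z k w) N `^ p)%:E + (N^-1)%:E * (Z k w ^+ n.+1)%:E))%E).
    apply: ge0_le_integral => //.
    - by move=> w _; rewrite lee_fin powR_ge0.
    - by apply/measurable_EFinP; exact: (measurableT_comp (measurable_powR p)).
    - apply: emeasurable_funD; first by apply/measurable_EFinP; exact: mmin.
      by apply: emeasurable_funM => //; apply/measurable_EFinP; exact: measurable_funX.
    by move=> w _; rewrite -EFinM -EFinD lee_fin mulrC; exact: powR_truncation.
  rewrite ge0_integralD//=.
  - rewrite leeD// ge0_integralZl//=.
    + by rewrite mulrC EFinM lee_wpmul2l ?lee_fin ?invr_ge0 ?(ltW N0).
    + by apply/measurable_EFinP; exact: measurable_funX.
    + by move=> w _; rewrite lee_fin exprn_ge0.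
    + by rewrite lee_fin invr_ge0 ltW.
  - by move=> w _; rewrite lee_fin powR_ge0.
  - by apply/measurable_EFinP; exact: mmin.
  - by move=> w _; rewrite -EFinM lee_fin mulr_ge0 ?exprn_ge0// invr_ge0 ltW.
  - by apply: emeasurable_funM => //; apply/measurable_EFinP; exact: measurable_funX.
have a0 k : (0 <= \int[P]_w (Z k w `^ p)%:E)%E by apply: integral_ge0 => w _; rewrite lee_fin powR_ge0.
have afin N k : 1 <= N -> m N k \is a fin_num -> (\int[P]_w (Z k w `^ p)%:E)%E \is a fin_num.
  move=> N1 mf; rewrite ge0_fin_numE// (le_lt_trans (aN N k N1))// lte_add_pinfty ?ltry//.
  by rewrite ltey_eq mf.
apply/fine_cvgP; split.
  have /fine_cvgP[h _] := cm 1 (lexx 1); apply: filterS h => k; exact: (afin 1 k (lexx 1)).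
apply/cvgrPdist_le => e e0.
pose N := Num.max 1 (C' / (e / 2)).
have N1 : 1 <= N by rewrite le_max lexx.
have N0 : 0 < N by exact: lt_le_trans N1.
have CN : C' / N <= e / 2.
  by rewrite ler_pdivrMr// mulrC -ler_pdivrMr ?divr_gt0// le_max lexx orbT.
have /fine_cvgP[hf /cvgrPdist_le hm] := cm N N1.
have e2 : 0 < e / 2 by rewrite divr_gt0.
near=> k; rewrite /= sub0r normrN ger0_norm; last exact: fine_ge0 (a0 k).
have mf : m N k \is a fin_num by near: k; exact: hf.
have mle : `|0 - fine (m N k)| <= e / 2 by near: k; exact: hm.
have m0 : (0 <= m N k)%E by apply: integral_ge0 => w _; rewrite lee_fin powR_ge0.
rewrite sub0r normrN ger0_norm ?fine_ge0// in mle.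
rewrite [leRHS]splitr; apply: le_trans (lerD mle CN).
rewrite -lee_fin EFinD (fineK mf) (fineK (afin N k N1 mf)); exact: aN.
Unshelve. all: by end_near. Qed.

End Lp_convergence.

(** * The local time as a random field *)

Section self_intersection_local_time.
Context (R : realType) d (Omega : measurableType d) (P : probability Omega R) (H T : R)
  (B : R -> Omega -> R).
Hypotheses (H0 : 0 < H) (H1 : H < 1) (T0 : 0 < T) (hB : is_fBm H P B).
Notation mu := (@lebesgue_measure R).

Definition fbm_local_time (t y : R) (w : Omega) : R := path_local_time (fbm_path B w) t y.

Lemma measurable_fbm_local_time t y : measurable_fun setT (fbm_local_time t y).
Proof.
apply: measurable_funM => //.
have swap (f : measurableTypeR R * Omega -> R) : measurable_fun setT f ->
    measurable_fun [set: Omega * measurableTypeR R] (fun x => f (x.2, x.1)).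
  move=> mf; apply: (measurableT_comp mf (g := fun x : Omega * measurableTypeR R => (x.2, x.1))).
  by apply: measurable_fun_pair; [exact: measurable_snd|exact: measurable_fst].
have mpy : measurable_fun [set: Omega * measurableTypeR R] (fun x => (x.2 : R) * y).
  by apply: measurable_funM => //; exact: measurable_snd.
apply: (measurable_Rint mu (f := fun w (p : measurableTypeR R) =>
  cos ((p : R) * y) * cos_transform (@plane_measure R) (simplex t) (path_increment (fbm_path B w)) p +
  sin ((p : R) * y) * sin_transform (@plane_measure R) (simplex t) (path_increment (fbm_path B w)) p)) => //.
apply: measurable_funD; apply: measurable_funM.
- exact: (measurableT_comp (@measurable_cos R) mpy).
- exact: (swap _ (measurable_fbm_cos_transform hB (@measurable_simplex R t))).
- exact: (measurableT_comp (@measurable_sin R) mpy).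
- exact: (swap _ (measurable_fbm_sin_transform hB (@measurable_simplex R t))).
Qed.

Lemma cvg_fbm_local_time t y : 0 <= t <= T ->
  {ae P, forall w, alpha_eps B eps t y w @[eps --> 0^'+] --> fbm_local_time t y w}.
Proof.
move=> tT; apply: filterS (fbm_dominated_transform H0 H1 T0 hB) => w hw.
have := cvg_path_local_time H0 H1 T0 (@continuous_fbm_path _ _ _ _ _ _ hB w) hw (y := y) tT.
by apply: cvg_trans; apply: near_eq_cvg; apply: nearW => eps; rewrite alpha_epsE.
Qed.

Lemma Lp_cvg_fbm_local_time t y p : 0 <= t <= T -> 0 < p ->
  (\int[P]_w (`|alpha_eps B eps t y w - fbm_local_time t y w| `^ p)%:E)%E @[eps --> 0^'+] --> 0%E.
Proof.
move=> tT p0; have /andP[t0 _] := tT.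
apply/(cvge_at_rightP _ _ 0) => u [u0 cu].
apply: (@Lp_cvg_of_moments _ _ _ P (fun k => alpha_eps B (u k) t y)) => //.
- by move=> k; exact: (measurable_alpha_eps hB (u k) y t0).
- exact: measurable_fbm_local_time.
- by move=> k w; exact: (alpha_eps_ge0 hB (u k) y w t0).
- apply: filterS (cvg_fbm_local_time y tT) => w /cvg_at_rightP; exact.
- move=> n; have [C [C0 hC]] := alpha_eps_moment H0 H1 T0 hB n.
  by exists C; split => // k; exact: hC.
Qed.

End self_intersection_local_time.

Theorem theorem1 (R : realType) (d : measure_display) (Omega : measurableType d)
    (P : probability Omega R) (H T : R) (B : R -> Omega -> R) :
  0 < H -> H < 1 -> 0 < T -> is_fBm H P B ->
  exists alpha : R -> R -> Omega -> R,
    (* existence of the limit, a.s. and in L^p for every p in (0, oo) *)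
    (forall t y, 0 <= t <= T ->
       [/\ measurable_fun setT (alpha t y),
           {ae P, forall w,
              alpha_eps B eps t y w @[eps --> 0^'+] --> alpha t y w} &
           forall p : R, 0 < p ->
              (\int[P]_w (`|alpha_eps B eps t y w - alpha t y w| `^ p)%:E)%E
                @[eps --> 0^'+] --> 0%E]) /\
    (* a modification with the stated regularity and occupation formula *)
    exists alpha' : R -> R -> Omega -> R,
      [/\ (forall t y, 0 <= t <= T ->
             measurable_fun setT (alpha' t y) /\
             {ae P, forall w, alpha' t y w = alpha t y w}),
          {ae P, forall w, forall gam : R, 0 < gam -> gam < 1 - H ->
             exists C : R, forall y y' t t', 0 <= t <= T -> 0 <= t' <= T ->
               `|alpha' t y w - alpha' t' y' w| <= C * (`|y - y'| + `|t - t'|) `^ gam},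
          {ae P, forall w, forall gam : R, 0 < gam -> gam < Num.min (H^-1 - 1) 1 ->
             forall t, 0 <= t <= T ->
             exists C : R, forall y y',
               `|alpha' t y w - alpha' t y' w| <= C * `|y - y'| `^ gam} &
          forall g : R -> R, continuous g -> forall t, 0 <= t <= T ->
             {ae P, forall w,
                dint t (fun r s => g (B s w - B r w)) =
                (\int[lebesgue_measure]_(y in setT) (g y * alpha' t y w)%:E)%E}].
Proof.
move=> H0 H1 T0 hB; have hG := fbm_dominated_transform H0 H1 T0 hB.
have cb := @continuous_fbm_path _ _ _ _ _ _ hB.
exists (fbm_local_time B); split.
  move=> t y tT; split; first exact: (measurable_fbm_local_time hB).
    exact: (cvg_fbm_local_time H0 H1 T0 hB).
  by move=> p p0; exact: (Lp_cvg_fbm_local_time H0 H1 T0 hB).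
(* [fbm_local_time] is defined by Fourier inversion for all [t] and [y], and the event of [hG]
   depends on neither, so the field already has the required regularity and is its own
   modification. *)
exists (fbm_local_time B); split.
- move=> t y tT; split; first exact: (measurable_fbm_local_time hB).
  exact: nearW.
- apply: filterS hG => w hw gam g0 g1.
  exact: (path_local_time_joint H0 H1 T0 (cb w) hw g0 g1).
- apply: filterS hG => w hw gam g0; rewrite lt_min => /andP[gH g1] t tT.
  have [C [_ hC]] := path_local_time_space H0 H1 T0 (cb w) hw (ltW g0) (ltW g1) gH.
  by exists C => y y'; exact: hC.
- move=> g cg t tT; apply: filterS hG => w hw.
  rewrite -(path_occupation_formula H0 H1 T0 (cb w) hw tT cg).
  apply: dint_eq => r s r0 rs st.
  by rewrite (fbm_pathE B w (ltW r0)) (fbm_pathE B w (ltW (lt_trans r0 rs))).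
Qed.
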